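(* Let $M$ be a loopless sparse paving matroid of rank $d$ on $m+d$ elements, and let $\lambda$ be its number of circuit-hyperplanes. Then the Kazhdan--Lusztig polynomial $P_M(t)$ is unimodal. If moreover $d\geq 5$ and $m\geq 1$, then $P_M(t)$ is strictly unimodal unless $$(m,d,\lambda)\in\{(4,5,3),\ (5,5,25),\ (6,5,66)\}.$$ In each of these three cases, the two nonconstant coefficients of $P_M(t)$ (those of $t$ and $t^2$) are equal.
   Context: A matroid of rank $d$ is paving if every circuit has at least $d$ elements; it is sparse paving if both it and its dual are paving. A circuit-hyperplane is a subset of the ground set that is both a circuit and a hyperplane. For a loopless matroid $M$, let $L(M)$ be its lattice of flats, $\chi_M(t)$ its characteristic polynomial and $\operatorname{rk}M$ its rank. The Kazhdan--Lusztig polynomials $P_M(t)\in\mathbb Z[t]$ of loopless matroids are uniquely determined by: (i) $P_M(t)=1$ if $\operatorname{rk}M=0$; (ii) $\deg P_M(t)<\operatorname{rk}M/2$ if $\operatorname{rk}M>0$; (iii) $t^{\operatorname{rk}M}P_M(t^{-1})=\sum_{F\in L(M)}\chi_{M_F}(t)P_{M^F}(t)$, where $M_F$ is the restriction of $M$ to $F$ and $M^F$ is the contraction of $M$ by $F$. A finite sequence $(c_0,\ldots,c_s)$ is unimodal if for some $r\in\{0,\ldots,s\}$ one has $c_0\leq\cdots\leq c_r\geq c_{r+1}\geq\cdots\geq c_s$; it is strictly unimodal if for some $r$ one has $c_0<\cdots<c_r>c_{r+1}>\cdots>c_s$. Either chain of inequalities may be empty. These terms are applied to a polynomial via its coefficient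 sequence $(c_0,\dots,c_s)$ ending at its actual degree $s$. *)

(* Defs.v *)
From mathcomp Require Import all_boot all_order all_algebra.
From mathcomp Require Import zify.

Set Implicit Arguments.
Unset Strict Implicit.
Unset Printing Implicit Defensive.

Import Order.TTheory GRing.Theory Num.Theory.

Local Open Scope ring_scope.

Definition matroid_axiom (T : finType) (E : {set T}) (I : {set {set T}}) : bool :=
  [&& [forall A in I, A \subset E],
      set0 \in I,
      [forall A in I, forall B : {set T}, (B \subset A) ==> (B \in I)]
    & [forall A in I, forall B in I, (#|A| < #|B|)%N ==>
         [exists x in B :\: A, x |: A \in I]]].

(* The ground set is an arbitrary subset of [T], so that all minors of a
   matroid have the same type as the matroid itself. *)
Record matroid (T : finType) := Matroid {
  ground : {set T};
  indep : {set {set T}};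
  matroidP : matroid_axiom ground indep
}.

Definition rk (T : finType) (M : matroid T) (A : {set T}) : nat :=
  \max_(I in indep M | I \subset A) #|I|.

Definition rank (T : finType) (M : matroid T) : nat := rk M (ground M).

Definition is_base (T : finType) (M : matroid T) (B : {set T}) : bool :=
  maxset (fun A => A \in indep M) B.

Definition circuit (T : finType) (M : matroid T) (C : {set T}) : bool :=
  minset (fun A => (A \subset ground M) && (A \notin indep M)) C.

Definition flats (T : finType) (M : matroid T) : {set {set T}} :=
  [set F in powerset (ground M) |
    [forall x in ground M :\: F, (rk M F < rk M (x |: F))%N]].

Definition hyperplane (T : finType) (M : matroid T) (H : {set T}) : bool :=
  (H \in flats M) && ((rk M H).+1 == rank M).

Definition circuit_hyperplanes (T : finType) (M : matroid T) : {set {set T}} :=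
  [set H | circuit M H && hyperplane M H].

Definition loopless (T : finType) (M : matroid T) : bool :=
  [forall x in ground M, [set x] \in indep M].

Section MatroidTheory.

Context {T : finType}.
Implicit Types (M N : matroid T) (A B F G H I J : {set T}).

Lemma eq_matroid M N : ground M = ground N -> indep M = indep N -> M = N.
Proof.
case: M N => [E1 I1 p1] [E2 I2 p2] /= eE eI; move: p1 p2; rewrite eE eI => p1 p2.
by rewrite (bool_irrelevance p1 p2).
Qed.

Lemma indep_ground M A : A \in indep M -> A \subset ground M.
Proof. by case/and4P: (matroidP M) => /forall_inP h _ _ _ /h. Qed.

Lemma indep0 M : set0 \in indep M.
Proof. by case/and4P: (matroidP M). Qed.

Lemma indepS M A B : B \subset A -> A \in indep M -> B \in indep M.
Proof.
case/and4P: (matroidP M) => _ _ /forall_inP h _ sBA /h /forallP /(_ B) /implyP.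
exact.
Qed.

Lemma indep_exchange M A B : A \in indep M -> B \in indep M -> (#|A| < #|B|)%N ->
  exists2 x, x \in B :\: A & x |: A \in indep M.
Proof.
case/and4P: (matroidP M) => _ _ _ /forall_inP h /h /forall_inP hA /hA /implyP hB.
by move=> /hB /exists_inP.
Qed.

Lemma rk_ge M A I : I \in indep M -> I \subset A -> (#|I| <= rk M A)%N.
Proof. by move=> iI sI; rewrite /rk (bigop.bigmax_sup I) ?iI. Qed.

Lemma rk_witness M A :
  exists I, [/\ I \in indep M, I \subset A & #|I| = rk M A].
Proof.
have h0 : (set0 \in indep M) && (set0 \subset A) by rewrite indep0 sub0set.
rewrite /rk (bigop.bigmax_eq_arg set0) //.
case: arg_maxnP => //= I /andP[iI sI] _.
by exists I.
Qed.

Lemma rk_extend M A J : J \in indep M -> J \subset A ->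
  exists I, [/\ I \in indep M, J \subset I, I \subset A & #|I| = rk M A].
Proof.
move=> iJ sJ.
pose P (I : {set T}) := [&& I \in indep M, J \subset I & I \subset A].
have PJ : P J by rewrite /P iJ sJ subxx.
case: (arg_maxnP (fun I : {set T} => #|I|) PJ) => I /and3P[iI sJI sIA] Imax.
exists I; split=> //; apply/eqP; rewrite eqn_leq rk_ge //= leqNgt.
apply/negP => lt; have [W [iW sW eW]] := rk_witness M A.
rewrite -eW in lt; have [x /setDP[xW xI] ixI] := indep_exchange iI iW lt.
have : P (x |: I).
  rewrite /P ixI (subset_trans sJI (subsetUr _ _)) /=.
  by rewrite subUset sub1set (subsetP sW) ?sIA.
by move/Imax; rewrite cardsU1 xI /=; lia.
Qed.

Lemma rk_leq_card M A : (rk M A <= #|A|)%N.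
Proof. by have [I [_ /subset_leq_card sI <-]] := rk_witness M A. Qed.

Lemma rkS M A B : A \subset B -> (rk M A <= rk M B)%N.
Proof.
move=> sAB; have [I [iI sI <-]] := rk_witness M A.
exact/rk_ge/(subset_trans sI).
Qed.

Lemma rk_submod M A B : (rk M (A :|: B) + rk M (A :&: B) <= rk M A + rk M B)%N.
Proof.
have [I [iI sI eI]] := rk_witness M (A :&: B).
have [J [iJ sIJ sJ eJ]] := rk_extend iI (subset_trans sI (subset_trans (subsetIl A B) (subsetUl A B))).
have hA : (#|J :&: A| <= rk M A)%N by rewrite rk_ge ?subsetIr // (indepS _ iJ) ?subsetIl.
have hB : (#|J :&: B| <= rk M B)%N by rewrite rk_ge ?subsetIr // (indepS _ iJ) ?subsetIl.
have hI : (#|I| <= #|(J :&: A) :&: (J :&: B)|)%N.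
  by rewrite subset_leq_card // -setIIr subsetI sIJ.
have := cardsUI (J :&: A) (J :&: B).
have -> : (J :&: A) :|: (J :&: B) = J by rewrite -setIUr; apply/setIidPl.
lia.
Qed.

Lemma indep_rk M A : (A \in indep M) = (A \subset ground M) && (rk M A == #|A|).
Proof.
apply/idP/andP=> [iA|[sA /eqP eA]].
  by rewrite indep_ground // eqn_leq rk_leq_card rk_ge.
have [I [iI sI eI]] := rk_witness M A.
suff -> : A = I by [].
by apply/eqP; rewrite eq_sym eqEcard sI eI eA leqnn.
Qed.

Lemma rk_ground M A : rk M (A :&: ground M) = rk M A.
Proof.
apply/eqP; rewrite eqn_leq rkS ?subsetIl //=.
have [I [iI sI <-]] := rk_witness M A.
by rewrite rk_ge // subsetI sI indep_ground.
Qed.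

Lemma rk0 M : rk M set0 = 0%N.
Proof. by apply/eqP; rewrite -leqn0 -(cards0 T) rk_leq_card. Qed.

Section RankFunction.

Variables (E : {set T}) (r : {set T} -> nat).
Hypotheses (r_card : forall A, (r A <= #|A|)%N)
  (rS : forall A B, A \subset B -> (r A <= r B)%N)
  (r_submod : forall A B, (r (A :|: B) + r (A :&: B) <= r A + r B)%N).

Lemma rank_function_absorb I A : (forall x, x \in A -> r (x |: I) = r I) ->
  r (A :|: I) = r I.
Proof.
have [n] := ubnP #|A|; elim: n A => // n IHn A ltA hA.
have [->|[x xA]] := set_0Vmem A; first by rewrite set0U.
have {}IHn : r (A :\ x :|: I) = r I.
  apply: IHn => [|y /setD1P[_ yA]]; last exact: hA.
  by move: ltA; rewrite (cardsD1 x A) xA; lia.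
apply/eqP; rewrite eqn_leq andbC rS ?subsetUr //=.
have := r_submod (A :\ x :|: I) (x |: I).
have -> : (A :\ x :|: I) :|: (x |: I) = A :|: I.
  by rewrite -{2}(setD1K xA) setUACA setUid (setUC (A :\ x)).
have : (r I <= r ((A :\ x :|: I) :&: (x |: I)))%N by rewrite rS // subsetI !subsetUr.
rewrite IHn hA //; lia.
Qed.

Lemma rank_function_matroid :
  matroid_axiom E [set A in powerset E | r A == #|A|].
Proof.
apply/and4P; split.
- by apply/forall_inP=> A; rewrite !inE => /andP[].
- by rewrite !inE sub0set eqn_leq r_card cards0.
- apply/forall_inP=> A; rewrite !inE => /andP[sA /eqP eA].
  apply/forallP => B; apply/implyP => sB; rewrite !inE (subset_trans sB) //=.
  rewrite eqn_leq r_card /=.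
  have := r_submod B (A :\: B).
  have -> : B :|: A :\: B = A by rewrite -{1}(setIidPr sB) setID.
  have := r_card (A :\: B); have := cardsID B A; move/setIidPr: sB => ->.
  rewrite eA; lia.
- apply/forall_inP=> A; rewrite !inE => /andP[sA /eqP eA].
  apply/forall_inP=> B; rewrite !inE => /andP[sB /eqP eB].
  apply/implyP => ltAB; apply: contraT; rewrite negb_exists_in => /forall_inP h.
  have : r (B :|: A) = r A.
    apply: rank_function_absorb => x xB.
    have [xA|xA] := boolP (x \in A); first by rewrite (setUidPr _) // sub1set.
    have := h x; rewrite !inE xA xB => /(_ isT).
    rewrite subUset sub1set (subsetP sB) // sA /=.
    have := r_card (x |: A); have := rS (subsetUr [set x] A).
    rewrite cardsU1 xA; lia.
  have := rS (subsetUl B A); lia.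
Qed.

End RankFunction.

Lemma baseP M B : reflect (B \in indep M /\ #|B| = rank M) (is_base M B).
Proof.
apply: (iffP idP) => [/maxsetP[iB maxB]|[iB eB]].
  split=> //; rewrite /rank; have [I [iI sBI _ <-]] := rk_extend iB (indep_ground iB).
  by rewrite (maxB I).
apply/maxsetP; split=> // C iC sBC; apply/eqP.
by rewrite eq_sym eqEcard sBC eB rk_ge // indep_ground.
Qed.

Lemma restrict_axiom M F :
  matroid_axiom (ground M :&: F) [set A in indep M | A \subset F].
Proof.
apply/and4P; split.
- apply/forall_inP=> A; rewrite inE => /andP[/indep_ground sA sAF].
  by rewrite subsetI sA.
- by rewrite inE indep0 sub0set.
- apply/forall_inP=> A; rewrite inE => /andP[iA sA].
  apply/forallP => B; apply/implyP => sB.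
  by rewrite inE (indepS sB) // (subset_trans sB).
- apply/forall_inP=> A; rewrite inE => /andP[iA sA].
  apply/forall_inP=> B; rewrite inE => /andP[iB sB].
  apply/implyP => /(indep_exchange iA iB)[x xBA ixA].
  apply/exists_inP; exists x => //; rewrite inE ixA subUset sub1set sA andbT.
  by case/setDP: xBA => /(subsetP sB).
Qed.

Lemma contract_axiom M F :
  matroid_axiom (ground M :\: F)
    [set A in powerset (ground M :\: F) | rk M (A :|: F) == (#|A| + rk M F)%N].
Proof.
pose r A := (rk M (A :|: F) - rk M F)%N.
have le A : (rk M F <= rk M (A :|: F))%N by rewrite rkS ?subsetUr.
have -> : [set A in powerset (ground M :\: F) | rk M (A :|: F) == (#|A| + rk M F)%N]
        = [set A in powerset (ground M :\: F) | r A == #|A|].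
  apply/setP=> A; rewrite !inE /r; congr (_ && _); apply/eqP/eqP; have := le A; lia.
apply: rank_function_matroid => [A|A B sAB|A B]; rewrite /r.
- have := rk_submod M A F; have := rk_leq_card M A; lia.
- by rewrite leq_sub2r // rkS // setSU.
- have := rk_submod M (A :|: F) (B :|: F).
  rewrite -setUIl setUACA setUid.
  move: (le (A :|: B)) (le (A :&: B)) (le A) (le B); lia.
Qed.

Lemma dual_axiom M :
  matroid_axiom (ground M)
    [set A in powerset (ground M) | [exists B, is_base M B && (A \subset ground M :\: B)]].
Proof.
pose r A := (#|A :&: ground M| + rk M (ground M :\: A) - rank M)%N.
have le A : (rank M <= #|A :&: ground M| + rk M (ground M :\: A))%N.
  have := rk_submod M (A :&: ground M) (ground M :\: A).
  have := rk_leq_card M (A :&: ground M).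
  rewrite setIC setID /rank; lia.
have -> : [set A in powerset (ground M) |
            [exists B, is_base M B && (A \subset ground M :\: B)]]
        = [set A in powerset (ground M) | r A == #|A|].
  apply/setP=> A; rewrite !inE; case sA: (A \subset _) => //=.
  have le' : (rk M (ground M :\: A) <= rank M)%N by rewrite rkS ?subsetDl.
  rewrite /r (setIidPl sA); apply/existsP/idP => [[B /andP[/baseP[iB eB] sAB]]|h].
    have : (#|B| <= rk M (ground M :\: A))%N.
      rewrite rk_ge // subsetD indep_ground //=.
      by move: sAB; rewrite subsetD disjoint_sym => /andP[].
    lia.
  have [B [iB sB eB]] := rk_witness M (ground M :\: A).
  exists B; apply/andP; split.
    apply/baseP; split=> //; have := le A; rewrite (setIidPl sA); lia.
  by move: sB; rewrite !subsetD sA disjoint_sym => /andP[_ ->].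
apply: rank_function_matroid => [A|A B sAB|A B]; rewrite /r.
- have : (rk M (ground M :\: A) <= rank M)%N by rewrite rkS ?subsetDl.
  have := subset_leq_card (subsetIl A (ground M)); lia.
- rewrite leq_sub2r //.
  have := rk_submod M (ground M :\: B) ((B :\: A) :&: ground M).
  have -> : ground M :\: B :|: (B :\: A) :&: ground M = ground M :\: A.
    apply/setP=> x; rewrite !inE; have := subsetP sAB x.
    by case: (x \in A); case: (x \in B); case: (x \in ground M) => // /(_ isT).
  have := rk_leq_card M ((B :\: A) :&: ground M).
  have := cardsID A (B :&: ground M).
  have -> : B :&: ground M :&: A = A :&: ground M.
    by rewrite setIAC (setIidPr sAB).
  have -> : B :&: ground M :\: A = (B :\: A) :&: ground M by rewrite setIDAC.
  lia.
- have := rk_submod M (ground M :\: A) (ground M :\: B).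
  rewrite -setDIr -setDUr.
  have := cardsUI (A :&: ground M) (B :&: ground M).
  rewrite -setIIl -setIUl.
  move: (le (A :|: B)) (le (A :&: B)) (le A) (le B); lia.
Qed.

End MatroidTheory.

Definition restrict (T : finType) (M : matroid T) (F : {set T}) : matroid T :=
  Matroid (restrict_axiom M F).

Definition contract (T : finType) (M : matroid T) (F : {set T}) : matroid T :=
  Matroid (contract_axiom M F).

(* The bases of the dual are the complements of the bases of [M]. *)
Definition dual (T : finType) (M : matroid T) : matroid T :=
  Matroid (dual_axiom M).

Definition paving (T : finType) (M : matroid T) : bool :=
  [forall C : {set T}, circuit M C ==> (rank M <= #|C|)%N].

Definition sparse_paving (T : finType) (M : matroid T) : bool :=
  paving M && paving (dual M).

(* [mobius M F] is mu(0, F) in the lattice of flats, where 0 = cl(set0) is the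
   only flat of rank 0.  Flats strictly below [F] have fewer elements, so
   [#|F|.+1] is enough fuel, see [mobiusE]. *)
Fixpoint mobius_fuel (T : finType) (n : nat) (M : matroid T) (F : {set T}) : int :=
  if n is n'.+1 then
    (rk M F == 0%N)%:R - \sum_(G in flats M | G \proper F) mobius_fuel n' M G
  else 0.

Definition mobius (T : finType) (M : matroid T) (F : {set T}) : int :=
  mobius_fuel #|F|.+1 M F.

Definition charpoly (T : finType) (M : matroid T) : {poly int} :=
  \sum_(F in flats M) mobius M F *: 'X^(rank M - rk M F).

(* t^n p(1/t), provided that deg p <= n. *)
Definition revpoly (n : nat) (p : {poly int}) : {poly int} :=
  \sum_(i < n.+1) p`_i *: 'X^(n - i).

(* The conditions that determine the Kazhdan-Lusztig polynomials of loopless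
   matroids.  [KL_family_KLpoly] and [KL_family_unique] show that [KLpoly] below
   is, on loopless matroids, the one and only family satisfying them. *)
Definition KL_family (T : finType) (P : matroid T -> {poly int}) : Prop :=
  forall M, loopless M ->
    [/\ rank M = 0%N -> P M = 1,
        (0 < rank M)%N -> ((size (P M)).-1.*2 < rank M)%N
      & revpoly (rank M) (P M)
          = \sum_(F in flats M) charpoly (restrict M F) * P (contract M F)].

(* In the last condition the term F = set0 is P_M itself, and t^(rk M) P_M(1/t) has no
   coefficient in degrees i with 2i < rk M: hence those coefficients of P_M are
   the opposites of the coefficients of the sum over F != set0. *)
Fixpoint KL_fuel (T : finType) (n : nat) (M : matroid T) : {poly int} :=
  if n is n'.+1 then
    if rank M == 0%N then 1 else
    \poly_(i < uphalf (rank M))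
      - (\sum_(F in flats M | F != set0)
           charpoly (restrict M F) * KL_fuel n' (contract M F))`_i
  else 1.

Definition KLpoly (T : finType) (M : matroid T) : {poly int} :=
  KL_fuel (rank M) M.

Section MinorTheory.

Context {T : finType}.
Implicit Types (M N : matroid T) (A B F G H K : {set T}).

Lemma flatsP M F :
  reflect (F \subset ground M /\
           forall x, x \in ground M -> x \notin F -> (rk M F < rk M (x |: F))%N)
          (F \in flats M).
Proof.
rewrite !inE; apply: (iffP andP) => -[sF h]; split=> //.
  by move=> x xE xF; apply: (forall_inP h); rewrite inE xF.
by apply/forall_inP=> x /setDP[xE xF]; apply: h.
Qed.

Lemma flat_ground M F : F \in flats M -> F \subset ground M.
Proof. by case/flatsP. Qed.

Lemma ground_flat M : ground M \in flats M.
Proof. by apply/flatsP; split=> // x ->. Qed.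

Lemma rk_flat_proper M F A :
  F \in flats M -> F \proper A -> A \subset ground M -> (rk M F < rk M A)%N.
Proof.
case/flatsP => _ h /properP[sFA [x xA xF]] sA.
apply: leq_trans (h x _ xF) _; first exact: (subsetP sA).
by rewrite rkS // subUset sub1set xA.
Qed.

Lemma rk_flat_eq M F A : F \in flats M -> F \subset A -> A \subset ground M ->
  rk M F = rk M A -> F = A.
Proof.
move=> fF sFA sA e; apply/eqP; apply: contraT => ne.
by have := rk_flat_proper fF _ sA; rewrite properEneq ne sFA e ltnn => /(_ isT).
Qed.

Lemma rk_restrict M F A : rk (restrict M F) A = rk M (A :&: F).
Proof.
rewrite /rk; apply: eq_bigl => I /=.
by rewrite inE subsetI -andbA; congr (_ && _); rewrite andbC.
Qed.

Lemma rank_restrict M F : F \subset ground M -> rank (restrict M F) = rk M F.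
Proof. by move=> sF; rewrite /rank rk_restrict /= -setIA setIid (setIidPr sF). Qed.

Lemma rk_contract M F A : F \subset ground M ->
  rk (contract M F) A = (rk M (A :|: F) - rk M F)%N.
Proof.
move=> sF; apply/eqP; rewrite eqn_leq; apply/andP; split.
  have [I [+ sI <-]] := rk_witness (contract M F) A.
  rewrite !inE /= => /andP[_ /eqP e].
  have : (rk M (I :|: F) <= rk M (A :|: F))%N by rewrite rkS // setSU.
  by rewrite e; lia.
have [J [iJ sJ eJ]] := rk_witness M F.
have [I [iI sJI sI eI]] := rk_extend iJ (subset_trans sJ (subsetUr A F)).
have eIF : #|I :&: F| = rk M F.
  apply/eqP; rewrite eqn_leq rk_ge ?subsetIr ?(indepS _ iI) ?subsetIl //=.
  by rewrite -eJ subset_leq_card // subsetI sJI.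
have eID : #|I :\: F| = (rk M (A :|: F) - rk M F)%N.
  by have := cardsID F I; lia.
rewrite -eID rk_ge // ?subDset 1?setUC // !inE /= setSD ?indep_ground //=.
have e : rk M (I :\: F :|: F) = rk M (A :|: F).
  apply/eqP; rewrite eqn_leq; apply/andP; split.
    by apply: rkS; rewrite subUset subsetUr (subset_trans (subsetDl _ _)).
  rewrite -eI rk_ge //; apply/subsetP => x; rewrite !inE => ->.
  by case: (x \in F).
rewrite e eID; have := rkS M (subsetUr A F); lia.
Qed.

Lemma rank_contract M F : F \subset ground M ->
  rank (contract M F) = (rank M - rk M F)%N.
Proof.
move=> sF; rewrite /rank rk_contract //=; congr (rk M _ - _)%N.
by rewrite setUC -{2}(setID (ground M) F) (setIidPr sF).
Qed.

Lemma flats_restrict M G F : G \in flats M ->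
  (F \in flats (restrict M G)) = (F \in flats M) && (F \subset G).
Proof.
move=> fG; have sG := flat_ground fG; apply/flatsP/andP => /=.
  rewrite (setIidPr sG) => -[sF h]; split=> //.
  have sFE := subset_trans sF sG.
  apply/flatsP; split=> // x xE xF; have [xG|xG] := boolP (x \in G).
    have := h _ xG xF; rewrite !rk_restrict (setIidPl sF) (setIidPl _) //.
    by rewrite subUset sub1set xG.
  rewrite ltnNge; apply/negP => le; have := rk_submod M (x |: F) G.
  have -> : (x |: F) :&: G = F.
    apply/setP=> y; rewrite !inE; case: eqP => [->|_] /=.
      by rewrite (negPf xG) (negPf xF).
    by apply: andb_idr; apply: (subsetP sF).
  have -> : (x |: F) :|: G = x |: G by rewrite -setUA (setUidPr sF).
  by have [_ /(_ x xE xG)] := flatsP _ _ fG; lia.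
move=> [fF sF]; rewrite (setIidPr sG); split=> // x xG xF.
rewrite !rk_restrict (setIidPl sF) (setIidPl _) ?subUset ?sub1set ?xG //.
by case/flatsP: fF => _; apply=> //; apply: (subsetP sG).
Qed.

Lemma flats_contract M F H : F \subset ground M -> F \subset H ->
  (H :\: F \in flats (contract M F)) = (H \in flats M).
Proof.
move=> sF sFH.
have eH : H :\: F :|: F = H by rewrite setUC -{1}(setIidPr sFH) setID.
have sHE : (H :\: F \subset ground M :\: F) = (H \subset ground M).
  apply/idP/idP => [|h]; last exact: setSD.
  by rewrite subsetD => /andP[h _]; rewrite -eH subUset sF h.
have le A : F \subset A -> (rk M F <= rk M A)%N by apply: rkS.
apply/flatsP/flatsP; rewrite /= sHE => -[sH h]; split=> // x.
  move=> xE xH; have xF : x \notin F by apply: contra xH; apply: (subsetP sFH).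
  have := h x; rewrite !inE xE xF (negPf xH) => /(_ isT isT).
  by rewrite !rk_contract // -setUA eH; lia.
rewrite !inE => /andP[xF xE]; rewrite xF /= => xH.
rewrite !rk_contract // -setUA eH.
have := h x xE xH; have := le H sFH; lia.
Qed.

Lemma flats_contractE M F K : F \subset ground M ->
  (K \in flats (contract M F)) = [disjoint K & F] && (K :|: F \in flats M).
Proof.
move=> sF; case d: [disjoint K & F] => /=.
  rewrite -(flats_contract sF (subsetUr K F)).
  by rewrite setDUl setDv setU0 (setDidPl d).
by apply/negP => /flat_ground /=; rewrite subsetD d andbF.
Qed.

Lemma big_flats_contract (R : nmodType) M F (f : {set T} -> R) : F \subset ground M ->
  \sum_(K in flats (contract M F)) f K
    = \sum_(H in flats M | F \subset H) f (H :\: F).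
Proof.
move=> sF; rewrite (reindex_onto (fun H => H :\: F) (fun K => K :|: F)) /=.
  apply: eq_bigl => H; rewrite flats_contractE //.
  apply/andP/andP => [[/andP[_ h] /eqP e]|[h sFH]].
    by rewrite -[in X in _ /\ X]e subsetUr; move: h; rewrite e.
  have e : H :\: F :|: F = H by rewrite setUC -{1}(setIidPr sFH) setID.
  rewrite e eqxx h andbT; split=> //.
  by rewrite -setI_eq0 setIC setIDA setIC -setIDA setDv setI0.
move=> K; rewrite flats_contractE // => /andP[d _].
by rewrite setDUl setDv setU0 (setDidPl d).
Qed.

Lemma eq_matroid_rk M N : ground M = ground N ->
  (forall A, A \subset ground M -> rk M A = rk N A) -> M = N.
Proof.
move=> eE h; apply: eq_matroid => //; apply/setP => A.
by rewrite !indep_rk -eE; case sA: (_ \subset _) => //=; rewrite h.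
Qed.

Lemma contract0 M : contract M set0 = M.
Proof.
apply: eq_matroid_rk => /= [|A _]; first by rewrite setD0.
by rewrite rk_contract ?sub0set // rk0 subn0 setU0.
Qed.

Lemma contract_contract M F G : F \subset G -> G \subset ground M ->
  contract (contract M F) (G :\: F) = contract M G.
Proof.
move=> sFG sG; have sF := subset_trans sFG sG.
have eG : G :\: F :|: F = G by rewrite setUC -{1}(setIidPr sFG) setID.
apply: eq_matroid_rk => /= [|A _].
  by rewrite setDDl setUC eG.
rewrite rk_contract /=; last exact: setSD.
rewrite !rk_contract // -setUA eG.
have := rkS M (subsetUr A G); have := rkS M sFG; lia.
Qed.

Lemma loopless_rk M x : loopless M -> x \in ground M -> rk M [set x] = 1%N.
Proof.
by move=> /forall_inP h /h; rewrite indep_rk cards1 => /andP[_ /eqP].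
Qed.

Lemma loopless_flat0 M : loopless M -> set0 \in flats M.
Proof.
move=> lM; apply/flatsP; split=> [|x xE _]; first exact: sub0set.
by rewrite setU0 rk0 loopless_rk.
Qed.

Lemma rk_flat_eq0 M F : loopless M -> F \in flats M -> (rk M F == 0%N) = (F == set0).
Proof.
move=> lM fF; apply/eqP/eqP => [e|->]; last exact: rk0.
by apply/esym/(rk_flat_eq (loopless_flat0 lM)); rewrite ?sub0set ?flat_ground ?rk0.
Qed.

Lemma loopless_restrict M F : loopless M -> loopless (restrict M F).
Proof.
move=> /forall_inP h; apply/forall_inP => x; rewrite /= !inE => /andP[xE xF].
by rewrite h // sub1set.
Qed.

Lemma loopless_contract M F : F \in flats M -> loopless (contract M F).
Proof.
move=> /flatsP[sF h]; apply/forall_inP => x xEF; have /setDP[xE xF] := xEF.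
rewrite indep_rk sub1set xEF /= rk_contract // cards1.
have := h x xE xF; have := rk_submod M [set x] F.
have := rk_leq_card M [set x]; rewrite cards1; lia.
Qed.

Lemma mobius_fuelE n M F : (#|F| < n)%N -> mobius_fuel n M F = mobius M F.
Proof.
elim: n {-2}n (leqnn n) F => [[]//|n IHn [//|k]]; rewrite ltnS => le F ltF.
rewrite /mobius /=; congr (_ - _); apply: eq_bigr => G /andP[_ /proper_card ltG].
rewrite IHn //; last by lia.
by rewrite IHn //; lia.
Qed.

Lemma mobiusE M F : mobius M F =
  (rk M F == 0%N)%:R - \sum_(G in flats M | G \proper F) mobius M G.
Proof.
rewrite {1}/mobius /=; congr (_ - _); apply: eq_bigr => G /andP[_ ltG].
by rewrite mobius_fuelE // proper_card.
Qed.

Lemma mobius_sum M F : F \in flats M ->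
  \sum_(G in flats M | G \subset F) mobius M G = (rk M F == 0%N)%:R.
Proof.
move=> fF; rewrite (bigD1 F) /=; last by rewrite fF subxx.
rewrite mobiusE -[RHS](subrK (\sum_(G in flats M | G \proper F) mobius M G)).
congr (_ + _); apply: eq_bigl => G.
by rewrite -andbA properEneq [_ && (_ \subset _)]andbC.
Qed.

Lemma mobius_restrict M G F : G \in flats M -> F \subset G ->
  mobius (restrict M G) F = mobius M F.
Proof.
move=> fG; have [n] := ubnP #|F|; elim: n F => // n IHn F ltF sF.
rewrite !mobiusE rk_restrict (setIidPl sF); congr (_ - _).
apply: eq_big => [H|H /andP[_ pH]].
  rewrite flats_restrict //; apply: andb_id2r => /proper_sub sH.
  by rewrite (subset_trans sH) ?andbT.
by rewrite IHn ?(subset_trans (proper_sub pH)) //; have := proper_card pH; lia.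
Qed.

Lemma charpoly_restrict M G : G \in flats M ->
  charpoly (restrict M G)
    = \sum_(H in flats M | H \subset G) mobius M H *: 'X^(rk M G - rk M H).
Proof.
move=> fG; rewrite /charpoly rank_restrict ?flat_ground //.
apply: eq_big => [H|H]; rewrite flats_restrict // => /andP[_ sH].
by rewrite mobius_restrict // rk_restrict (setIidPl sH).
Qed.

Lemma mobius_contract_sum M F G : F \in flats M -> G \in flats M -> F \subset G ->
  \sum_(H in flats M | (F \subset H) && (H \subset G)) mobius (contract M F) (H :\: F)
    = (F == G)%:R.
Proof.
move=> fF fG sFG; have sF := flat_ground fF.
have eG : G :\: F :|: F = G by rewrite setUC -{1}(setIidPr sFG) setID.
have fGF : G :\: F \in flats (contract M F) by rewrite flats_contract.
transitivity ((rk (contract M F) (G :\: F) == 0%N)%:R : int); last first.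
  rewrite rk_flat_eq0 ?loopless_contract // setD_eq0.
  by rewrite eqEsubset sFG.
rewrite -mobius_sum // [RHS]big_mkcondr big_flats_contract // -[RHS]big_mkcondr.
apply: eq_bigl => H; rewrite -andbA; apply: andb_id2l => fH; apply: andb_id2l => sFH.
by rewrite subDset setUC eG.
Qed.

Lemma charpoly_minor M F G : F \in flats M -> G \in flats M -> F \subset G ->
  charpoly (restrict (contract M F) (G :\: F))
    = \sum_(H in flats M | (F \subset H) && (H \subset G))
        mobius (contract M F) (H :\: F) *: 'X^(rk M G - rk M H).
Proof.
move=> fF fG sFG; have sF := flat_ground fF.
have eU H : F \subset H -> H :\: F :|: F = H.
  by move=> sFH; rewrite setUC -{1}(setIidPr sFH) setID.
have fGF : G :\: F \in flats (contract M F) by rewrite flats_contract.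
rewrite charpoly_restrict // big_mkcondr big_flats_contract // -big_mkcondr.
apply: eq_big => [H|H /andP[/andP[_ sFH] _]].
  rewrite -andbA; apply: andb_id2l => fH; apply: andb_id2l => sFH.
  by rewrite subDset setUC eU.
rewrite !rk_contract // !eU //; congr (_ *: 'X^_).
have := rkS M sFG; have := rkS M sFH; lia.
Qed.

Lemma sum_inverse_comm (I : finType) (A : {set I}) (f g : I -> I -> int) :
  (forall x y, x \in A -> y \in A -> \sum_(z in A) f x z * g z y = (x == y)%:R) ->
  forall x y, x \in A -> y \in A -> \sum_(z in A) g x z * f z y = (x == y)%:R.
Proof.
move=> h x y xA yA.
pose m (k : I -> I -> int) := \matrix_(i < #|A|, j < #|A|) k (enum_val i) (enum_val j).
have : m f *m m g = 1%:M.
  apply/matrixP => i j; rewrite !mxE.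
  under eq_bigr do rewrite !mxE.
  rewrite -(big_enum_val (fun z => f (enum_val i) z * g z (enum_val j))).
  by rewrite h ?enum_valP // (inj_eq enum_val_inj).
move/mulmx1C/matrixP/(_ (enum_rank_in xA x) (enum_rank_in xA y)).
rewrite !mxE; under eq_bigr do rewrite !mxE !enum_rankK_in //.
rewrite -(big_enum_val (fun z => g x z * f z y)) => ->.
by rewrite -(inj_eq enum_val_inj) !enum_rankK_in.
Qed.

Lemma mobius_contract_sum_dual M K H : K \in flats M -> H \in flats M ->
  \sum_(F in flats M | (K \subset F) && (F \subset H)) mobius (contract M F) (H :\: F)
    = (K == H)%:R.
Proof.
pose f (F H : {set T}) : int :=
  if F \subset H then mobius (contract M F) (H :\: F) else 0.
pose g (F H : {set T}) : int := (F \subset H)%:R.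
move=> fK fH; rewrite -(sum_inverse_comm (A := flats M) (f := f) (g := g)) //.
  rewrite big_mkcondr; apply: eq_bigr => F _; rewrite /f /g.
  by case: (K \subset F); case: (F \subset H); rewrite ?mul1r ?mul0r.
move=> F G fF fG; have [sFG|nFG] := boolP (F \subset G).
  rewrite -(mobius_contract_sum fF fG sFG) [RHS]big_mkcondr; apply: eq_bigr => F' _.
  by rewrite /f /g; case: (F \subset F'); case: (F' \subset G); rewrite ?mulr1 ?mulr0 ?mul0r.
rewrite big1 => [|F' _]; first by case: eqP nFG => // ->; rewrite subxx.
rewrite /f /g; case: ifP => sF; rewrite ?mul0r //; case: (boolP (F' \subset G)) => [s|].
  by rewrite (subset_trans sF s) in nFG.
by rewrite mulr0.
Qed.

Lemma revpoly_poly n (p : {poly int}) : revpoly n p = \poly_(i < n.+1) p`_(n - i).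
Proof.
rewrite poly_def /revpoly (reindex_inj rev_ord_inj) /=.
apply: eq_bigr => i _; rewrite subSS; congr (_ *: 'X^_).
by have := ltn_ord i; lia.
Qed.

Lemma coef_revpoly n (p : {poly int}) k :
  (revpoly n p)`_k = if (k <= n)%N then p`_(n - k) else 0.
Proof. by rewrite revpoly_poly coef_poly ltnS. Qed.

Lemma revpolyZXn n i (c : int) : (i <= n)%N ->
  revpoly n (c *: 'X^i) = c *: 'X^(n - i).
Proof.
move=> le; apply/polyP => k; rewrite coef_revpoly !coefZ !coefXn.
case: leqP => lek; first by congr (_ * _%:R); congr nat_of_bool; lia.
by rewrite (_ : _ == _ = false) ?mulr0 //; lia.
Qed.

Lemma revpoly_sum n (I : Type) (r : seq I) (P : pred I) (p : I -> {poly int}) :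
  revpoly n (\sum_(i <- r | P i) p i) = \sum_(i <- r | P i) revpoly n (p i).
Proof.
apply/polyP => k; rewrite coef_revpoly !coef_sum.
case: (leqP k n) => lek; first by apply: eq_bigr => i _; rewrite coef_revpoly lek.
by rewrite big1 // => i _; rewrite coef_revpoly leqNgt lek.
Qed.

Lemma revpolyM m n (p q : {poly int}) : (size p <= m.+1)%N -> (size q <= n.+1)%N ->
  revpoly (m + n) (p * q) = revpoly m p * revpoly n q.
Proof.
move=> sp sq.
have e k (s : {poly int}) : (size s <= k.+1)%N -> s = \sum_(i < k.+1) s`_i *: 'X^i.
  move=> ss; rewrite -poly_def; apply/polyP => i; rewrite coef_poly.
  by case: ltnP => // le; rewrite nth_default // (leq_trans ss).
rewrite {1}(e m p sp) {1}(e n q sq) mulr_suml revpoly_sum /revpoly mulr_suml.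
apply: eq_bigr => i _; rewrite !mulr_sumr -/(revpoly _ _) revpoly_sum.
apply: eq_bigr => j _; rewrite -!scalerAl -!scalerAr !scalerA -!exprD.
rewrite revpolyZXn; last by have := (ltn_ord i); have := ltn_ord j; lia.
by congr (_ *: 'X^_); have := (ltn_ord i); have := ltn_ord j; lia.
Qed.

Lemma size_charpoly M : (size (charpoly M) <= (rank M).+1)%N.
Proof.
apply: (leq_trans (size_sum _ _ _)); apply/bigmax_leqP => F _.
by rewrite (leq_trans (size_scale_leq _ _)) // size_polyXn ltnS leq_subr.
Qed.

Lemma charpoly_kernel M G : loopless M -> G \in flats M ->
  \sum_(F in flats M | F \subset G)
     revpoly (rk M F) (charpoly (restrict M F))
       * charpoly (restrict (contract M F) (G :\: F))
  = (G == set0)%:R.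
Proof.
move=> lM fG.
transitivity (\sum_(F in flats M | F \subset G)
  \sum_(K in flats M | K \subset F) \sum_(H in flats M | (F \subset H) && (H \subset G))
    (mobius M K * mobius (contract M F) (H :\: F)) *: 'X^(rk M K + (rk M G - rk M H))
    : {poly int}).
  apply: eq_bigr => F /andP[fF sFG].
  rewrite charpoly_restrict // charpoly_minor // revpoly_sum mulr_suml.
  apply: eq_bigr => K /andP[fK sKF]; rewrite mulr_sumr; apply: eq_bigr => H _.
  rewrite revpolyZXn ?leq_subr // -scalerAl -scalerAr scalerA -exprD subKn //.
  exact: rkS.
rewrite (exchange_big_dep (fun K => (K \in flats M) && (K \subset G))) /=; last first.
  by move=> F K /andP[_ sFG] /andP[-> sKF]; rewrite (subset_trans sKF).
transitivity (\sum_(K in flats M | K \subset G) (mobius M K *: 'X^(rk M G) : {poly int})).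
  apply: eq_bigr => K /andP[fK sKG].
  rewrite (exchange_big_dep (fun H => (H \in flats M) && (H \subset G))) /=; last first.
    by move=> F H _ /and3P[-> _ ->].
  transitivity (\sum_(H in flats M | H \subset G)
      (mobius M K * (K == H)%:R) *: 'X^(rk M K + (rk M G - rk M H)) : {poly int}).
    apply: eq_bigr => H /andP[fH sHG].
    rewrite -(mobius_contract_sum_dual fK fH) mulr_sumr scaler_suml.
    apply: eq_bigl => F; rewrite fH sHG !andbT fK /=.
    case fF: (F \in flats M) => //=.
    by apply/andP/andP => [[/andP[_ ->] ->]|[-> s]] //; rewrite s (subset_trans s).
  rewrite (bigD1 K) /=; last by rewrite fK.
  rewrite eqxx mulr1 subnKC ?rkS // big1 ?addr0 // => H /andP[_ ne].
  by rewrite eq_sym (negPf ne) mulr0 scale0r.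
rewrite -scaler_suml mobius_sum // rk_flat_eq0 //.
by case: eqP => [->|_]; rewrite ?scale0r // rk0 expr0 scale1r.
Qed.

Definition KL_sum (P : matroid T -> {poly int}) M : {poly int} :=
  \sum_(F in flats M | F != set0) charpoly (restrict M F) * P (contract M F).

Lemma charpoly_restrict0 M : loopless M -> charpoly (restrict M set0) = 1.
Proof.
move=> lM; have f0 := loopless_flat0 lM; rewrite charpoly_restrict //.
rewrite (bigD1 set0) /= ?f0 ?subxx // big1 => [|H]; last first.
  by rewrite subset0 -andbA => /and3P[_ /eqP->]; rewrite eqxx.
rewrite addr0 subnn expr0 mobiusE rk0 eqxx big1 ?subr0 ?scale1r // => G.
by move=> /andP[_ /proper_card]; rewrite cards0.
Qed.

Lemma KL_sumE P M : loopless M ->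
  \sum_(F in flats M) charpoly (restrict M F) * P (contract M F) = P M + KL_sum P M.
Proof.
move=> lM; rewrite (bigD1 set0) /= ?loopless_flat0 //.
by rewrite charpoly_restrict0 // mul1r contract0.
Qed.

Lemma KL_sum_size (P : matroid T -> {poly int}) M :
  (forall F, F \in flats M -> F != set0 ->
     (size (P (contract M F)) <= (rank (contract M F)).+1)%N) ->
  (size (KL_sum P M) <= (rank M).+1)%N.
Proof.
move=> h; apply: (leq_trans (size_sum _ _ _)); apply/bigmax_leqP => F /andP[fF F0].
have := h F fF F0; have := size_charpoly (restrict M F).
rewrite rank_restrict ?rank_contract ?flat_ground //.
have := size_polyMleq (charpoly (restrict M F)) (P (contract M F)).
have := rkS M (flat_ground fF); rewrite -/(rank M); lia.
Qed.

Lemma KL_sum_antipalindromic (P : matroid T -> {poly int}) M : loopless M -> (0 < rank M)%N ->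
  (forall F, F \in flats M -> F != set0 ->
     (size (P (contract M F)) <= (rank (contract M F)).+1)%N /\
     revpoly (rank (contract M F)) (P (contract M F))
       = \sum_(K in flats (contract M F))
           charpoly (restrict (contract M F) K) * P (contract (contract M F) K)) ->
  revpoly (rank M) (KL_sum P M) = - KL_sum P M.
Proof.
move=> lM r0 h; rewrite /KL_sum revpoly_sum.
transitivity (\sum_(F in flats M | F != set0) \sum_(G in flats M | F \subset G)
   revpoly (rk M F) (charpoly (restrict M F))
     * charpoly (restrict (contract M F) (G :\: F)) * P (contract M G)).
  apply: eq_bigr => F /andP[fF F0]; have [sz e] := h F fF F0.
  have sF := flat_ground fF.
  have -> : rank M = (rk M F + rank (contract M F))%N.
    by rewrite rank_contract // subnKC // rkS.
  rewrite revpolyM // -?rank_restrict ?size_charpoly // e big_flats_contract //.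
  rewrite mulr_sumr; apply: eq_bigr => G /andP[fG sFG].
  by rewrite mulrA contract_contract // flat_ground.
rewrite (exchange_big_dep (fun G => (G \in flats M) && (G != set0))) /=; last first.
  move=> F G /andP[_ F0] /andP[-> sFG]; apply: contraNN F0 => /eqP e.
  by rewrite -subset0 -e.
rewrite -sumrN; apply: eq_bigr => G /andP[fG G0].
rewrite -mulr_suml -mulNr; congr (_ * _).
have := charpoly_kernel lM fG; rewrite (negPf G0) (bigD1 set0) /=; last first.
  by rewrite loopless_flat0 // sub0set.
rewrite charpoly_restrict0 // rk0 contract0 setD0.
rewrite /revpoly big_ord1 coef1 /= scale1r expr0 mul1r addrC => /eqP.
rewrite addr_eq0 => /eqP <-; apply: eq_bigl => F.
by rewrite fG /=; case: (F \in _) => //=; rewrite andbC.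
Qed.

Lemma rank_contract_lt M F : loopless M -> F \in flats M -> F != set0 ->
  (rank (contract M F) < rank M)%N.
Proof.
move=> lM fF; rewrite -(rk_flat_eq0 lM fF) rank_contract ?flat_ground //.
have := rkS M (flat_ground fF); rewrite -/(rank M); lia.
Qed.

Lemma KL_fuelE n M : loopless M -> (rank M <= n)%N -> KL_fuel n M = KLpoly M.
Proof.
rewrite /KLpoly => lM leM; move: (leqnn (rank M)); move: {2 3}(rank M) => k.
elim: n k M lM leM => [|n IHn] [|k] M lM /= len lek //.
- by rewrite (_ : rank M = 0%N) //; lia.
- by rewrite (_ : rank M = 0%N) //; lia.
case: eqP => // _; apply/polyP => i; rewrite !coef_poly; case: ifP => // _.
congr (- (polyseq _)`_i); apply: eq_bigr => F /andP[fF F0]; congr (_ * _).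
have lt := rank_contract_lt lM fF F0.
by apply: IHn; [exact: loopless_contract | lia | lia].
Qed.

Lemma KLpolyE M : loopless M -> (0 < rank M)%N ->
  KLpoly M = \poly_(i < uphalf (rank M)) - (KL_sum (@KLpoly T) M)`_i.
Proof.
move=> lM r0; rewrite /KLpoly; case e: (rank M) r0 => [//|r] _ /=; rewrite e /=.
apply/polyP => i; rewrite !coef_poly; case: ifP => // _.
congr (- (polyseq _)`_i); apply: eq_bigr => F /andP[fF F0]; rewrite KL_fuelE ?loopless_contract //.
by have := rank_contract_lt lM fF F0; lia.
Qed.

Lemma KL_family_KLpoly : KL_family (@KLpoly T).
Proof.
move=> M; have [n] := ubnP (rank M); elim: n M => // n IHn M ltM lM.
have [r0|r0] := posnP (rank M).
  have P1 : KLpoly M = 1 by rewrite /KLpoly r0.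
  split; [by [] | by rewrite r0 | ].
  rewrite KL_sumE // P1 /KL_sum big1 => [|F /andP[fF F0]]; last first.
    by have := rank_contract_lt lM fF F0; rewrite r0.
  by rewrite r0 /revpoly big_ord1 coef1 /= scale1r addr0.
have sz N : loopless N -> (0 < rank N)%N -> (size (KLpoly N) <= uphalf (rank N))%N.
  by move=> lN rN; rewrite KLpolyE // size_poly.
have sz' F : F \in flats M -> F != set0 ->
    (size (KLpoly (contract M F)) <= (rank (contract M F)).+1)%N.
  move=> fF F0; have [rF|rF] := posnP (rank (contract M F)).
    by rewrite /KLpoly rF /= size_poly1.
  by have := sz _ (loopless_contract fF) rF; lia.
have szS := KL_sum_size sz'.
have anti : revpoly (rank M) (KL_sum (@KLpoly T) M) = - KL_sum (@KLpoly T) M.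
  apply: KL_sum_antipalindromic => // F fF F0; split; first exact: sz'.
  have lt := rank_contract_lt lM fF F0.
  by have [] := IHn _ (leq_trans lt ltM) (loopless_contract fF).
split=> [e|_|]; first by rewrite e in r0.
  by have := sz M lM r0; lia.
rewrite KL_sumE //; apply/polyP => k; rewrite coefD coef_revpoly KLpolyE //.
rewrite !coef_poly; have /polyP/(_ k) := anti; rewrite coef_revpoly coefN.
set S := KL_sum _ M in szS *.
case: (leqP k (rank M)) => [lek|ltk] e; last first.
  have -> : (k < uphalf (rank M))%N = false by lia.
  by rewrite add0r nth_default // (leq_trans szS).
case: (ltngtP k.*2 (rank M)) => hk.
- have -> : (k < uphalf (rank M))%N by lia.
  have -> : (rank M - k < uphalf (rank M))%N = false by lia.
  by rewrite addNr.
- have -> : (k < uphalf (rank M))%N = false by lia.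
  have -> : (rank M - k < uphalf (rank M))%N by lia.
  by rewrite e opprK add0r.
- have -> : (k < uphalf (rank M))%N = false by lia.
  have -> : (rank M - k < uphalf (rank M))%N = false by lia.
  have ek : (rank M - k = k)%N by lia.
  by move: e; rewrite ek add0r; move: (S`_k) => z; lia.
Qed.

Lemma KL_family_unique (P : matroid T -> {poly int}) M :
  KL_family P -> loopless M -> P M = KLpoly M.
Proof.
move=> hP; have [n] := ubnP (rank M); elim: n M => // n IHn M ltM lM.
have [P0 Pd Pr] := hP M lM; have [Q0 Qd Qr] := KL_family_KLpoly lM.
have [r0|r0] := posnP (rank M); first by rewrite P0 ?Q0.
have eS : KL_sum P M = KL_sum (@KLpoly T) M.
  apply: eq_bigr => F /andP[fF F0]; rewrite IHn ?loopless_contract //.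
  exact: leq_trans (rank_contract_lt lM fF F0) ltM.
move: Pr Qr; rewrite !KL_sumE // eS => Pr Qr; have {}Pd := Pd r0; have {}Qd := Qd r0.
apply/polyP => k; case: (leqP (rank M) k.*2) => hk.
  have h s : (s.-1.*2 < rank M)%N -> (s <= k)%N by clear -hk; lia.
  by rewrite [LHS]nth_default ?[RHS]nth_default //; apply: h.
have h s : (s.-1.*2 < rank M)%N -> (s <= rank M - k)%N by clear -hk; lia.
have /polyP/(_ k) := Pr; have /polyP/(_ k) := Qr.
rewrite !coefD !coef_revpoly; have -> : (k <= rank M)%N by lia.
rewrite [(KLpoly M)`_(_ - _)]nth_default; last exact: h.
rewrite [(P M)`_(_ - _)]nth_default; last exact: h.
by move=> eQ eP; apply: (addIr (KL_sum (@KLpoly T) M)`_k); rewrite -eP -eQ.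
Qed.

End MinorTheory.

(* For [p : {poly int}], the coercion [polyseq] gives c = (c_0, ..., c_s) with
   s the degree of [p]. *)
Definition unimodal (c : seq int) : Prop :=
  exists2 r, (r < size c)%N &
    (forall i, (i < r)%N -> c`_i <= c`_i.+1) /\
    (forall i, (r <= i)%N -> (i.+1 < size c)%N -> c`_i.+1 <= c`_i).

Definition strictly_unimodal (c : seq int) : Prop :=
  exists2 r, (r < size c)%N &
    (forall i, (i < r)%N -> c`_i < c`_i.+1) /\
    (forall i, (r <= i)%N -> (i.+1 < size c)%N -> c`_i.+1 < c`_i).

(* Main.v *)
Require Import Defs.
From mathcomp Require Import all_boot all_order all_algebra.
From mathcomp Require Import zify ssrZ ring lra.
From Stdlib Require BinInt Znat.

Set Implicit Arguments.
Unset Strict Implicit.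
Unset Printing Implicit Defensive.

Import Order.TTheory GRing.Theory Num.Theory.

Local Open Scope ring_scope.

(* Relaxing a circuit-hyperplane changes the Kazhdan-Lusztig polynomial by a polynomial B_d
   that depends only on the rank d, so that P_M = U_(m,d) - lambda B_d, where U_(m,d) belongs
   to the uniform matroid and B_d = U_(1,d) - U_(1,d-1).  Inverse binomial transform in d turns
   the defining recursion of the U_(m,d) into [revpoly N G = G + V] with V explicit and
   antipalindromic; since deg G < N/2, G is minus the lower half of V.

   After division by C(m+d,m) C(d,i) C(d-i-1,i), the coefficient of t^i becomes
   kappa - l beta, where beta is a rational function of (d, i), l = lambda / C(m+d,m) is at
   most 1/(m+1) and at most 1/(d+1), and kappa satisfies a first-order recursion in m.  With
   e = d - i, two rational functions enclosing kappa show for m >= 2 (for m = 1, P_M is U_(1,d)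
   or U_(1,d-1)) that the coefficients increase from i to i+1 when d >= 3i+3 and decrease
   when d <= 3i+1.  For d = 3i+2 they decrease if m <= i+2 and increase if m >= i+3, apart
   from d = 5 (where the exceptions live) and from (m, d) = (5, 8), (6, 11), where equality
   would force 3 lambda = 247 or 11 lambda = 10336. *)

(** * Kazhdan-Lusztig polynomials of uniform matroids *)

(** The mode lies near i = d/3 because C(d,i) C(d-i-1,i) is, up to the factor (d-2i)/(d-i), the
    trinomial coefficient with parts i, i, d-2i, largest when the parts balance, whereas kappa and
    beta vary slowly. Off the line d = 3i+2 the quotient of consecutive factors decides the sign,
    and rational bounds for kappa suffice up to one small case. On that line the quotient is
    2i/(2i+1), and for m close to i the drift of kappa cancels it to first order. What remains is of
    the same order as the width of the enclosure of kappa; hence the comparison of errors at m = i+2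
    and the exact values for small i.

    Every consecutive difference is affine in l, so its sign is settled at l = 0 and at an upper
    bound for l. The two upper bounds are double counts of the sets of size d-1 and d+1 around the
    circuit-hyperplanes. *)

(* V and, in [kl_half], G = - (V truncated below degree N/2) of the header, with N = rank. *)
Definition kl_kernel (m N : nat) : {poly int} :=
  \sum_(j < N) 'C(m + N, m + j.+1)%:R * (- (1 + 'X)) ^+ (N - j.+1) * ('X^(j.+1) - 1).

Definition kl_half (m N : nat) : {poly int} :=
  \poly_(i < uphalf N) - (kl_kernel m N)`_i.

(* In rank [d = 0] this is 0, not 1, so that flats of size [d - 1] can be summed like the
   smaller ones in [KLpoly_sparse_paving], whether or not they lie on a circuit-hyperplane. *)
Definition uniform_KL (m d : nat) : {poly int} :=
  \sum_(N < d.+1) 'C(m + d, m + N)%:R * kl_half m N.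

Definition uniform_charpoly (m d : nat) : {poly int} :=
  \sum_(k < d) (-1) ^+ k * 'C(m + d, k)%:R * ('X^(d - k) - 1).

Lemma size_Xn_sub1 j : (size ('X^j - 1 : {poly int})%R <= j.+1)%N.
Proof.
apply: (leq_trans (size_polyD _ _)).
by rewrite size_polyXn size_polyN size_poly1 geq_max leqnn.
Qed.

Lemma size_natpolyM n (p : {poly int}) : (size (n%:R * p)%R <= size p)%N.
Proof. by rewrite mulr_natl -scaler_nat size_scale_leq. Qed.

Lemma size_oneX_exp k : (size ((- (1 + 'X)) ^+ k : {poly int})%R <= k.+1)%N.
Proof.
apply: (leq_trans (size_poly_exp_leq _ _)).
by rewrite size_polyN addrC size_XaddC mul1n.
Qed.

Lemma revpolyD n (p q : {poly int}) : revpoly n (p + q) = revpoly n p + revpoly n q.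
Proof.
by apply/polyP => k; rewrite coefD !coef_revpoly coefD; case: ifP; rewrite ?addr0.
Qed.

Lemma revpolyN n (p : {poly int}) : revpoly n (- p) = - revpoly n p.
Proof.
by apply/polyP => k; rewrite coefN !coef_revpoly coefN; case: ifP; rewrite ?oppr0.
Qed.

Lemma revpolyMn n c (p : {poly int}) : revpoly n (c%:R * p) = c%:R * revpoly n p.
Proof.
apply/polyP => k; rewrite !mulr_natl coefMn !coef_revpoly coefMn.
by case: ifP; rewrite ?mul0rn.
Qed.

Lemma revpolyXn n i : (i <= n)%N -> revpoly n 'X^i = 'X^(n - i).
Proof. by move=> le; rewrite -['X^i]scale1r revpolyZXn // scale1r. Qed.

Lemma revpoly_shift d N (p : {poly int}) : (N <= d)%N -> (size p <= N.+1)%N ->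
  revpoly d p = 'X^(d - N) * revpoly N p.
Proof.
move=> le sp; have := @revpolyM (d - N) N 1 p.
rewrite mul1r subnK // => -> //; last by rewrite size_poly1.
by rewrite -[X in revpoly _ X](expr0 'X) revpolyXn // subn0.
Qed.

Lemma revpoly_oneX_exp k : revpoly k ((- (1 + 'X)) ^+ k) = (- (1 + 'X)) ^+ k.
Proof.
elim: k => [|k IHk].
  by rewrite expr0 -[X in revpoly _ X](expr0 'X) revpolyXn.
rewrite exprS -{1}add1n revpolyM ?size_oneX_exp //; last first.
  by rewrite size_polyN addrC size_XaddC.
have r1 : revpoly 1 1 = 'X by rewrite -(expr0 'X) revpolyXn.
have rX : revpoly 1 'X = 1 by rewrite -[X in revpoly _ X]expr1 revpolyXn.
by rewrite IHk revpolyN revpolyD r1 rX ['X + 1]addrC.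
Qed.

Lemma kl_kernel_anti m N : revpoly N (kl_kernel m N) = - kl_kernel m N.
Proof.
rewrite revpoly_sum -sumrN; apply: eq_bigr => j _.
rewrite -!mulrA revpolyMn -mulrN; congr (_ * _).
have ltj := ltn_ord j.
rewrite -{1}(subnK ltj) revpolyM ?size_oneX_exp ?size_Xn_sub1 //.
rewrite revpoly_oneX_exp -mulrN; congr (_ * _).
rewrite revpolyD revpolyN revpolyXn // -(expr0 'X) revpolyXn //.
by rewrite subnn subn0 opprB.
Qed.

Lemma size_polyM_bound (p q : {poly int}) a b : (size p <= a.+1)%N -> (size q <= b.+1)%N ->
  (size (p * q)%R <= (a + b).+1)%N.
Proof. by move=> sp sq; apply: (leq_trans (size_polyMleq p q)); lia. Qed.

Lemma size_kl_kernel m N : (size (kl_kernel m N) <= N.+1)%N.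
Proof.
apply: (leq_trans (size_sum _ _ _)); apply/bigmax_leqP => j _.
rewrite -mulrA; apply: (leq_trans (size_natpolyM _ _)).
rewrite -[X in (_ <= X.+1)%N](subnK (ltn_ord j)).
by rewrite size_polyM_bound ?size_oneX_exp ?size_Xn_sub1.
Qed.

(** The condition [i < uphalf N] says 2i < N, so exactly one of each pair i < N - i is kept, and
    antipalindromy supplies the other. For even N the middle coefficient of S equals its own
    opposite and vanishes. *)
Lemma truncation_rev N (S : {poly int}) : (size S <= N.+1)%N -> revpoly N S = - S ->
  let P := \poly_(i < uphalf N) - S`_i in revpoly N P = P + S.
Proof.
move=> szS anti /=; apply/polyP => k; rewrite coefD coef_revpoly !coef_poly.
have /polyP/(_ k) := anti; rewrite coef_revpoly coefN.
case: (leqP k N) => [lek|ltk] e; last first.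
  have -> : (k < uphalf N)%N = false by lia.
  by rewrite add0r nth_default // (leq_trans szS).
case: (ltngtP k.*2 N) => hk.
- have -> : (k < uphalf N)%N by lia.
  have -> : (N - k < uphalf N)%N = false by lia.
  by rewrite addNr.
- have -> : (k < uphalf N)%N = false by lia.
  have -> : (N - k < uphalf N)%N by lia.
  by rewrite e opprK add0r.
- have -> : (k < uphalf N)%N = false by lia.
  have -> : (N - k < uphalf N)%N = false by lia.
  have ek : (N - k = k)%N by lia.
  by move: e; rewrite ek add0r; move: (S`_k) => z; lia.
Qed.

Lemma kl_half_rev m N : revpoly N (kl_half m N) = kl_half m N + kl_kernel m N.
Proof. exact: truncation_rev (size_kl_kernel m N) (kl_kernel_anti m N). Qed.

Lemma size_kl_half m N : (size (kl_half m N) <= uphalf N)%N.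
Proof. exact: size_poly. Qed.

Lemma kl_half0 m : kl_half m 0 = 0.
Proof. by apply/polyP => i; rewrite coef_poly coef0. Qed.

Lemma size_uniform_KL m d : (size (uniform_KL m d) <= uphalf d)%N.
Proof.
apply: (leq_trans (size_sum _ _ _)); apply/bigmax_leqP => N _.
apply: (leq_trans (size_natpolyM _ _)); apply: (leq_trans (size_kl_half _ _)).
by have := ltn_ord N; lia.
Qed.

Lemma uniform_KL0 m : uniform_KL m 0 = 0.
Proof. by rewrite /uniform_KL big_ord1 kl_half0 mulr0. Qed.

Lemma bin_mul_bin n a b : (a + b <= n)%N ->
  ('C(n, a) * 'C(n - a, b) = 'C(n, b) * 'C(n - b, a))%N.
Proof.
move=> le; have h1 := bin_fact (n := n) (m := a); have h2 := bin_fact (n := n) (m := b).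
have h3 := bin_fact (n := n - a) (m := b); have h4 := bin_fact (n := n - b) (m := a).
have {}h1 := h1 ltac:(lia); have {}h2 := h2 ltac:(lia).
have {}h3 := h3 ltac:(lia); have {}h4 := h4 ltac:(lia).
have e : (n - b - a = n - a - b)%N by lia.
rewrite e in h4.
apply/eqP; rewrite -(eqn_pmul2r (m := a`! * b`! * (n - a - b)`!)) ?muln_gt0 ?fact_gt0 //.
apply/eqP; transitivity n`!.
  by rewrite -h1 -h3; ring.
by rewrite -h2 -h4; ring.
Qed.

Lemma bin_mul_sub n a b : (b <= a <= n)%N ->
  ('C(n, a) * 'C(a, b) = 'C(n, b) * 'C(n - b, a - b))%N.
Proof.
move=> /andP[ba an]; rewrite -(bin_sub (n := n) (m := a)) //.
have := @bin_mul_bin n (n - a) b; rewrite subKn // => -> //; last by lia.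
congr (_ * _)%N; rewrite -(bin_sub (n := n - b) (m := a - b)); last by lia.
by congr 'C(_, _); lia.
Qed.

(** This is condition (iii) for the uniform matroid: a flat of size k < d has characteristic
    polynomial (X-1)^k and contraction U_(m,d-k). After substitution, [kl_half m N] carries
    C(m+d,m+N) times X^(d-N) on the left, from reversing in degree d instead of N, and times
    ((X-1)+1)^(d-N) on the right. These agree, and only the [kl_kernel] terms are left to match
    [uniform_charpoly]. *)
Lemma uniform_KL_rec m d :
  revpoly d (uniform_KL m d)
    = \sum_(k < d) 'C(m + d, k)%:R * ('X - 1) ^+ k * uniform_KL m (d - k)
      + uniform_charpoly m d.
Proof.
transitivity (\sum_(N < d.+1) 'C(m + d, m + N)%:R * 'X^(d - N) * kl_half m N
   + \sum_(N < d.+1) 'C(m + d, m + N)%:R * 'X^(d - N) * kl_kernel m N : {poly int}).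
  rewrite revpoly_sum -big_split /=; apply: eq_bigr => N _.
  rewrite revpolyMn (@revpoly_shift d N) //; first by rewrite kl_half_rev; ring.
    by rewrite -ltnS.
  by apply: (leq_trans (size_kl_half _ _)); lia.
congr (_ + _).
  transitivity (\sum_(k < d.+1) 'C(m + d, k)%:R * ('X - 1) ^+ k * uniform_KL m (d - k)
     : {poly int}); last by rewrite big_ord_recr /= subnn uniform_KL0 mulr0 addr0.
  transitivity (\sum_(k < d.+1) \sum_(N < d.+1 | (N <= d - k)%N)
      'C(m + d, k)%:R * ('X - 1) ^+ k * ('C(m + (d - k), m + N)%:R * kl_half m N)
      : {poly int}); last first.
    apply: eq_bigr => k _; rewrite /uniform_KL mulr_sumr.
    rewrite (big_ord_widen_cond d.+1 xpredT
      (fun N => 'C(m + d, k)%:R * ('X - 1) ^+ k * ('C(m + (d - k), m + N)%:R * kl_half m N))).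
      by apply: eq_bigl => N; rewrite ltnS.
    by rewrite ltnS leq_subr.
  rewrite (exchange_big_dep predT) //=; apply: eq_bigr => N _.
  have leN : (N <= d)%N by rewrite -ltnS.
  transitivity ('C(m + d, m + N)%:R * kl_half m N
       * \sum_(k < (d - N).+1) ('X - 1) ^+ k *+ 'C(d - N, k) : {poly int}).
    rewrite -['X in LHS](subrK 1) [_ + 1]addrC exprDn mulrAC; congr (_ * _); apply: eq_bigr => k _.
    by rewrite expr1n mul1r.
  rewrite mulr_sumr.
  have -> : \sum_(k < d.+1 | (N <= d - k)%N)
      ('C(m + d, k)%:R * ('X - 1) ^+ k * ('C(m + (d - k), m + N)%:R * kl_half m N))
    = \sum_(k < d.+1 | (k < (d - N).+1)%N)
      ('C(m + d, k)%:R * ('X - 1) ^+ k * ('C(m + (d - k), m + N)%:R * kl_half m N)) :> {poly int}.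
    by apply: eq_bigl => k; have := ltn_ord k; lia.
  rewrite -(big_ord_widen_cond d.+1 xpredT
    (fun k => 'C(m + d, k)%:R * ('X - 1) ^+ k * ('C(m + (d - k), m + N)%:R * kl_half m N)));
    last by lia.
  apply: eq_bigr => k _; have lek := ltn_ord k.
  have e : ('C(m + d, k) * 'C(m + (d - k), m + N) = 'C(m + d, m + N) * 'C(d - N, k))%N.
    have -> : (m + (d - k) = m + d - k)%N by lia.
    rewrite bin_mul_bin; last by lia.
    by congr (_ * 'C(_, _))%N; lia.
  rewrite -[_ ^+ k *+ _]mulr_natr.
  transitivity (('C(m + d, m + N) * 'C(d - N, k))%:R * ('X - 1) ^+ k * kl_half m N : {poly int}).
    by rewrite natrM; ring.
  by rewrite -e natrM; ring.
transitivity (\sum_(j < d) 'C(m + d, m + j.+1)%:R * (-1) ^+ (d - j.+1) * ('X^(j.+1) - 1)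
   : {poly int}); last first.
  rewrite /uniform_charpoly (reindex_inj rev_ord_inj) /=; apply: eq_bigr => j _.
  have ltj := ltn_ord j.
  have -> : (d - j.+1).+1 = (d - j)%N by lia.
  rewrite subKn 1?ltnW // ['C(_, _)%:R * _]mulrC; congr (_ * _%:R * _).
  rewrite -bin_sub; last by lia.
  by congr 'C(_, _); lia.
transitivity (\sum_(N < d.+1) \sum_(j < d | (j < N)%N) 'C(m + d, m + N)%:R * 'X^(d - N) *
    ('C(m + N, m + j.+1)%:R * (- (1 + 'X)) ^+ (N - j.+1) * ('X^(j.+1) - 1)) : {poly int}).
  apply: eq_bigr => N _; rewrite /kl_kernel mulr_sumr.
  rewrite (big_ord_widen_cond d xpredT (fun j => 'C(m + d, m + N)%:R * 'X^(d - N) *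
    ('C(m + N, m + j.+1)%:R * (- (1 + 'X)) ^+ (N - j.+1) * ('X^(j.+1) - 1)))) //.
  by rewrite -ltnS.
rewrite (exchange_big_dep predT) //=; apply: eq_bigr => j _; have ltj := ltn_ord j.
rewrite -(big_mkord (fun N => (j < N)%N) (fun N => 'C(m + d, m + N)%:R * 'X^(d - N) *
    ('C(m + N, m + j.+1)%:R * (- (1 + 'X)) ^+ (N - j.+1) * ('X^(j.+1) - 1)))).
rewrite (big_cat_nat (n := j.+1)) //=; last by lia.
rewrite big_nat_cond big1 ?add0r; last by move=> N /andP[]; lia.
rewrite -[X in index_iota X _](add0n j.+1) big_addn big_mkord.
(* The binomial sum collapses because X - (1+X) = -1; this is the origin of the powers of -(1+X) in
   [kl_kernel]. *)
transitivity ('C(m + d, m + j.+1)%:R * ('X^(j.+1) - 1) *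
  \sum_(q < (d - j.+1).+1) ('X ^+ (d - j.+1 - q) * (- (1 + 'X)) ^+ q) *+ 'C(d - j.+1, q) : {poly int}); last first.
  by rewrite -exprDn mulrAC; congr (_ * _ * _); congr (_ ^+ _); ring.
rewrite mulr_sumr; have -> : (d.+1 - j.+1 = (d - j.+1).+1)%N by lia.
apply: eq_big => [q|q _]; first by lia.
have ltq := ltn_ord q.
have e : ('C(m + d, m + (q + j.+1)) * 'C(m + (q + j.+1), m + j.+1)
          = 'C(m + d, m + j.+1) * 'C(d - j.+1, q))%N.
  rewrite bin_mul_sub; last by lia.
  by congr (_ * 'C(_, _))%N; lia.
have -> : (d - (q + j.+1) = d - j.+1 - q)%N by lia.
have -> : (q + j.+1 - j.+1 = q)%N by lia.
rewrite -[_ * _ *+ _]mulr_natr.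
transitivity (('C(m + d, m + (q + j.+1)) * 'C(m + (q + j.+1), m + j.+1))%:R *
   ('X^(d - j.+1 - q) * (- (1 + 'X)) ^+ q) * ('X^(j.+1) - 1) : {poly int}).
  by rewrite natrM; ring.
by rewrite e natrM; ring.
Qed.

(** For d >= 2, the matroid of rank d on d+1 elements with one circuit-hyperplane is U_(1,d-1) plus
    a coloop, with the polynomial of U_(1,d-1); relaxing it gives U_(1,d). As [uniform_KL 1 0] is 0,
    the value at d = 1 is 1. *)
Definition relaxation_KL (d : nat) : {poly int} := uniform_KL 1 d - uniform_KL 1 d.-1.

Lemma sum_sign_bin_trunc (R : comNzRingType) d :
  \sum_(k < d) (-1) ^+ k *+ 'C(d.+1, k) = - ((-1) ^+ d *+ d.+1 + (-1) ^+ d.+1) :> R.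
Proof.
have := exprDn (1 : R) (-1) d.+1.
rewrite subrr expr0n mulr0n 2!big_ord_recr /= binSn binn expr1n expr1n !mul1r mulr1n => e.
apply/eqP; rewrite -subr_eq0 opprK addrA eq_sym; apply/eqP/(etrans e).
by congr (_ + _ + _); apply: eq_bigr => k _; rewrite expr1n mul1r.
Qed.

(** U_(1,d) is the cycle matroid of a cycle of length d+1, whose chromatic polynomial is on the
    right. *)
Lemma uniform_charpoly1X d :
  'X * uniform_charpoly 1 d = ('X - 1) ^+ d.+1 + (-1) ^+ d.+1 * ('X - 1).
Proof.
have e2 : \sum_(k < d) (-1) ^+ k * 'C(d.+1, k)%:R * 'X^(d.+1 - k)
    = ('X - 1) ^+ d.+1 - (((-1) ^+ d *+ d.+1) * 'X + (-1) ^+ d.+1) :> {poly int}.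
  rewrite exprDn 2!big_ord_recr /= binSn binn subnn subSnn expr0 expr1 mul1r mulr1n.
  have -> : \sum_(k < d) (-1) ^+ k * 'C(d.+1, k)%:R * 'X^(d.+1 - k)
      = \sum_(i < d) 'X^(d.+1 - i) * (-1) ^+ i *+ 'C(d.+1, i) :> {poly int}.
    by apply: eq_bigr => k _; rewrite -[in RHS]mulr_natr; ring.
  by rewrite -[_ *+ d.+1]mulr_natr -[(-1) ^+ d *+ d.+1]mulr_natr; ring.
rewrite /uniform_charpoly mulr_sumr.
transitivity (\sum_(k < d) (-1) ^+ k * 'C(d.+1, k)%:R * 'X^(d.+1 - k)
              - 'X * \sum_(k < d) (-1) ^+ k *+ 'C(d.+1, k) : {poly int}).
  rewrite mulr_sumr -sumrB; apply: eq_bigr => k _.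
  rewrite add1n -[in RHS]mulr_natr subSn; last by rewrite ltnW.
  by rewrite exprS; ring.
by rewrite sum_sign_bin_trunc e2 exprS -[_ *+ d.+1]mulr_natr; ring.
Qed.

Lemma uniform_charpoly1S d :
  uniform_charpoly 1 d.+1 = ('X - 1) * uniform_charpoly 1 d + (-1) ^+ d * ('X - 1).
Proof.
apply: (@mulfI _ (polyX int)); first by rewrite polyX_eq0.
rewrite mulrDr mulrCA !uniform_charpoly1X.
by rewrite !exprS; ring.
Qed.

Lemma size_relaxation_KL d : (size (relaxation_KL d) <= uphalf d)%N.
Proof.
apply: (leq_trans (size_polyD _ _)); rewrite size_polyN geq_max size_uniform_KL /=.
by apply: (leq_trans (size_uniform_KL _ _)); lia.
Qed.

(** This is the part of condition (iii) proportional to lambda, in rank d+1: the sum runs over the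
    subsets of one circuit-hyperplane, the next term is its restriction U_(1,d), and the last is its
    effect on the characteristic polynomial of the whole matroid. The proof splits C(d+2,k) by
    Pascal's rule. *)
Lemma relaxation_KL_rec d : revpoly d.+1 (relaxation_KL d.+1)
    = \sum_(k < d.+1) 'C(d.+1, k)%:R * ('X - 1) ^+ k * relaxation_KL (d.+1 - k)
      - uniform_charpoly 1 d - (-1) ^+ d.+1 * ('X - 1).
Proof.
rewrite /relaxation_KL revpolyD revpolyN /= uniform_KL_rec.
rewrite (@revpoly_shift d.+1 d); [|by []|by apply: leq_trans (size_uniform_KL _ _) _; lia].
rewrite subSnn expr1 uniform_KL_rec uniform_charpoly1S !add1n.
pose f k : {poly int} := ('X - 1) ^+ k * uniform_KL 1 (d.+1 - k).
pose g k : {poly int} := ('X - 1) ^+ k * uniform_KL 1 (d - k).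
have -> : \sum_(k < d.+1) 'C(d.+2, k)%:R * ('X - 1) ^+ k * uniform_KL 1 (d.+1 - k)
    = \sum_(k < d.+1) 'C(d.+1, k)%:R * f k + ('X - 1) * \sum_(k < d) 'C(d.+1, k)%:R * g k :> {poly int}.
  rewrite big_ord_recl [X in _ = X + _]big_ord_recl !bin0 /f -mulrA -addrA; congr (_ + _).
  rewrite mulr_sumr -big_split /=; apply: eq_bigr => k _.
  by rewrite /bump /= add1n binS natrD /g subSS exprS; ring.
have -> : \sum_(k < d) 'C(d.+1, k)%:R * ('X - 1) ^+ k * uniform_KL 1 (d - k)
    = \sum_(k < d) 'C(d.+1, k)%:R * g k :> {poly int}.
  by apply: eq_bigr => k _; rewrite /g mulrA.
have -> : \sum_(k < d.+1) 'C(d.+1, k)%:R * ('X - 1) ^+ k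
             * (uniform_KL 1 (d.+1 - k) - uniform_KL 1 (d.+1 - k).-1)
    = \sum_(k < d.+1) 'C(d.+1, k)%:R * f k - \sum_(k < d) 'C(d.+1, k)%:R * g k :> {poly int}.
  have -> : \sum_(k < d) 'C(d.+1, k)%:R * g k = \sum_(k < d.+1) 'C(d.+1, k)%:R * g k :> {poly int}.
    by rewrite big_ord_recr /= /g subnn uniform_KL0 !mulr0 addr0.
  rewrite -sumrB; apply: eq_bigr => k _; rewrite /f /g.
  have -> : (d.+1 - k).-1 = (d - k)%N by lia.
  by ring.
by rewrite exprS; ring.
Qed.

(** * Sparse paving matroids *)

Section SubsetSums.

Variable T : finType.
Implicit Types (A B E : {set T}).

Lemma sum_subsets_card (V : nmodType) (f : nat -> V) E d :
  \sum_(A : {set T} | (A \subset E) && (#|A| < d)%N) f #|A|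
    = \sum_(k < d) f k *+ 'C(#|E|, k).
Proof.
transitivity (\sum_(A : {set T} | (A \subset E) && (#|A| < d)%N)
   \sum_(k < d | #|A| == k) f k).
  by apply: eq_bigr => A /andP[_ lt]; rewrite (big_pred1 (Ordinal lt)).
rewrite (exchange_big_dep xpredT) //=; apply: eq_bigr => k _.
rewrite -cards_draws -sumr_const; apply: eq_bigl => A.
rewrite inE -andbA; congr (_ && _); apply/andP/eqP => [[_ /eqP]|->] //.
Qed.

Lemma sum_all_subsets_card (V : nmodType) (f : nat -> V) E :
  \sum_(A : {set T} | A \subset E) f #|A| = \sum_(k < #|E|.+1) f k *+ 'C(#|E|, k).
Proof.
rewrite -sum_subsets_card; apply: eq_bigl => A.
by case s: (A \subset E) => //=; rewrite ltnS subset_leq_card.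
Qed.

End SubsetSums.

Section SparsePaving.

Variable T : finType.
Implicit Types (M : matroid T) (A B C F G H : {set T}).

(** The second half is pavingness of the dual, expressed without the dual; in this form the property
    passes to contractions ([contract_small_large]). *)
Definition small_indep_large_spanning M : Prop :=
  (forall A, A \subset ground M -> (#|A| < rank M)%N -> A \in indep M) /\
  (forall A, A \subset ground M -> (rank M < #|A|)%N -> rk M A = rank M).

Lemma paving_small_indep M A : paving M -> A \subset ground M ->
  (#|A| < rank M)%N -> A \in indep M.
Proof.
move=> /forallP pM sA ltA; apply: contraT => nA.
have [|C cC sC] := @minset_exists T (fun B => (B \subset ground M) && (B \notin indep M)) A.
  by rewrite sA.
have := pM C; rewrite /circuit cC /=; have := subset_leq_card sC; lia.
Qed.

Lemma rank_dual_ge M : (#|ground M| - rank M <= rank (dual M))%N.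
Proof.
have [B [iB sB eB]] := rk_witness M (ground M).
rewrite /rank -eB -cardsDS //; apply: rk_ge; last exact: subsetDl.
rewrite /= !inE subsetDl /=; apply/existsP; exists B.
by rewrite subxx andbT; apply/baseP.
Qed.

Lemma sparse_pavingP M : sparse_paving M -> small_indep_large_spanning M.
Proof.
case/andP=> pM pD; split=> A sA ltA; first exact: paving_small_indep.
apply/eqP; rewrite eqn_leq rkS //= leqNgt; apply/negP => lt.
have := @paving_small_indep (dual M) (ground M :\: A) pD.
rewrite /= subsetDl => /(_ isT).
have -> : (#|ground M :\: A| < rank (dual M))%N.
  by have := rank_dual_ge M; rewrite cardsDS //; have := subset_leq_card sA; lia.
move=> /(_ isT); rewrite !inE => /andP[_ /existsP[B /andP[/baseP[iB eB] sB]]].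
have : (#|B| <= rk M A)%N.
  apply: rk_ge => //; apply/subsetP => x xB; have xE := subsetP (indep_ground iB) x xB.
  by have := subsetP sB x; rewrite !inE xB xE /=; case: (x \in A) => // /(_ isT).
lia.
Qed.

Section Structure.

Variable M : matroid T.
Hypothesis nuM : small_indep_large_spanning M.

(** Smaller sets are independent and larger ones span, which fixes the size. Conversely, such a set
    becomes independent when an element is removed and spanning when one is added. *)
Lemma circuit_hyperplanesE C : (C \in circuit_hyperplanes M)
  = [&& C \subset ground M, #|C| == rank M & C \notin indep M].
Proof.
have [small large] := nuM; rewrite inE; apply/andP/and3P.
  move=> [/minsetp/andP[sC nC] /andP[_ /eqP rC]]; split=> //.
  rewrite eqn_leq; apply/andP; split; rewrite leqNgt; apply/negP => lt.
    by have := large C sC lt; lia.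
  by rewrite small in nC.
move=> [sC /eqP eC nC]; have rC : (rk M C < rank M)%N.
  have := rkS M sC; rewrite -/(rank M) leq_eqVlt => /orP[/eqP e|//].
  by move: nC; rewrite indep_rk sC e eC eqxx.
split.
  apply/minsetP; split=> [|B /andP[sB nB] sBC]; first by rewrite sC.
  apply/eqP; apply: contraNT nB => ne.
  by rewrite small // -eC proper_card // properEneq ne.
apply/andP; split.
  apply/flatsP; split=> // x xE xC; rewrite (large (x |: C)) //.
    by rewrite subUset sub1set xE.
  by rewrite cardsU1 xC eC; lia.
have [e|[x xC]] := set_0Vmem C; first by rewrite e indep0 in nC.
have eCx : (#|C :\ x|.+1 = rank M)%N by rewrite -eC (cardsD1 x C) xC.
have : (#|C :\ x| <= rk M C)%N.
  rewrite rk_ge ?subD1set // small //; last by rewrite -eCx.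
  exact: subset_trans (subD1set _ _) sC.
lia.
Qed.

Lemma ch_ground C : C \in circuit_hyperplanes M -> C \subset ground M.
Proof. by rewrite circuit_hyperplanesE => /and3P[]. Qed.

Lemma ch_card C : C \in circuit_hyperplanes M -> #|C| = rank M.
Proof. by rewrite circuit_hyperplanesE => /and3P[_ /eqP]. Qed.

Lemma ch_flat C : C \in circuit_hyperplanes M -> C \in flats M.
Proof. by rewrite inE => /andP[_ /andP[]]. Qed.

Lemma ch_rk C : C \in circuit_hyperplanes M -> (rk M C).+1 = rank M.
Proof. by rewrite inE => /andP[_ /andP[_ /eqP]]. Qed.

(** Two distinct ones with rank - 1 common elements would have an independent intersection and a
    spanning union, against submodularity. *)
Lemma ch_eq C1 C2 : C1 \in circuit_hyperplanes M -> C2 \in circuit_hyperplanes M ->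
  (rank M <= #|C1 :&: C2|.+1)%N -> C1 = C2.
Proof.
move=> h1 h2 le; apply/eqP; apply: contraT => ne.
have [small large] := nuM.
have e1 := ch_card h1; have e2 := ch_card h2.
have lt : (#|C1 :&: C2| < rank M)%N.
  rewrite -e1 proper_card // properEneq subsetIl andbT; apply: contraNneq ne => e.
  by rewrite eqEcard e1 e2 leqnn andbT -e subsetIr.
have := cardsUI C1 C2; have := rk_submod M C1 C2.
have sI : C1 :&: C2 \subset ground M by rewrite (subset_trans (subsetIl _ _)) ?ch_ground.
have : C1 :&: C2 \in indep M by rewrite small.
rewrite indep_rk sI /= => /eqP ->.
have := ch_rk h1; have := ch_rk h2; rewrite e1 e2 => r1 r2 sub c.
have : rk M (C1 :|: C2) = rank M by rewrite large ?subUset ?ch_ground //; lia.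
lia.
Qed.

Definition ch_above F : {set {set T}} := [set C in circuit_hyperplanes M | F \subset C].

Lemma in_ch_above C F :
  (C \in ch_above F) = (C \in circuit_hyperplanes M) && (F \subset C).
Proof. by rewrite in_set. Qed.

Lemma card_ch_above_le1 F : (rank M <= #|F|.+1)%N -> (#|ch_above F| <= 1)%N.
Proof.
move=> le; apply/card_le1_eqP => C1 C2; rewrite !in_ch_above => /andP[h1 s1] /andP[h2 s2].
apply: ch_eq => //; apply: (leq_trans le).
by rewrite ltnS subset_leq_card // subsetI s1 s2.
Qed.

(** Adding a point to F leaves it independent unless the result is a dependent set of size [rank M],
    that is, a circuit-hyperplane. *)
Lemma small_flatP F : F \subset ground M -> (#|F| < rank M)%N ->
  reflect (#|F|.+1 = rank M -> ch_above F = set0) (F \in flats M).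
Proof.
have [small large] := nuM; move=> sF ltF.
have iF := small F sF ltF; have rF : rk M F = #|F|.
  by move: iF; rewrite indep_rk => /andP[_ /eqP].
apply: (iffP idP) => [fF eF|h].
  apply/setP => C; rewrite in_ch_above in_set0; apply/negP => /andP[hC sFC].
  have [x xC xF] : exists2 x, x \in C & x \notin F.
    by apply/subsetPn; apply/negP => /subset_leq_card; rewrite (ch_card hC); lia.
  have /flatsP[_ /(_ x)] := fF; rewrite (subsetP (ch_ground hC)) // => /(_ isT xF).
  have : (rk M (x |: F) <= rk M C)%N by rewrite rkS // subUset sub1set xC.
  by have := ch_rk hC; lia.
apply/flatsP; split=> // x xE xF.
have sxF : x |: F \subset ground M by rewrite subUset sub1set xE.
have cxF : #|x |: F| = #|F|.+1 by rewrite cardsU1 xF.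
suff : x |: F \in indep M by rewrite indep_rk sxF /= cxF rF => /eqP ->.
have [lt|ge] := ltnP #|F|.+1 (rank M); first by rewrite small ?cxF.
have eF : #|F|.+1 = rank M by lia.
apply: contraT => n; have /setP/(_ (x |: F)) := h eF.
by rewrite in_set0 in_ch_above circuit_hyperplanesE sxF cxF eF eqxx n subsetUr.
Qed.

Lemma flat_cases F : F \in flats M -> (rank M <= #|F|)%N ->
  F = ground M \/ F \in circuit_hyperplanes M.
Proof.
have [small large] := nuM; move=> fF le; have sF := flat_ground fF.
have h : rk M F = rank M -> F = ground M.
  by move=> e; apply: (rk_flat_eq fF).
have [iF|nF] := boolP (F \in indep M).
  left; apply: h; move: iF; rewrite indep_rk sF => /eqP e.
  by have := rkS M sF; rewrite -/(rank M); lia.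
move: le; rewrite leq_eqVlt => /orP[/eqP e|lt]; last by left; apply/h/large.
by right; rewrite circuit_hyperplanesE sF -e eqxx nF.
Qed.

Lemma ground_notin_ch : ground M \notin circuit_hyperplanes M.
Proof. by apply/negP => /ch_rk; rewrite -/(rank M); lia. Qed.

Lemma rank_le_ground : (rank M <= #|ground M|)%N.
Proof. exact: rk_leq_card. Qed.

Lemma sum_flats (V : nmodType) (f : {set T} -> V) :
  \sum_(F in flats M) f F
    = \sum_(F : {set T} | (F \in flats M) && (#|F| < rank M)%N) f F
      + \sum_(C in circuit_hyperplanes M) f C + f (ground M).
Proof.
rewrite (bigID (fun F => #|F| < rank M)%N) /= -addrA; congr (_ + _).
rewrite (bigID (fun F => F \in circuit_hyperplanes M)) /=; congr (_ + _).
  apply: eq_bigl => F; case h: (F \in circuit_hyperplanes M); rewrite ?andbF //.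
  by rewrite ch_flat // (ch_card h) ltnn.
apply: big_pred1 => F; apply/idP/eqP => [/andP[/andP[fF]]|->].
  by rewrite -leqNgt => le nh; have [|h] := flat_cases fF le; last rewrite h in nh.
by rewrite ground_flat ground_notin_ch -leqNgt rank_le_ground.
Qed.

Lemma sum_ch_above (V : nmodType) (f : nat -> V) :
  \sum_(F : {set T} | (F \subset ground M) && (#|F| < rank M)%N) f #|F| *+ #|ch_above F|
    = (\sum_(k < rank M) f k *+ 'C(rank M, k)) *+ #|circuit_hyperplanes M|.
Proof.
transitivity (\sum_(F : {set T} | (F \subset ground M) && (#|F| < rank M)%N)
    \sum_(C in circuit_hyperplanes M | F \subset C) f #|F|).
  by apply: eq_bigr => F _; rewrite -sumr_const; apply: eq_bigl => C; rewrite in_ch_above.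
rewrite (exchange_big_dep (fun C => C \in circuit_hyperplanes M)) /=; last first.
  by move=> F C _ /andP[].
rewrite -sumr_const; apply: eq_bigr => C hC.
transitivity (\sum_(k < rank M) f k *+ 'C(#|C|, k)); last first.
  by apply: eq_bigr => k _; rewrite ch_card.
rewrite -sum_subsets_card; apply: eq_bigl => F; rewrite hC /=.
apply/andP/andP => [[/andP[_ ->] ->]|[s ->]] //.
by rewrite s (subset_trans s) // ch_ground.
Qed.

(** Each circuit-hyperplane contains [rank M] sets of size [(rank M).-1], and by [ch_eq] each of
    these lies in at most one. Lower and upper in the two names refer to the level of sets that is
    counted; both lemmas bound the number of circuit-hyperplanes from above. *)
Lemma ch_lower_bound : (0 < rank M)%N ->
  (#|circuit_hyperplanes M| * rank M <= 'C(#|ground M|, (rank M).-1))%N.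
Proof.
move=> r0.
have := sum_ch_above (fun k => nat_of_bool (k == (rank M).-1)).
have := sum_subsets_card (fun k => nat_of_bool (k == (rank M).-1)) (ground M) (rank M).
have lt : ((rank M).-1 < rank M)%N by rewrite prednK.
have e (n : nat) : \sum_(k < rank M) (nat_of_bool (k == (rank M).-1 :> nat)) *+ 'C(n, k) = 'C(n, (rank M).-1).
  rewrite (bigD1 (Ordinal lt)) //= eqxx big1 ?addr0 => [|k ne].
    by rewrite -mulr_natr mul1r natn.
  by move: ne; rewrite -val_eqE /= => /negPf ->; rewrite mul0rn.
rewrite !e => <- e2.
have -> : (#|circuit_hyperplanes M| * rank M = 'C(rank M, (rank M).-1) *+ #|circuit_hyperplanes M|)%N.
  by case: (rank M) r0 => // r _; rewrite /= binSn mulnC -mulr_natr natn.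
rewrite -e2; apply: leq_sum => F /andP[_ ltF].
case: eqP => [eF|_]; last by rewrite mul0rn.
have := @card_ch_above_le1 F; rewrite eF prednK // leqnn => /(_ isT).
by rewrite -mulr_natr mul1r natn.
Qed.

(** Two circuit-hyperplanes inside one set of size [(rank M).+1] would meet in at least
    [(rank M).-1] elements. *)
Lemma ch_upper_bound :
  (#|circuit_hyperplanes M| * (#|ground M| - rank M) <= 'C(#|ground M|, (rank M).+1))%N.
Proof.
rewrite -cards_draws -sum1_card.
have -> : ((\sum_(C in circuit_hyperplanes M) 1) * (#|ground M| - rank M))%N
   = \sum_(C in circuit_hyperplanes M)
       \sum_(G in [set A : {set T} | A \subset ground M & #|A| == (rank M).+1] | C \subset G) 1%N :> nat.
  rewrite big_distrl /=; apply: eq_bigr => C hC; rewrite mul1n.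
  rewrite -(ch_card hC) -cardsDS ?ch_ground // sum1dep_card.
  have inj : {in ground M :\: C &, injective (fun x => x |: C)}.
    move=> x y; rewrite !inE => /andP[xC xE] /andP[yC yE] /setP/(_ x).
    by rewrite !inE eqxx /= (negPf xC) orbF => /esym/eqP.
  rewrite -(card_in_imset inj); apply: eq_card => G; rewrite !inE.
  apply/imsetP/idP => [[x /setDP[xE xC] ->]|/andP[/andP[sG /eqP cG] sCG]].
    by rewrite subUset sub1set xE ch_ground //= cardsU1 xC (ch_card hC) eqxx subsetUr.
  have : #|G :\: C| = 1%N by rewrite cardsDS // cG (ch_card hC) subSnn.
  move=> /eqP/cards1P[x e]; exists x.
    have : x \in G :\: C by rewrite e set11.
    by rewrite !inE => /andP[-> xG]; rewrite (subsetP sG).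
  by rewrite -e setUC -{1}(setIidPr sCG) setID.
rewrite (exchange_big_dep (mem [set A : {set T} | A \subset ground M & #|A| == (rank M).+1])) /=;
  last by move=> C G _ /andP[].
rewrite -sum1_card; apply: leq_sum => G; rewrite inE => /andP[sG /eqP cG].
rewrite sum1dep_card; apply/card_le1_eqP => C1 C2.
rewrite in_set => /and3P[h1 _ s1]; rewrite in_set => /and3P[h2 _ s2].
apply: ch_eq => //; have := cardsUI C2 C1; rewrite (ch_card h1) (ch_card h2).
have : (#|C2 :|: C1| <= #|G|)%N by rewrite subset_leq_card // subUset s1 s2.
lia.
Qed.

End Structure.

End SparsePaving.

(** * Kazhdan-Lusztig polynomials of sparse paving matroids *)

Lemma scale_sign k (p : {poly int}) : (-1) ^+ k *: p = (-1) ^+ k * p.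
Proof. by rewrite -signr_odd scaler_sign -[in RHS]signr_odd mulr_sign. Qed.

Section KLformula.

Variable T : finType.
Implicit Types (M : matroid T) (A B C F G H : {set T}).

Lemma contract_small_large M F : small_indep_large_spanning M -> F \subset ground M ->
  (#|F| < rank M)%N ->
  rank (contract M F) = (rank M - #|F|)%N /\ small_indep_large_spanning (contract M F).
Proof.
move=> [small large] sF ltF.
have iF := small F sF ltF; have rF : rk M F = #|F|.
  by move: iF; rewrite indep_rk => /andP[_ /eqP].
have cU A : A \subset ground M :\: F -> #|A :|: F| = (#|A| + #|F|)%N.
  rewrite subsetD => /andP[_]; rewrite -setI_eq0 => /eqP e.
  by have := cardsUI A F; rewrite e cards0 addn0.
have sU A : A \subset ground M :\: F -> A :|: F \subset ground M.
  by rewrite subsetD subUset sF => /andP[->].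
rewrite /small_indep_large_spanning rank_contract // rF; split=> //; split=> A /= sA hA.
  have lt : (#|A :|: F| < rank M)%N by rewrite cU //; lia.
  have := small _ (sU A sA) lt; rewrite indep_rk cU // => /andP[_ /eqP e].
  by rewrite !inE sA e rF eqxx.
by rewrite rk_contract // large ?sU ?cU // ?rF //; lia.
Qed.

Lemma card_ch_contract M F : small_indep_large_spanning M -> F \subset ground M ->
  (#|F| < rank M)%N -> #|circuit_hyperplanes (contract M F)| = #|ch_above M F|.
Proof.
move=> nuM sF ltF; have [small large] := nuM.
have iF := small F sF ltF; have rF : rk M F = #|F|.
  by move: iF; rewrite indep_rk => /andP[_ /eqP].
have [rC nuC] := contract_small_large nuM sF ltF.
have inj : {in ch_above M F &, injective (fun C => C :\: F)}.
  move=> C1 C2; rewrite !in_ch_above => /andP[_ s1] /andP[_ s2] e.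
  by rewrite -(setID C1 F) -(setID C2 F) (setIidPr s1) (setIidPr s2) e.
rewrite -(card_in_imset inj); apply: eq_card => A.
have e C : F \subset C -> C :\: F :|: F = C.
  by move=> sFC; rewrite setUC -{1}(setIidPr sFC) setID.
rewrite circuit_hyperplanesE // rC; apply/and3P/imsetP => /=.
  move=> [sA /eqP cA nA].
  have /andP[sAE dA] : (A \subset ground M) && [disjoint A & F] by rewrite -subsetD.
  have cU : #|A :|: F| = rank M.
    have := cardsUI A F; move: dA; rewrite -setI_eq0 => /eqP ->; rewrite cards0; lia.
  have sU : A :|: F \subset ground M by rewrite subUset sAE.
  exists (A :|: F); last by rewrite setDUl setDv setU0 (setDidPl dA).
  rewrite in_ch_above circuit_hyperplanesE // sU cU eqxx subsetUr andbT /=.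
  apply: contra nA; rewrite indep_rk sU cU !inE sA /= rF cA => /eqP ->.
  by rewrite subnK // ltnW.
move=> [C]; rewrite in_ch_above circuit_hyperplanesE // => /andP[/and3P[sC /eqP cC nC] sFC] ->.
rewrite setSD // cardsDS // cC eqxx; split=> //.
apply: contra nC; rewrite inE => /andP[_]; rewrite (e C sFC) cardsDS // cC rF.
by rewrite (subnK (ltnW ltF)) indep_rk sC cC.
Qed.

Lemma mobius_boolean M F : (forall G, G \subset F -> G \in flats M) ->
  (forall G, G \subset F -> rk M G = #|G|) -> mobius M F = (-1) ^+ #|F|.
Proof.
have [n] := ubnP #|F|; elim: n F => // n IHn F ltF fl rkF.
rewrite mobiusE rkF //.
transitivity ((#|F| == 0%N)%:R - (\sum_(G : {set T} | G \subset F) (-1) ^+ #|G| - (-1) ^+ #|F|) : int).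
  congr (_ - _); rewrite [in RHS](bigD1 F) //= [X in _ = X]addrAC subrr add0r.
  apply: eq_big => [G|G /andP[_ pG]].
    rewrite properEneq andbC; case s: (G \subset F); rewrite ?andbF //= andbT.
    by rewrite fl // andbT.
  have sG := proper_sub pG; have := proper_card pG => cG.
  by apply: IHn => [|H sH|H sH]; [lia | apply: fl | apply: rkF]; apply: subset_trans sG.
have -> : \sum_(G : {set T} | G \subset F) (-1) ^+ #|G| = (#|F| == 0%N)%:R :> int.
  rewrite (sum_all_subsets_card (fun k => (-1) ^+ k)) -expr0n -(subrr 1) exprDn.
  by apply: eq_bigr => k _; rewrite expr1n mul1r.
by rewrite opprB addrCA subrr addr0.
Qed.

(** Subtracting the vanishing sum of the Moebius values removes the term of the top flat, so that
    its Moebius value need not be computed. *)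
Lemma charpoly_restrict_sub1 M G : G \in flats M -> (0 < rk M G)%N ->
  charpoly (restrict M G)
    = \sum_(H in flats M | H \subset G) mobius M H *: ('X^(rk M G - rk M H) - 1).
Proof.
move=> fG r0; rewrite charpoly_restrict // -[LHS]subr0.
have := mobius_sum fG; rewrite eqn0Ngt r0 mulr0n => e.
rewrite -[X in _ - X](scale0r (1 : {poly int})) -e scaler_suml -sumrB.
by apply: eq_bigr => H _; rewrite scalerBr.
Qed.

Lemma charpoly_sub1 M : (0 < rank M)%N ->
  charpoly M = \sum_(F in flats M) mobius M F *: ('X^(rank M - rk M F) - 1).
Proof.
move=> r0; rewrite /charpoly -[LHS]subr0.
have := mobius_sum (ground_flat M); rewrite -/(rank M) eqn0Ngt r0 mulr0n => e.
rewrite -[X in _ - X](scale0r (1 : {poly int})) -e scaler_suml.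
under [X in _ - X]eq_bigl => F.
  rewrite (_ : _ && _ = (F \in flats M)); last by apply/andb_idr/flat_ground.
  over.
by rewrite -sumrB; apply: eq_bigr => H _; rewrite scalerBr.
Qed.

Section Formula.

Variable M : matroid T.
Hypotheses (nuM : small_indep_large_spanning M) (lM : loopless M).
Let d := rank M.

Lemma small_rk F : F \subset ground M -> (#|F| < d)%N -> rk M F = #|F|.
Proof. by move=> sF /(nuM.1 _ sF); rewrite indep_rk => /andP[_ /eqP]. Qed.

Lemma very_small_flat F : F \subset ground M -> (#|F|.+1 < d)%N -> F \in flats M.
Proof. by move=> sF lt; apply/small_flatP => //; rewrite -/d; lia. Qed.

Lemma subset_small_flat F G : F \in flats M -> (#|F| < d)%N -> G \subset F -> G \in flats M.
Proof.
move=> fF lt sG; have [->|ne] := eqVneq G F; first by [].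
apply: very_small_flat; first exact: subset_trans (flat_ground fF).
by have : (#|G| < #|F|)%N by [rewrite proper_card // properEneq ne]; lia.
Qed.

Lemma mobius_small F : F \in flats M -> (#|F| < d)%N -> mobius M F = (-1) ^+ #|F|.
Proof.
move=> fF lt; apply: mobius_boolean => G sG; first exact: (subset_small_flat fF).
by apply: small_rk; [exact: subset_trans (flat_ground fF) | exact: leq_ltn_trans (subset_leq_card sG) _].
Qed.

Lemma charpoly_small F : F \in flats M -> (#|F| < d)%N ->
  charpoly (restrict M F) = ('X - 1) ^+ #|F|.
Proof.
move=> fF lt; rewrite charpoly_restrict //; have sF := flat_ground fF.
transitivity (\sum_(H : {set T} | H \subset F) (-1) ^+ #|H| *: 'X^(#|F| - #|H|) : {poly int}).
  apply: eq_big => [H|H /andP[fH sH]].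
    by apply/andb_idl/subset_small_flat.
  have ltH := leq_ltn_trans (subset_leq_card sH) lt.
  by rewrite mobius_small // !small_rk // flat_ground.
rewrite (sum_all_subsets_card (fun k => (-1) ^+ k *: 'X^(#|F| - k))) exprDn.
apply: eq_bigr => k _; congr (_ *+ _).
by rewrite scale_sign mulrC.
Qed.

(** The sets of size below d that are not flats are the (d-1)-subsets of the circuit-hyperplanes: d
    for each of these, and none counted twice. *)
Lemma sum_small_flats (V : zmodType) (f : nat -> V) : (0 < d)%N ->
  \sum_(F : {set T} | (F \in flats M) && (#|F| < d)%N) f #|F|
    = \sum_(k < d) f k *+ 'C(#|ground M|, k) - f d.-1 *+ d *+ #|circuit_hyperplanes M|.
Proof.
move=> d0; rewrite -sum_subsets_card.
have lt : (d.-1 < d)%N by rewrite prednK.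
have -> : f d.-1 *+ d = \sum_(k < d) (f k *+ (k == d.-1 :> nat)) *+ 'C(d, k).
  rewrite (bigD1 (Ordinal lt)) //= eqxx big1 ?addr0 => [|k].
    by case: (d) d0 => // n _; rewrite binSn.
  by rewrite -val_eqE /= => /negPf ->; rewrite mul0rn.
rewrite -(sum_ch_above nuM (fun k => f k *+ (k == d.-1))) -sumrB.
rewrite [RHS](bigID (fun F => F \in flats M)) /= [X in _ + X]big1 ?addr0 => [|F].
  apply: eq_big => [F|F /andP[fF ltF]].
    by case fF: (F \in flats M); rewrite ?andbF // (flat_ground fF) andbT.
  have /small_flatP := fF; rewrite flat_ground // => /(_ nuM isT ltF) h.
  case: eqP => [e|]; last by rewrite mulr0n mul0rn subr0.
  by rewrite h ?cards0 ?mulr0n ?subr0 // e prednK.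
move=> /andP[/andP[sF ltF]]; case: (small_flatP nuM sF ltF) => // nh _.
have e : #|F|.+1 = d by apply/eqP; apply: contra_notT nh => /eqP ne /ne.
have l1 := @card_ch_above_le1 _ _ nuM F; rewrite e leqnn in l1; have {}l1 := l1 isT.
have : ch_above M F <> set0 by move=> e0; apply: nh.
move=> /eqP; rewrite -card_gt0 => l0.
have -> : #|ch_above M F| = 1%N by lia.
by rewrite -e eqxx subrr.
Qed.

Lemma ch_rank_gt1 C : C \in circuit_hyperplanes M -> (1 < d)%N.
Proof.
rewrite circuit_hyperplanesE // => /and3P[sC /eqP cC nC].
rewrite ltnNge; apply: contra nC => le1.
have [e|[x xC]] := set_0Vmem C; first by rewrite e indep0.
have -> : C = [set x] by apply/eqP; rewrite eq_sym eqEcard sub1set xC cards1 cC.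
by move/forall_inP: lM => /(_ x); apply; rewrite (subsetP sC).
Qed.

Lemma sum_flats_below_ch (V : nmodType) (f : nat -> V) C : C \in circuit_hyperplanes M ->
  \sum_(H in flats M | H \proper C) f #|H| = \sum_(k < d.-1) f k *+ 'C(d, k).
Proof.
move=> hC; transitivity (\sum_(k < d.-1) f k *+ 'C(#|C|, k)); last first.
  by apply: eq_bigr => k _; rewrite (ch_card nuM).
have d1 := ch_rank_gt1 hC.
rewrite -sum_subsets_card; apply: eq_bigl => H; apply/andP/andP => -[].
  move=> fH pH; have sH := proper_sub pH; split=> //.
  have := proper_card pH; rewrite (ch_card nuM hC) -/d => lt.
  have /small_flatP := fH; rewrite flat_ground // => /(_ nuM isT lt) h.
  rewrite ltnNge; apply/negP => le.
  have /setP/(_ C) : ch_above M H = set0 by apply: h; rewrite -/d; lia.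
  by rewrite in_ch_above hC sH in_set0.
move=> sH lt; split.
  by apply: very_small_flat; [apply: (subset_trans sH); apply: ch_ground nuM _ hC | lia].
rewrite properEneq sH andbT; apply: contraTneq lt => ->.
by rewrite (ch_card nuM hC) -/d -leqNgt leq_pred.
Qed.

Lemma mobius_ch C : C \in circuit_hyperplanes M -> mobius M C = (-1) ^+ d.-1 *+ d.-1.
Proof.
move=> hC; have d1 := ch_rank_gt1 hC; have := ch_rk hC; rewrite -/d => rC.
rewrite mobiusE (_ : _ == _ = false) ?sub0r; last by lia.
transitivity (- \sum_(H in flats M | H \proper C) (-1) ^+ #|H| : int).
  congr (- _); apply: eq_bigr => H /andP[fH pH]; rewrite mobius_small //.
  by rewrite /d -(ch_card nuM hC) proper_card.
rewrite (sum_flats_below_ch (fun k => (-1) ^+ k)) //.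
case: (d) d1 => // d' _ /=; rewrite sum_sign_bin_trunc opprK mulrS exprS mulN1r.
by rewrite addrAC subrr add0r.
Qed.

(** A circuit with d elements restricts to U_(1,d-1). *)
Lemma charpoly_ch C : C \in circuit_hyperplanes M ->
  charpoly (restrict M C) = uniform_charpoly 1 d.-1.
Proof.
move=> hC; have d1 := ch_rank_gt1 hC; have := ch_rk hC; rewrite -/d => rC.
rewrite charpoly_restrict_sub1 ?ch_flat //; last by lia.
rewrite (bigD1 C) /=; last by rewrite ch_flat ?subxx.
rewrite subnn expr0 subrr scaler0 add0r.
transitivity (\sum_(H in flats M | H \proper C) (-1) ^+ #|H| *: ('X^(d.-1 - #|H|) - 1) : {poly int}).
  apply: eq_big => [H|H /andP[/andP[fH sH] ne]].
    by rewrite properEneq -andbA [(H != C) && _]andbC.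
  have lt : (#|H| < d)%N by rewrite /d -(ch_card nuM hC) proper_card // properEneq ne.
  rewrite mobius_small // (small_rk (flat_ground fH)) //.
  by congr (_ *: ('X^(_ - _) - 1)); lia.
rewrite (sum_flats_below_ch (fun k => (-1) ^+ k *: ('X^(d.-1 - k) - 1))) //.
apply: eq_bigr => k _; rewrite add1n prednK; last by lia.
by rewrite scale_sign -[_ *+ _]mulr_natr mulrAC.
Qed.

(** Each circuit-hyperplane adds (-1)^(d-1) (d-1) by its Moebius value and destroys d flats of size
    d-1, each worth (-1)^(d-1); the balance is (-1)^d times X - 1. *)
Lemma charpoly_sparse_paving m : #|ground M| = (m + d)%N -> (0 < d)%N ->
  charpoly M = uniform_charpoly m d + (-1) ^+ d * ('X - 1) *+ #|circuit_hyperplanes M|.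
Proof.
move=> cM d0; rewrite charpoly_sub1 // (sum_flats nuM) subnn expr0 subrr scaler0 addr0.
have -> : \sum_(C in circuit_hyperplanes M) mobius M C *: ('X^(rank M - rk M C) - 1)
   = (((-1) ^+ d.-1 *+ d.-1) *: ('X - 1)) *+ #|circuit_hyperplanes M| :> {poly int}.
  rewrite -sumr_const; apply: eq_bigr => C hC; rewrite mobius_ch //.
  by have := ch_rk hC => <-; rewrite subSnn expr1.
pose f k : {poly int} := (-1) ^+ k * ('X^(d - k) - 1).
have -> : \sum_(F : {set T} | (F \in flats M) && (#|F| < rank M)%N)
      mobius M F *: ('X^(rank M - rk M F) - 1)
    = \sum_(F : {set T} | (F \in flats M) && (#|F| < d)%N) f #|F|.
  apply: eq_bigr => F /andP[fF lt]; rewrite mobius_small // small_rk ?flat_ground //.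
  by rewrite scale_sign.
rewrite sum_small_flats // cM.
have -> : \sum_(k < d) f k *+ 'C(m + d, k) = uniform_charpoly m d.
  by apply: eq_bigr => k _; rewrite -[_ *+ _]mulr_natr /f mulrAC.
rewrite -addrA; congr (_ + _); rewrite -mulNrn -mulrnDl; congr (_ *+ _).
have -> : f d.-1 = (-1) ^+ d.-1 * ('X - 1) by rewrite /f (_ : (d - d.-1 = 1)%N) ?expr1; [|lia].
rewrite -scalerMnl scale_sign; case: (d) d0 => // d' _ /=.
by rewrite mulrS exprS; ring.
Qed.

End Formula.

End KLformula.

Lemma uniform_KL1 m : uniform_KL m 1 = 1.
Proof.
rewrite /uniform_KL 2!big_ord_recr big_ord0 /= kl_half0 mulr0 !add0r binn mul1r.
apply/polyP => -[|i]; rewrite coef_poly coef1 //=.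
rewrite /kl_kernel big_ord1 binn expr0 !mul1r expr1 coefB coefX coef1 /=.
by rewrite sub0r opprK.
Qed.

Section Formula.

Variable T : finType.
Implicit Types (M : matroid T) (A B C F G H : {set T}).

Lemma KLpoly_rank0 M : rank M = 0%N -> KLpoly M = 1.
Proof. by rewrite /KLpoly => ->. Qed.

Lemma KLpoly_rank1 M : loopless M -> rank M = 1%N -> KLpoly M = 1.
Proof.
move=> lM r1; have r0 : (0 < rank M)%N by rewrite r1.
have fl F : F \in flats M -> F != set0 -> F = ground M.
  move=> fF F0; apply: (rk_flat_eq fF) => //; first exact: flat_ground.
  have := rkS M (flat_ground fF); have := rk_flat_eq0 lM fF; rewrite (negPf F0).
  rewrite -/(rank M) r1; lia.
have ne0 : ground M != set0 by rewrite -(rk_flat_eq0 lM (ground_flat M)) -/(rank M) r1.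
have rE : rank (contract M (ground M)) = 0%N by rewrite rank_contract // subnn.
rewrite KLpolyE // r1 /KL_sum (big_pred1 (ground M)) => [|F]; last first.
  apply/andP/eqP => [[fF F0]|->]; first exact: fl.
  by rewrite ground_flat.
rewrite (KLpoly_rank0 rE) mulr1 charpoly_restrict ?ground_flat //.
rewrite (bigD1 (ground M)) /= ?ground_flat ?subxx // (big_pred1 set0) => [|F]; last first.
  apply/andP/eqP => [[/andP[fF _] ne]|->]; first by apply: contraNeq ne => /(fl F fF) ->.
  by rewrite loopless_flat0 // sub0set eq_sym.
have m0 : mobius M set0 = 1.
  by rewrite mobiusE rk0 eqxx big1 ?subr0 // => G /andP[_ /proper_card]; rewrite cards0.
have mE : mobius M (ground M) = -1.
  rewrite mobiusE -/(rank M) r1 (big_pred1 set0) ?m0 ?sub0r // => F.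
  apply/andP/eqP => [[fF pF]|->]; last by rewrite loopless_flat0 // proper0.
  by apply: contraTeq pF => /(fl F fF) ->; rewrite properxx.
rewrite m0 mE rk0 -/(rank M) r1 subnn expr0 expr1.
apply/polyP => -[|i]; rewrite coef_poly coef1 //=.
by rewrite coefD !coefZ coefX coef1 /= mulr0 addr0 mulr1 opprK.
Qed.

(** Contracting a small flat lowers the rank and preserves m, so induction on the rank gives every
    term but that of the empty flat. It then suffices that the candidate [Q set0] satisfies
    condition (iii), since its degree bound makes its coefficients readable from that equation. *)
Lemma KLpoly_sparse_paving M m : small_indep_large_spanning M -> loopless M ->
  (0 < rank M)%N -> #|ground M| = (m + rank M)%N ->
  KLpoly M = uniform_KL m (rank M) - relaxation_KL (rank M) *+ #|circuit_hyperplanes M|.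
Proof.
have [n] := ubnP (rank M); elim: n M => // n IHn M ltM nuM lM r0 cM.
set d := rank M in cM r0 *; set L := #|circuit_hyperplanes M|.
pose Q F : {poly int} := uniform_KL m (d - #|F|) - relaxation_KL (d - #|F|) *+ #|ch_above M F|.
have QF F : F \in flats M -> (#|F| < d)%N -> F != set0 -> KLpoly (contract M F) = Q F.
  move=> fF ltF F0; have sF := flat_ground fF.
  have [rC nuC] := contract_small_large nuM sF ltF.
  rewrite /Q -(card_ch_contract nuM) // -rC.
  have c0 : (0 < #|F|)%N by rewrite card_gt0.
  apply: IHn => //; rewrite ?rC; try (rewrite -/d; lia).
    exact: loopless_contract.
  by rewrite /= cardsDS // cM -/d; lia.
have Q0 : Q set0 = uniform_KL m d - relaxation_KL d *+ L.
  rewrite /Q cards0 subn0; congr (_ - _ *+ _); apply: eq_card => C.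
  by rewrite in_ch_above sub0set andbT.
(* A small set that is not a flat lies on exactly one circuit-hyperplane and has d-1 elements, so
   its [Q] is U_(m,1) - B_1 = 1 - 1. Hence the sum over small flats extends to all small sets, where
   it can be evaluated by cardinality. *)
have nonflat F : F \subset ground M -> (#|F| < d)%N -> F \notin flats M -> Q F = 0.
  move=> sF ltF; case: (small_flatP nuM sF ltF) => // nh _.
  have e : #|F|.+1 = d by apply/eqP; apply: contra_notT nh => /eqP ne /ne.
  have l1 : (#|ch_above M F| <= 1)%N by rewrite card_ch_above_le1 // -/d e.
  have : ch_above M F <> set0 by move=> e0; apply: nh.
  move=> /eqP; rewrite -card_gt0 => l0.
  have -> : Q F = uniform_KL m 1 - relaxation_KL 1 *+ 1.
    by rewrite /Q; congr (uniform_KL _ _ - relaxation_KL _ *+ _); lia.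
  by rewrite /relaxation_KL !uniform_KL1 uniform_KL0 subr0 subrr.
have key : revpoly d (Q set0) = Q set0 + KL_sum (@KLpoly T) M.
  transitivity (\sum_(F in flats M) charpoly (restrict M F)
      * (if F == set0 then Q set0 else KLpoly (contract M F))); last first.
    rewrite (bigD1 set0) ?loopless_flat0 //= eqxx charpoly_restrict0 // mul1r.
    by congr (_ + _); apply: eq_bigr => F /andP[_ /negPf ->].
  rewrite (sum_flats nuM) -/d.
  have e1 : \sum_(F | (F \in flats M) && (#|F| < d)%N)
       charpoly (restrict M F) * (if F == set0 then Q set0 else KLpoly (contract M F))
     = \sum_(k < d) 'C(m + d, k)%:R * ('X - 1) ^+ k * uniform_KL m (d - k)
       - (\sum_(k < d) 'C(d, k)%:R * ('X - 1) ^+ k * relaxation_KL (d - k)) *+ L.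
    transitivity (\sum_(F : {set T} | (F \subset ground M) && (#|F| < d)%N)
        (('X - 1) ^+ #|F| * uniform_KL m (d - #|F|)
         - ('X - 1) ^+ #|F| * relaxation_KL (d - #|F|) *+ #|ch_above M F|)).
      rewrite [RHS](bigID (fun F => F \in flats M)) /= [X in _ + X]big1 ?addr0 => [|F].
        apply: eq_big => [F|F /andP[fF ltF]].
          by case fF: (F \in flats M); rewrite ?andbF // (flat_ground fF) andbT.
        rewrite (charpoly_small nuM) // -mulrnAr -mulrBr; congr (_ * _).
        by case: eqP => [->|/eqP F0]; [|rewrite QF].
      move=> /andP[/andP[sF ltF] nF]; rewrite -mulrnAr -mulrBr.
      by rewrite -/(Q F) nonflat // mulr0.
    rewrite sumrB (sum_subsets_card (fun k => ('X - 1) ^+ k * uniform_KL m (d - k))).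
    rewrite (sum_ch_above nuM (fun k => ('X - 1) ^+ k * relaxation_KL (d - k))) cM.
    by congr (_ - _ *+ _); apply: eq_bigr => k _; rewrite -mulr_natr; ring.
  have e2 : \sum_(C in circuit_hyperplanes M)
       charpoly (restrict M C) * (if C == set0 then Q set0 else KLpoly (contract M C))
     = uniform_charpoly 1 d.-1 *+ L.
    rewrite -sumr_const; apply: eq_bigr => C hC; rewrite (charpoly_ch nuM) //.
    have := ch_card nuM hC; have := ch_rk hC; have := ch_flat hC.
    case: eqP => [->|_ fC rC cC]; first by rewrite cards0 -/d; lia.
    rewrite KLpoly_rank1 ?mulr1 ?loopless_contract // rank_contract ?flat_ground //; lia.
  have e3 : charpoly (restrict M (ground M))
       * (if ground M == set0 then Q set0 else KLpoly (contract M (ground M)))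
     = uniform_charpoly m d + (-1) ^+ d * ('X - 1) *+ L.
    rewrite -(charpoly_sparse_paving nuM lM) //.
    have -> : restrict M (ground M) = M.
      apply: eq_matroid => /=; first by rewrite setIid.
      by apply/setP => A; rewrite inE; apply/andb_idr/indep_ground.
    rewrite -(rk_flat_eq0 lM (ground_flat M)) -/(rank M) -/d.
    rewrite eqn0Ngt r0 /= KLpoly_rank0 ?mulr1 //.
    by rewrite rank_contract // subnn.
  rewrite e1 e2 e3 Q0 revpolyD revpolyN uniform_KL_rec.
  have -> : revpoly d (relaxation_KL d *+ L) = revpoly d (relaxation_KL d) *+ L.
    by rewrite -mulr_natl revpolyMn mulr_natl.
  rewrite -[in LHS](prednK r0) relaxation_KL_rec prednK //.
  set a := \sum_(k < d) _; set b := \sum_(k < d) _.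
  rewrite 2!mulrnBl; move: (a) (b *+ L) (uniform_charpoly _ _ *+ L) (_ * _ *+ L) => ? ? ? ?.
  by ring.
have szQ : (size (Q set0) <= uphalf d)%N.
  rewrite Q0; apply: (leq_trans (size_polyD _ _)); rewrite size_polyN geq_max size_uniform_KL.
  by rewrite -mulr_natl (leq_trans (size_natpolyM _ _)) ?size_relaxation_KL.
rewrite -Q0 KLpolyE // -/d; apply/polyP => i; rewrite coef_poly.
case: ltnP => hi; last by rewrite nth_default // (leq_trans szQ).
(* As 2i < d, the index d - i is beyond the degree bound of [Q set0]; the left side is 0 and the
   identity becomes the recursion for [KLpoly]. *)
have /polyP/(_ i) := key; rewrite coefD coef_revpoly.
have -> : (i <= d)%N by lia.
rewrite nth_default; last by apply: (leq_trans szQ); lia.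
by move=> /esym/eqP; rewrite addr_eq0 => /eqP ->.
Qed.

End Formula.

(** * Coefficients *)

Lemma alternating_bin_sum q s K :
  \sum_(j < K) (-1) ^+ j * 'C(q.+1, s.+1 + j)%:R = 'C(q, s)%:R - (-1) ^+ K * 'C(q, s + K)%:R :> int.
Proof.
elim: K => [|K IHK]; first by rewrite big_ord0 addn0 expr0 mul1r subrr.
rewrite big_ord_recr /= IHK addSn binS natrD exprS addnS.
by ring.
Qed.

Lemma alternating_bin_tail q s K : (q < s + K)%N ->
  \sum_(j < K) (-1) ^+ j * 'C(q.+1, s.+1 + j)%:R = 'C(q, s)%:R :> int.
Proof. by move=> lt; rewrite alternating_bin_sum (bin_small lt) mulr0 subr0. Qed.

Lemma coef_oneX_exp k t : ((- (1 + 'X)) ^+ k : {poly int})`_t = (-1) ^+ k * 'C(k, t)%:R.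
Proof.
rewrite [(- (_ + _)) ^+ k]exprNn -scale_sign coefZ addrC; congr (_ * _).
have := exprDn ('X : {poly int}) 1 k; rewrite addrC => ->.
rewrite (reindex_inj rev_ord_inj) /=.
have -> : \sum_(j < k.+1) 'X^(k - (k.+1 - j.+1)) * 1 ^+ (k.+1 - j.+1) *+ 'C(k, k.+1 - j.+1)
   = \poly_(j < k.+1) 'C(k, j)%:R :> {poly int}.
  rewrite poly_def; apply: eq_bigr => j _; have lej : (j <= k)%N by rewrite -ltnS.
  by rewrite subSS expr1n mulr1 subKn // bin_sub // scaler_nat.
by rewrite coef_poly; case: ltnP => // /bin_small ->.
Qed.

Definition alt_conv (m i e : nat) : int :=
  \sum_(q < e - i) (-1) ^+ q * ('C(m + e, m + i.+1 + q) * 'C(m + i + q, m))%:R.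

(** The first binomial product comes from the powers X^(j+1) with j < i, of which there are none for
    i = 0. The factor [0 < i] records this: at m = i = 0 the truncated predecessor alone would give
    'C(0, 0) = 1. *)
Lemma coef_kl_kernel m N i : (i < N)%N -> (kl_kernel m N)`_i =
  (-1) ^+ N.-1 * (('C(m + N, m + i) * ((0 < i) * 'C((m + i).-1, m)))%:R
                 - ('C(m + N, i) * 'C((m + N - i).-1, m))%:R).
Proof.
move=> ltN; rewrite /kl_kernel coef_sum.
transitivity (\sum_(j < N) (-1) ^+ N.-1 * ((-1) ^+ j * (
     ((j < i) * ('C(m + N, N - i) * 'C(m + i, m.+1 + j)))%:R
     - ('C(m + N, i) * 'C(m + N - i, m.+1 + j))%:R)) : int).
  apply: eq_bigr => j _; have ltj := ltn_ord j.
  have sg : (-1) ^+ (N - j.+1) = (-1) ^+ N.-1 * (-1) ^+ j :> int.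
    rewrite -exprD -signr_odd -[in RHS]signr_odd; congr (_ ^+ nat_of_bool _); lia.
  rewrite mulrBr mulr1 coefB coefMXn !mulr_natl !coefMn !coef_oneX_exp sg.
  have b1 : ('C(m + N, m.+1 + j) * 'C(N - j.+1, i) = 'C(m + N, i) * 'C(m + N - i, m.+1 + j))%N.
    have [le|gt] := leqP (m.+1 + j + i) (m + N).
      by rewrite -bin_mul_bin //; congr (_ * 'C(_, _))%N; lia.
    by rewrite [X in (_ * X)%N = _]bin_small ?[X in _ = (_ * X)%N]bin_small ?muln0 //; lia.
  rewrite -b1 addSnnS; case: ltnP => lij.
    by rewrite mul0n natrM; ring.
  have b2 : ('C(m + N, m + j.+1) * 'C(N - j.+1, i - j.+1) = 'C(m + N, N - i) * 'C(m + i, m + j.+1))%N.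
    rewrite -[in RHS](_ : m + N - (N - i) = m + i)%N; last by lia.
    rewrite -bin_mul_bin; last by lia.
    rewrite -(bin_sub (m := i - j.+1)); last by lia.
    by congr (_ * 'C(_, _))%N; lia.
  by rewrite mul1n -b2 !natrM; ring.
rewrite -mulr_sumr; congr (_ * _).
under eq_bigr do rewrite mulrBr.
rewrite sumrB; congr (_ - _).
  transitivity ('C(m + N, m + i)%:R * \sum_(j < i) (-1) ^+ j * 'C(m + i, m.+1 + j)%:R : int).
    rewrite mulr_sumr (big_ord_widen N (fun j => 'C(m + N, m + i)%:R
      * ((-1) ^+ j * 'C(m + i, m.+1 + j)%:R))); last exact: ltnW.
    rewrite [RHS]big_mkcond /=; apply: eq_bigr => j _.
    have -> : 'C(m + N, N - i) = 'C(m + N, m + i).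
      by rewrite -[RHS]bin_sub; [congr 'C(_, _); lia|lia].
    by case: ifP => _; rewrite ?mul0n ?mulr0 // mul1n natrM; ring.
  case: i {ltN} => [|i]; first by rewrite big_ord0 ltnn mul0n muln0 mulr0.
  rewrite addnS alternating_bin_tail ?mul1n ?natrM //; lia.
transitivity ('C(m + N, i)%:R * \sum_(j < N) (-1) ^+ j * 'C((m + N - i).-1.+1, m.+1 + j)%:R : int).
  rewrite mulr_sumr; apply: eq_bigr => j _; rewrite prednK; last by lia.
  by rewrite natrM; ring.
by rewrite alternating_bin_tail ?natrM //; lia.
Qed.

Lemma coef_uniform_KL m d i : (i.*2 < d)%N -> (uniform_KL m d)`_i =
  'C(m + d, i)%:R * alt_conv m i (d - i)
  - ('C(m + d, m + i) * ((0 < i) * 'C((m + i).-1, m)) * 'C((d - i).-1, i))%:R.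
Proof.
move=> lt2; rewrite /uniform_KL coef_sum.
transitivity (\sum_(q < d - i - i) (-1) ^+ q * (
   ('C(m + d, i) * ('C(m + (d - i), m + i.+1 + q) * 'C(m + i + q, m)))%:R
   - ('C(m + d, m + i) * 'C(d - i, i.+1 + q) * ((0 < i) * 'C((m + i).-1, m)))%:R) : int).
  rewrite -(big_mkord xpredT (fun N => ('C(m + d, m + N)%:R * kl_half m N)`_i)).
  rewrite (big_cat_nat (n := i.*2.+1)) //=; last by lia.
  rewrite big_nat_cond big1 ?add0r; last first.
    move=> N /andP[/andP[_ ltN] _]; rewrite mulr_natl coefMn coef_poly.
    by rewrite (_ : (i < uphalf N)%N = false) ?mul0rn //; lia.
  rewrite -[X in index_iota X _](add0n i.*2.+1) big_addn big_mkord.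
  have -> : (d.+1 - i.*2.+1 = d - i - i)%N by lia.
  apply: eq_bigr => q _; have ltq := ltn_ord q.
  rewrite mulr_natl coefMn coef_poly.
  have -> : (i < uphalf (q + i.*2.+1))%N by lia.
  rewrite coef_kl_kernel; last by lia.
  have -> : (-1) ^+ (q + i.*2.+1).-1 = (-1) ^+ q :> int.
    by rewrite -signr_odd -[in RHS]signr_odd; congr (_ ^+ nat_of_bool _); lia.
  have b1 : ('C(m + d, m + (q + i.*2.+1)) * 'C(m + (q + i.*2.+1), i)
             = 'C(m + d, i) * 'C(m + (d - i), m + i.+1 + q))%N.
    rewrite bin_mul_sub; last by lia.
    by congr (_ * 'C(_, _))%N; lia.
  have b2 : ('C(m + d, m + (q + i.*2.+1)) * 'C(m + (q + i.*2.+1), m + i)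
             = 'C(m + d, m + i) * 'C(d - i, i.+1 + q))%N.
    rewrite bin_mul_sub; last by lia.
    by congr (_ * 'C(_, _))%N; lia.
  have -> : (m + (q + i.*2.+1) - i).-1 = (m + i + q)%N by lia.
  rewrite [('C(m + d, i) * _)%N]mulnA -b1 -b2 -[_ *+ _]mulr_natr !natrM; ring.
under eq_bigr do rewrite mulrBr.
rewrite sumrB; congr (_ - _).
  by rewrite /alt_conv mulr_sumr; apply: eq_bigr => q _; rewrite natrM; ring.
transitivity (('C(m + d, m + i) * ((0 < i) * 'C((m + i).-1, m)))%:R *
   \sum_(q < d - i - i) (-1) ^+ q * 'C((d - i).-1.+1, i.+1 + q)%:R : int).
  rewrite mulr_sumr; apply: eq_bigr => q _; rewrite prednK; last by lia.
  by rewrite !natrM; ring.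
by rewrite alternating_bin_tail ?natrM //; lia.
Qed.

Lemma alt_conv0 i e : (i < e)%N -> alt_conv 0 i e = 'C(e.-1, i)%:R.
Proof.
move=> lt; rewrite /alt_conv -[RHS](@alternating_bin_tail _ _ (e - i)); last by lia.
by apply: eq_bigr => q _; rewrite prednK ?bin0 ?muln1 //; lia.
Qed.

Lemma alternating_abel (u v w : nat -> int) K : (forall q, v q.+1 = v q + w q) ->
  \sum_(q < K) (-1) ^+ q * ((u q.+1 + u q) * v q.+1)
    = \sum_(q < K) (-1) ^+ q * (u q * w q) + u 0%N * v 0%N - (-1) ^+ K * (u K * v K).
Proof.
move=> h; elim: K => [|K IHK]; first by rewrite !big_ord0 expr0; ring.
by rewrite !big_ord_recr /= IHK h exprS; ring.
Qed.

(** Pascal's rule on the first binomial and Abel summation on the second reproduce the sum for m, up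
    to one boundary term. *)
Lemma alt_convS m i e : (i < e)%N ->
  alt_conv m.+1 i e = alt_conv m i e + ('C(m + e, m + i.+1) * 'C(m + i, m.+1))%:R.
Proof.
move=> lt; rewrite /alt_conv.
pose u q : int := 'C(m + e, m + i.+1 + q)%:R.
pose v q : int := 'C(m + i + q, m.+1)%:R.
pose w q : int := 'C(m + i + q, m)%:R.
have h q : v q.+1 = v q + w q by rewrite /v /w addnS binS natrD.
have := @alternating_abel u v w (e - i) h.
have -> : u (e - i)%N = 0 by rewrite /u bin_small //; lia.
have -> : u 0%N * v 0%N = ('C(m + e, m + i.+1) * 'C(m + i, m.+1))%:R.
  by rewrite /u /v !addn0 natrM.
rewrite mul0r mulr0 subr0 => e1.
transitivity (\sum_(q < e - i) (-1) ^+ q * ((u q.+1 + u q) * v q.+1)).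
  apply: eq_bigr => q _; congr (_ * _); rewrite /u /v -natrD -natrM; congr (_%:R).
  by rewrite !addSn !addnS binS.
rewrite e1; congr (_ + _); by apply: eq_bigr => q _; rewrite /u /w natrM.
Qed.

Lemma alt_conv_i0 m e : (0 < e)%N -> alt_conv m 0 e = 1.
Proof.
move=> e0; elim: m => [|m IHm]; first by rewrite alt_conv0 // bin0.
by rewrite alt_convS // IHm addn0 [X in (_ * X)%N]bin_small // muln0 addr0.
Qed.

Lemma uniform_KL_coef0 m d : (0 < d)%N -> (uniform_KL m d)`_0 = 1.
Proof.
move=> d0; rewrite coef_uniform_KL // bin0 subn0 alt_conv_i0 //.
by rewrite ltnn mul0n muln0 mul0n subr0 mulr1.
Qed.

(** * Signs of rational functions *)

(** Polynomials as nested coefficient lists, with the highest-numbered variable outermost and binary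
    integers as coefficients, so that sign tests can be run by computation. *)
Fixpoint mpol (k : nat) : Type := if k is k'.+1 then seq (mpol k') else BinNums.Z.

Fixpoint mconst (k : nat) (z : BinNums.Z) : mpol k :=
  if k is k'.+1 then [:: mconst k' z] else z.

Fixpoint mvar (k j : nat) : mpol k :=
  if k is k'.+1 then
    if j == k' then [:: mconst k' BinNums.Z0; mconst k' (BinNums.Zpos BinNums.xH)] else [:: mvar k' j]
  else BinNums.Z0.

Fixpoint madd (k : nat) : mpol k -> mpol k -> mpol k :=
  if k is k'.+1 then
    fix add (p q : seq (mpol k')) : seq (mpol k') :=
      match p, q with
      | [::], _ => q
      | _, [::] => p
      | a :: p', b :: q' => madd a b :: add p' q'
      end
  else BinInt.Z.add.

Fixpoint mopp (k : nat) : mpol k -> mpol k :=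
  if k is k'.+1 then map (@mopp k') else BinInt.Z.opp.

Fixpoint mmul (k : nat) : mpol k -> mpol k -> mpol k :=
  if k is k'.+1 then
    fix mul (p q : seq (mpol k')) : seq (mpol k') :=
      if p is a :: p' then
        @madd k'.+1 (map (@mmul k' a) q) (mconst k' BinNums.Z0 :: mul p' q)
      else [::]
  else BinInt.Z.mul.

Fixpoint mnonneg (k : nat) : mpol k -> bool :=
  if k is k'.+1 then all (@mnonneg k') else BinInt.Z.leb BinNums.Z0.

Fixpoint mpos (k : nat) : mpol k -> bool :=
  if k is k'.+1 then
    fun p : seq (mpol k') => if p is a :: p' then mpos a && all (@mnonneg k') p' else false
  else BinInt.Z.ltb BinNums.Z0.

Inductive rexpr : Type :=
  | RVar of nat | RNat of nat | RAdd of rexpr & rexpr | RMul of rexpr & rexpr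
  | ROpp of rexpr | RInv of rexpr.

(* A fraction with denominator in [mpos], which is what the sign of the numerator needs. *)
Fixpoint rfrac (k : nat) (e : rexpr) : option (mpol k * mpol k) :=
  match e with
  | RVar j => if (j < k)%N then Some (mvar k j, mconst k (BinNums.Zpos BinNums.xH)) else None
  | RNat n => Some (mconst k (BinInt.Z.of_nat n), mconst k (BinNums.Zpos BinNums.xH))
  | RAdd e1 e2 =>
      if rfrac k e1 is Some (n1, d1) then
        if rfrac k e2 is Some (n2, d2) then
          Some (madd (mmul n1 d2) (mmul n2 d1), mmul d1 d2)
        else None
      else None
  | RMul e1 e2 =>
      if rfrac k e1 is Some (n1, d1) then
        if rfrac k e2 is Some (n2, d2) then Some (mmul n1 n2, mmul d1 d2) else None
      else None
  | ROpp e1 => if rfrac k e1 is Some (n, d) then Some (mopp n, d) else None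
  | RInv e1 =>
      if rfrac k e1 is Some (n, d) then if mpos n then Some (d, n) else None else None
  end.

Definition rexpr_pos (k : nat) (e : rexpr) : bool :=
  if rfrac k e is Some (n, _) then mpos n else false.

Definition rexpr_nonneg (k : nat) (e : rexpr) : bool :=
  if rfrac k e is Some (n, _) then mnonneg n else false.

Section Soundness.

Variables (R : realFieldType) (env : seq R).
Hypothesis env_ge0 : all (fun x => 0 <= x) env.

Fixpoint meval (k : nat) : mpol k -> R :=
  if k is k'.+1 then
    fun p : seq (mpol k') => foldr (fun a s => meval a + env`_k' * s) 0 p
  else fun z => (int_of_Z z)%:~R.

Fixpoint reval (e : rexpr) : R :=
  match e with
  | RVar j => env`_j
  | RNat n => n%:R
  | RAdd e1 e2 => reval e1 + reval e2
  | RMul e1 e2 => reval e1 * reval e2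
  | ROpp e1 => - reval e1
  | RInv e1 => (reval e1)^-1
  end.

Lemma nth_env_ge0 j : 0 <= env`_j.
Proof.
have [lt|ge] := ltnP j (size env); last by rewrite nth_default.
exact: (allP env_ge0) (mem_nth _ lt).
Qed.

Lemma meval_const k z : meval (mconst k z) = (int_of_Z z)%:~R.
Proof. by elim: k => //= k ->; rewrite mulr0 addr0. Qed.

Lemma meval_var k j : (j < k)%N -> meval (mvar k j) = env`_j.
Proof.
elim: k => //= k IHk; rewrite ltnS leq_eqVlt.
case: eqP => [-> _|_ /= lt] /=; first by rewrite !meval_const; ring.
by rewrite IHk // mulr0 addr0.
Qed.

Lemma meval_add k (p q : mpol k) : meval (madd p q) = meval p + meval q.
Proof.
elim: k p q => [|k IHk] /=; first by move=> p q; rewrite -rmorphD -rmorphD.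
elim=> [|a p IHp] [|b q] /=; rewrite ?add0r ?addr0 //.
by rewrite IHk IHp; ring.
Qed.

Lemma meval_opp k (p : mpol k) : meval (mopp p) = - meval p.
Proof.
elim: k p => [|k IHk] /=; first by move=> p; rewrite -rmorphN -rmorphN.
by elim=> [|a p IHp] /=; rewrite ?oppr0 // IHk IHp; ring.
Qed.

Lemma meval_mul k (p q : mpol k) : meval (mmul p q) = meval p * meval q.
Proof.
elim: k p q => [|k IHk] /=; first by move=> p q; rewrite -rmorphM -rmorphM.
move=> p q; elim: p => [|a p IHp] /=; first by rewrite mul0r.
apply: etrans (@meval_add k.+1 _ _) _; rewrite /= IHp meval_const mulrDl.
have -> : foldr (fun b s => meval b + env`_k * s) 0 [seq mmul a i | i <- q]
        = meval a * foldr (fun b s => meval b + env`_k * s) 0 q.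
  by elim: q {IHp} => [|b q IHq] /=; rewrite ?mulr0 // IHk IHq; ring.
by rewrite rmorph0 /=; ring.
Qed.

Lemma mnonneg_ge0 k (p : mpol k) : mnonneg p -> 0 <= meval p.
Proof.
elim: k p => [|k IHk] /=; first by move=> p; rewrite ler0z; lia.
elim=> [|a p IHp] //= /andP[/IHk ha /IHp hp].
by rewrite addr_ge0 // mulr_ge0 // nth_env_ge0.
Qed.

Lemma mpos_gt0 k (p : mpol k) : mpos p -> 0 < meval p.
Proof.
elim: k p => [|k IHk] /=; first by move=> p; rewrite ltr0z; lia.
case=> [|a p] //= /andP[/IHk ha hp].
rewrite ltr_wpDr // mulr_ge0 ?nth_env_ge0 //; exact: (@mnonneg_ge0 k.+1 p hp).
Qed.

Lemma rfracP k e n d : rfrac k e = Some (n, d) ->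
  0 < meval d /\ reval e = meval n / meval d.
Proof.
have one_eval k' : meval (mconst k' (BinNums.Zpos BinNums.xH)) = 1 by rewrite meval_const.
elim: e n d => [j|j|e1 IH1 e2 IH2|e1 IH1 e2 IH2|e1 IH1|e1 IH1] n d /=.
- by case: ifP => // lt [<- <-]; rewrite one_eval meval_var // divr1 ltr01.
- move=> [<- <-]; rewrite one_eval meval_const divr1 ltr01; split=> //.
  by have -> : int_of_Z (BinInt.Z.of_nat j) = j%:Z by lia.
- case: rfrac IH1 => [[n1 d1]|] // /(_ _ _ erefl)[p1 ->].
  case: rfrac IH2 => [[n2 d2]|] // /(_ _ _ erefl)[p2 ->] [<- <-].
  rewrite meval_add !meval_mul mulr_gt0 //; split=> //.
  by field; rewrite !gt_eqF.
- case: rfrac IH1 => [[n1 d1]|] // /(_ _ _ erefl)[p1 ->].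
  case: rfrac IH2 => [[n2 d2]|] // /(_ _ _ erefl)[p2 ->] [<- <-].
  rewrite !meval_mul mulr_gt0 //; split=> //.
  by field; rewrite !gt_eqF.
- case: rfrac IH1 => [[n1 d1]|] // /(_ _ _ erefl)[p1 ->] [<- <-].
  by rewrite meval_opp mulNr.
- case: rfrac IH1 => [[n1 d1]|] // /(_ _ _ erefl)[p1 ->].
  case: ifP => // /mpos_gt0 p2 [<- <-]; split=> //.
  by rewrite invf_div.
Qed.

Lemma rexpr_pos_gt0 e : rexpr_pos (size env) e -> 0 < reval e.
Proof.
rewrite /rexpr_pos; case E: rfrac => [[n d]|] // /mpos_gt0 pn.
by have [pd ->] := rfracP E; rewrite divr_gt0.
Qed.

Lemma rexpr_nonneg_ge0 e : rexpr_nonneg (size env) e -> 0 <= reval e.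
Proof.
rewrite /rexpr_nonneg; case E: rfrac => [[n d]|] // /mnonneg_ge0 pn.
by have [pd ->] := rfracP E; rewrite divr_ge0 // ltW.
Qed.

End Soundness.

Ltac env_index x env :=
  lazymatch env with
  | x :: _ => constr:(0%N)
  | _ :: ?env' => let j := env_index x env' in constr:(S j)
  end.

Ltac reify_rexpr env t :=
  lazymatch t with
  | (?a + ?b)%R =>
      let x := reify_rexpr env a in let y := reify_rexpr env b in constr:(RAdd x y)
  | (?a * ?b)%R =>
      let x := reify_rexpr env a in let y := reify_rexpr env b in constr:(RMul x y)
  | (- ?a)%R => let x := reify_rexpr env a in constr:(ROpp x)
  | (?a^-1)%R => let x := reify_rexpr env a in constr:(RInv x)
  | (?n%:R)%R => constr:(RNat n)
  | 1%R => constr:(RNat 1)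
  | 0%R => constr:(RNat 0)
  | _ => let j := env_index t env in constr:(RVar j)
  end.

(* Proves [0 < t] or [0 <= t] for a rational function [t] of the nonnegative [env] whose
   numerator and denominators, as polynomials in [env], have nonnegative coefficients and
   (for the denominators, and for the numerator of [0 < t]) a positive constant term. *)
Ltac rational_sign env :=
  lazymatch goal with
  | |- is_true (0 < ?t)%R =>
      let e := reify_rexpr env t in
      apply: (@rexpr_pos_gt0 _ env _ e);
      [by rewrite /= ?andbT; repeat (apply/andP; split) | by vm_compute]
  | |- is_true (0 <= ?t)%R =>
      let e := reify_rexpr env t in
      apply: (@rexpr_nonneg_ge0 _ env _ e);
      [by rewrite /= ?andbT; repeat (apply/andP; split) | by vm_compute]
  end.

(** * Bounds for the normalized coefficients *)

(** The normalized coefficient of t^i in U_(m,d) with e = d - i, see [coef_uniform_kappa]. The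
    second term of [coef_uniform_KL] normalizes to i/(m+i); subtracting it turns the boundary term
    of [alt_convS] into the increment i/(m+i) - i/(m+i+1). The value 0 at m = 0 reflects that
    Boolean matroids have polynomial 1. *)
Fixpoint kappa (i e m : nat) : rat :=
  if m is m'.+1 then
    (m'%:R + 1) / (m'%:R + 1 + e%:R)
      * (kappa i e m' + i%:R / ((m'%:R + i%:R) * (m'%:R + i%:R + 1)))
  else 0.

(** For e > 2 and growing m, kappa is i/((e-1)m) to leading order. Both bounds share this;
    [kappa_ub] also matches the next order in 1/m, while [kappa_lb] is exact at m = 1. For i >= 2
    and e = i+1 they coincide. *)
Definition kappa_ub (i e m : rat) : rat :=
  i * m * (e - 2) / ((e - 1) * (m + i) * ((e - 2) * m + e * (i - 1))).
Definition kappa_lb (i e m : rat) : rat :=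
  i * m / ((m + i) * ((e - 1) * (m - 1) + (e + 1) * i)).
(** With e = d - i, [beta] is the normalized coefficient of B_d ([coef_relaxation]) and [rho] the
    quotient of consecutive normalizing factors ([weightS]). Passing from i to i+1 lowers e by 1. *)
Definition beta (i e : rat) : rat := 2 * i * e / ((i + 1) * (e + 1) * (e - 1)).
Definition rho (i e : rat) : rat :=
  e * (e - i - 1) * (e - i - 2) / ((e - 1) * (i + 1) * (i + 1)).
Definition step_lb (i e m l : rat) : rat :=
  rho i e * (kappa_lb (i + 1) (e - 1) m - l * beta (i + 1) (e - 1))
  - (kappa_ub i e m - l * beta i e).
Definition step_ub (i e m l : rat) : rat :=
  rho i e * (kappa_ub (i + 1) (e - 1) m - l * beta (i + 1) (e - 1))
  - (kappa_lb i e m - l * beta i e).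
Definition kappa_ub_defect (i e m : rat) : rat :=
  kappa_ub i e (m + 1) * (m + 1 + e) / (m + 1)
  - (kappa_ub i e m + i / ((m + i) * (m + i + 1))).
Definition kappa_lb_defect (i e m : rat) : rat :=
  (kappa_lb i e m + i / ((m + i) * (m + i + 1)))
  - kappa_lb i e (m + 1) * (m + 1 + e) / (m + 1).

Ltac step_sign env :=
  rewrite /step_lb /step_ub /kappa_ub_defect /kappa_lb_defect /rho /beta /kappa_ub /kappa_lb;
  rational_sign env.


Lemma kappa_ub_step (i e m k : rat) : 0 <= m -> 0 <= e -> 0 <= kappa_ub_defect i e m ->
  k <= kappa_ub i e m ->
  (m + 1) / (m + 1 + e) * (k + i / ((m + i) * (m + i + 1))) <= kappa_ub i e (m + 1).
Proof.
rewrite /kappa_ub_defect => m0 e0; set t := i / _; set u := kappa_ub i e m.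
set v := kappa_ub i e (m + 1) => hd hk.
have m1 : 0 < m + 1 by lra.
have me : 0 < m + 1 + e by lra.
rewrite mulrAC ler_pdivrMr // mulrC -ler_pdivlMr //.
by move: hd; set w := v * _ / _; lra.
Qed.

Lemma kappa_lb_step (i e m k : rat) : 0 <= m -> 0 <= e -> 0 <= kappa_lb_defect i e m ->
  kappa_lb i e m <= k ->
  kappa_lb i e (m + 1) <= (m + 1) / (m + 1 + e) * (k + i / ((m + i) * (m + i + 1))).
Proof.
rewrite /kappa_lb_defect => m0 e0; set t := i / _; set u := kappa_lb i e m.
set v := kappa_lb i e (m + 1) => hd hk.
have m1 : 0 < m + 1 by lra.
have me : 0 < m + 1 + e by lra.
rewrite mulrAC ler_pdivlMr // [X in _ <= X]mulrC -ler_pdivrMr //.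
by move: hd; set w := v * _ / _; lra.
Qed.

Ltac generalize_natr x X X0 := have := ler0n rat x; move: (x%:R : rat) => X X0.

Ltac nat_sign1 x :=
  rewrite ?natrD; let X := fresh "X" in let X0 := fresh "X0" in generalize_natr x X X0;
  step_sign [:: X].

Ltac nat_sign2 x y :=
  rewrite ?natrD;
  let X := fresh "X" in let X0 := fresh "X0" in generalize_natr x X X0;
  let Y := fresh "Y" in let Y0 := fresh "Y0" in generalize_natr y Y Y0;
  step_sign [:: X; Y].

Ltac nat_sign3 x y z :=
  rewrite ?natrD;
  let X := fresh "X" in let X0 := fresh "X0" in generalize_natr x X X0;
  let Y := fresh "Y" in let Y0 := fresh "Y0" in generalize_natr y Y Y0;
  let Z := fresh "Z" in let Z0 := fresh "Z0" in generalize_natr z Z Z0;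
  step_sign [:: X; Y; Z].

Lemma kappa_ub_defect_ge0 i e m : (1 < i < e)%N -> 0 <= kappa_ub_defect i%:R e%:R m%:R.
Proof.
move=> /andP[i1 ie]; have [x ex] : exists x, i = (x + 2)%N by exists (i - 2)%N; lia.
have [y ey] : exists y, e = (i + 1 + y)%N by exists (e - i - 1)%N; lia.
by subst; nat_sign3 x y m.
Qed.

Lemma kappa_le_ub i e m : (0 < i < e)%N -> (2 < e)%N -> (0 < m)%N ->
  kappa i e m <= kappa_ub i%:R e%:R m%:R.
Proof.
move=> /andP[i0 ie] e2; have [i1|i1] := leqP 2 i.
  elim: m => [|m IHm] // _; rewrite -natr1; apply: kappa_ub_step => //.
    by apply: kappa_ub_defect_ge0; rewrite i1.
  by case: m IHm => [_|m ->] //; rewrite /kappa_ub mulr0 !mul0r.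
(* For i = 1 the formula [kappa_ub] is 0/0 at m = 0, so the induction starts from m = 1. *)
have -> : i = 1%N by lia.
have [y ey] : exists y, e = (y + 3)%N by exists (e - 3)%N; lia.
elim: m => [|[|m] IHm] // _.
  by rewrite -subr_ge0 /=; subst; nat_sign1 y.
rewrite -[m.+2%:R]natr1; apply: kappa_ub_step; rewrite ?ler0n ?IHm //.
by rewrite -[m.+1%:R]natr1; subst; nat_sign2 y m.
Qed.

Lemma kappa_ge_lb i e m : (0 < i < e)%N -> (0 < m)%N ->
  kappa_lb i%:R e%:R m%:R <= kappa i e m.
Proof.
move=> /andP[i0 ie].
have [x ex] : exists x, i = (x + 1)%N by exists (i - 1)%N; lia.
have [y ey] : exists y, e = (i + 1 + y)%N by exists (e - i - 1)%N; lia.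
elim: m => [|[|m] IHm] // _.
  by rewrite -subr_ge0 /=; subst; nat_sign2 x y.
rewrite -[m.+2%:R]natr1; apply: kappa_lb_step; rewrite ?ler0n ?IHm //.
by rewrite -[m.+1%:R]natr1; subst; nat_sign3 x y m.
Qed.

(** * Signs of consecutive differences off the line d = 3i+2 *)

Definition kappa_diff (i e m : nat) (l : rat) : rat :=
  rho i%:R e%:R * (kappa i.+1 e.-1 m - l * beta (i%:R + 1) (e%:R - 1))
  - (kappa i e m - l * beta i%:R e%:R).

Lemma rho_ge0 i e : (i + 3 <= e)%N -> 0 <= rho i%:R e%:R.
Proof.
move=> ie; have [y ey] : exists y, e = (y + i + 3)%N by exists (e - i - 3)%N; lia.
by subst; nat_sign2 y i.
Qed.

Lemma pred_natr n : (0 < n)%N -> n.-1%:R = n%:R - 1 :> rat.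
Proof. by case: n => // n _; rewrite -natr1 addrK. Qed.

Lemma kappa_diff_ge i e m l : (0 < i)%N -> (i + 3 <= e)%N -> (0 < m)%N ->
  step_lb i%:R e%:R m%:R l <= kappa_diff i e m l.
Proof.
move=> i0 ie m0; rewrite /step_lb /kappa_diff lerD ?ler_wpM2l ?rho_ge0 ?lerN2 ?lerD2r //.
  by rewrite natr1 -pred_natr ?kappa_ge_lb //; lia.
by rewrite kappa_le_ub //; lia.
Qed.

Lemma kappa_diff_le i e m l : (0 < i)%N -> (i + 3 <= e)%N -> (0 < m)%N ->
  kappa_diff i e m l <= step_ub i%:R e%:R m%:R l.
Proof.
move=> i0 ie m0; rewrite /step_ub /kappa_diff lerD ?ler_wpM2l ?rho_ge0 ?lerN2 ?lerD2r //.
  by rewrite natr1 -pred_natr ?kappa_le_ub //; lia.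
by rewrite kappa_ge_lb //; lia.
Qed.

Lemma affine_pos (a b l l0 : rat) : 0 <= l -> l <= l0 -> 0 < a -> 0 < a - l0 * b -> 0 < a - l * b.
Proof.
move=> hl le a0 h; have [b0|b0] := lerP b 0.
  by have := mulr_ge0_le0 hl b0; lra.
by have := ler_wpM2r (ltW b0) le; lra.
Qed.

Lemma step_lb_affine i e m l : step_lb i e m l =
  step_lb i e m 0 - l * (rho i e * beta (i + 1) (e - 1) - beta i e).
Proof. by rewrite /step_lb; ring. Qed.

Lemma step_ub_affine i e m l : step_ub i e m l =
  step_ub i e m 0 - l * (rho i e * beta (i + 1) (e - 1) - beta i e).
Proof. by rewrite /step_ub; ring. Qed.

Lemma step_lb_pos i e m l l0 : 0 <= l -> l <= l0 -> 0 < step_lb i e m 0 ->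
  0 < step_lb i e m l0 -> 0 < step_lb i e m l.
Proof. by rewrite ![step_lb _ _ _ l]step_lb_affine [step_lb _ _ _ l0]step_lb_affine; apply: affine_pos. Qed.

Lemma step_ub_neg i e m l l0 : 0 <= l -> l <= l0 -> 0 < - step_ub i e m 0 ->
  0 < - step_ub i e m l0 -> 0 < - step_ub i e m l.
Proof.
rewrite (step_ub_affine i e m l) (step_ub_affine i e m l0).
set a := step_ub _ _ _ 0; set b := _ - beta _ _ => hl le a0.
have eN t : - (a - t * b) = - a - t * - b by ring.
by rewrite !eN; apply: affine_pos hl le a0.
Qed.

Lemma le_invn (l : rat) (n : nat) : l * (n%:R + 1) <= 1 -> l <= (n%:R + 1)^-1.
Proof. by move=> h; rewrite -div1r ler_pdivlMr // ltr_wpDl. Qed.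

(** In each case i, e and m are expressed by parameters starting at 0 so that the polynomials tested
    by [rational_sign] have coefficients of one sign. Large m uses l <= 1/(m+1), smaller m uses l <=
    1/(d+1). At (1, 5, 2) the enclosure is too wide at l = 1/7, and [kappa_diff_pos_full] evaluates
    kappa instead. *)
Lemma kappa_diff_pos i e m l : (0 < i)%N -> (i.*2 + 3 <= e)%N -> (1 < m)%N ->
  (i, e, m) <> (1, 5, 2)%N ->
  0 <= l -> l * (m%:R + 1) <= 1 -> l * ((e + i)%:R + 1) <= 1 -> 0 < kappa_diff i e m l.
Proof.
move=> i0 ie m1 ne l0 /le_invn lm /le_invn ld.
apply: lt_le_trans (kappa_diff_ge _ _ _ _) => //; try lia.
have pos0 : 0 < step_lb i%:R e%:R m%:R 0.
  have [x ex] : exists x, i = (x + 1)%N by exists (i - 1)%N; lia.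
  have [y ey] : exists y, e = (i + i + 3 + y)%N by exists (e - i.*2 - 3)%N; lia.
  have [z ez] : exists z, m = (z + 2)%N by exists (m - 2)%N; lia.
  by rewrite ez ey ex; nat_sign3 x y z.
have [h|h] := leqP (i + 4) m.
  apply: step_lb_pos lm _ _ => //.
  have [x ex] : exists x, i = (x + 1)%N by exists (i - 1)%N; lia.
  have [y ey] : exists y, e = (i + i + 3 + y)%N by exists (e - i.*2 - 3)%N; lia.
  have [z ez] : exists z, m = (i + 4 + z)%N by exists (m - i - 4)%N; lia.
  by rewrite ez ey ex; nat_sign3 x y z.
apply: step_lb_pos ld _ _ => //.
have [hi|hi] := leqP (i + 2) m.
  have [x ex] : exists x, i = (x + 1)%N by exists (i - 1)%N; lia.
  have [y ey] : exists y, e = (i + i + 3 + y)%N by exists (e - i.*2 - 3)%N; lia.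
  have [] : m = (i + 2)%N \/ m = (i + 3)%N by lia.
    by move=> ->; rewrite ey ex; nat_sign2 x y.
  by move=> ->; rewrite ey ex; nat_sign2 x y.
have [y ey] : exists y, e = (i + i + 3 + y)%N by exists (e - i.*2 - 3)%N; lia.
have [m3|m3] := leqP 3 m.
  have [x ex] : exists x, m = (x + 3)%N by exists (m - 3)%N; lia.
  have [z ez] : exists z, i = (x + 2 + z)%N by exists (i + 1 - m)%N; lia.
  by rewrite ey ez ex; nat_sign3 x y z.
have em : m = 2 by lia.
have [i2|i2] := leqP 2 i.
  have [x ex] : exists x, i = (x + 2)%N by exists (i - 2)%N; lia.
  by rewrite ey ex em; nat_sign2 x y.
have ei : i = 1%N by lia.
have [x ex] : exists x, e = (x + 6)%N.
  by exists (e - 6)%N; apply/esym/subnK; case: (eqVneq e 5) ne => [->|]; rewrite ?ei ?em //; lia.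
by rewrite ex ei em; nat_sign2 x y.
Qed.

Lemma kappa_diff_neg i e m l : (i + 3 <= e)%N -> (e <= i.*2.+1)%N -> (0 < m)%N ->
  0 <= l -> l * (m%:R + 1) <= 1 -> l * ((e + i)%:R + 1) <= 1 -> kappa_diff i e m l < 0.
Proof.
move=> ie ei m0 l0 /le_invn lm /le_invn ld.
apply: le_lt_trans (kappa_diff_le _ _ _ _) _ => //; try lia.
rewrite -oppr_gt0.
have [x ex] : exists x, e = (x + i + 3)%N by exists (e - i - 3)%N; lia.
have [y ey] : exists y, i = (x + y + 2)%N by exists (i - x - 2)%N; lia.
have neg0 : 0 < - step_ub i%:R e%:R m%:R 0.
  have [z ez] : exists z, m = (z + 1)%N by exists (m - 1)%N; lia.
  by rewrite ez ex ey; nat_sign3 x y z.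
have [h|h] := leqP (i + 2) m.
  apply: step_ub_neg lm _ _ => //.
  have [z ez] : exists z, m = (i + 2 + z)%N by exists (m - i - 2)%N; lia.
  by rewrite ez ex ey; nat_sign3 x y z.
apply: step_ub_neg ld _ _ => //.
have [hx|hx] := leqP m (x + 1).
  have [z ez] : exists z, m = (z + 1)%N by exists (m - 1)%N; lia.
  have [t et] : exists t, x = (z + t)%N by exists (x - z)%N; lia.
  by rewrite ez ex ey et; nat_sign3 z t y.
have [hy|hy] := leqP m (x + y + 1).
  have [z ez] : exists z, m = (x + z + 1)%N by exists (m - x - 1)%N; lia.
  have [t et] : exists t, y = (z + t)%N by exists (y - z)%N; lia.
  by rewrite ez ex ey et; nat_sign3 z t x.
have [] : m = i \/ m = (i + 1)%N by lia.
  by move=> ->; rewrite ex ey; nat_sign2 x y.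
by move=> ->; rewrite ex ey; nat_sign2 x y.
Qed.

Lemma kappa_diff_affine i e m l : kappa_diff i e m l =
  kappa_diff i e m 0 - l * (rho i%:R e%:R * beta (i%:R + 1) (e%:R - 1) - beta i%:R e%:R).
Proof. by rewrite /kappa_diff; ring. Qed.

Lemma kappa_diff_pos_affine i e m l l0 : 0 <= l -> l <= l0 -> 0 < kappa_diff i e m 0 ->
  0 < kappa_diff i e m l0 -> 0 < kappa_diff i e m l.
Proof.
rewrite (kappa_diff_affine i e m l) (kappa_diff_affine i e m l0); exact: affine_pos.
Qed.

(** * The critical line d = 3i+2 *)

Definition defect_ratio (i m : rat) : rat := 1 + 4 / (m + i - 1).

(** The induction step of [critical_defect]: D and D' are the errors of [kappa_ub] at (i, e) and
    (i+1, e-1), r and r' the amounts by which [kappa_ub] fails the recursion, s is [rho]. The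
    quotient (M+e)/(M+1+e) of the two damping factors lets the ratio fall from c to c1. *)
Lemma ratio_step (M e c c1 s r r' D D' : rat) : 0 <= M -> 0 < e -> 0 <= c -> 0 <= s ->
  0 <= r' -> 0 <= D' -> r <= c * s * r' -> D <= c * s * D' ->
  c * (M + e) / (M + 1 + e) <= c1 ->
  (M + 1) / (M + 1 + e) * (D + r) <= c1 * s * ((M + 1) / (M + e) * (D' + r')).
Proof.
move=> M0 e0 c0 s0 r0 D0 hr hD hc.
have Me : 0 < M + e by lra.
have Me1 : 0 < M + 1 + e by lra.
have M1 : 0 <= M + 1 by lra.
apply: (@le_trans _ _ ((M + 1) / (M + 1 + e) * (c * s * (D' + r')))).
  by rewrite ler_wpM2l ?divr_ge0 ?(ltW Me1) // [c * s * _]mulrDr lerD.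
have -> : (M + 1) / (M + 1 + e) * (c * s * (D' + r'))
    = (c * (M + e) / (M + 1 + e)) * (s * ((M + 1) / (M + e) * (D' + r'))).
  by field; rewrite !gt_eqF.
rewrite -[X in _ <= X]mulrA ler_wpM2r //.
by rewrite mulr_ge0 // mulr_ge0 ?divr_ge0 ?addr_ge0 // ltW.
Qed.

Lemma kappa_ub_defectE (i e m k : rat) : 0 <= m -> 0 < e ->
  kappa_ub i e (m + 1) - (m + 1) / (m + 1 + e) * (k + i / ((m + i) * (m + i + 1)))
    = (m + 1) / (m + 1 + e) * (kappa_ub i e m - k + kappa_ub_defect i e m).
Proof.
rewrite /kappa_ub_defect => m0 e0.
have m1 : m + 1 != 0 by rewrite gt_eqF //; lra.
have me : m + 1 + e != 0 by rewrite gt_eqF //; lra.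
move: (kappa_ub _ _ _) (kappa_ub _ _ _) (i / _) => u u' t.
by field; rewrite m1 me.
Qed.

(* The factor [defect_ratio] is fitted to the quotient of the defects of [kappa_ub] at
   [(i, e)] and [(i + 1, e - 1)], which is about [1 + 4 / (m + i)]. *)
Lemma critical_defect i m : (6 < i)%N ->
  kappa_ub i%:R (i.*2.+2)%:R m%:R - kappa i i.*2.+2 m
  <= defect_ratio i%:R m%:R * rho i%:R (i.*2.+2)%:R
     * (kappa_ub i.+1%:R (i.*2.+1)%:R m%:R - kappa i.+1 i.*2.+1 m).
Proof.
move=> i6; have [x ex] : exists x, i = (x + 7)%N by exists (i - 7)%N; lia.
have e1 : i.*2.+1 = (x + x + 15)%N by lia.
have e2 : i.*2.+2 = (x + x + 16)%N by lia.
have i1 : i.+1 = (x + 8)%N by lia.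
elim: m => [|m IHm].
  by rewrite /= /kappa_ub !mulr0 !mul0r !subr0 mulr0.
rewrite -[m.+1%:R]natr1 [kappa i _ _]/= [kappa i.+1 _ _]/= !kappa_ub_defectE //.
have -> : m%:R + 1 + (i.*2.+1)%:R = m%:R + (i.*2.+2)%:R :> rat.
  by rewrite -[(i.*2.+2)%:R]natr1; ring.
apply: ratio_step IHm _; first exact: ler0n.
- by rewrite ltr0n.
- rewrite /defect_ratio ex; nat_sign2 x m.
- by apply: rho_ge0; lia.
- by apply: kappa_ub_defect_ge0; lia.
- rewrite subr_ge0; case: (posnP m) => [->|mp]; last by apply: kappa_le_ub; lia.
  by rewrite /kappa_ub mulr0 !mul0r.
- rewrite -subr_ge0 e2 e1 i1 ex /defect_ratio; nat_sign2 x m.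
- rewrite -subr_ge0 e2 ex /defect_ratio; nat_sign2 x m.
Qed.

Lemma critical_diff_neg0 i m : (1 < i)%N -> (0 < m <= i + 2)%N ->
  kappa_diff i i.*2.+2 m 0 < 0.
Proof.
move=> i1 /andP[m0 mi]; have ee : i.*2.+2 = (i + i + 2)%N by lia.
have [mi1|mi1] := leqP m i.+1.
  apply: le_lt_trans (kappa_diff_le _ _ _ _) _ => //; try lia.
  rewrite -oppr_gt0 ee; have [mi2|mi2] := leqP m i.
    have [x ex] : exists x, m = (x + 1)%N by exists (m - 1)%N; lia.
    have [y ey] : exists y, i = (x + y + 1)%N by exists (i - x - 1)%N; lia.
    by rewrite ey ex; nat_sign2 x y.
  have -> : m = (i + 1)%N by lia.
  have [x ex] : exists x, i = (x + 2)%N by exists (i - 2)%N; lia.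
  by rewrite ex; nat_sign1 x.
have em : m = (i + 2)%N by lia.
have [i6|i6] := leqP 7 i.
  have := critical_defect m i6; rewrite -[i.+1%:R]natr1 [(i.*2.+1)%:R](@pred_natr i.*2.+2) //.
  rewrite /kappa_diff !mul0r !subr0 /=.
  have rho0 : 0 <= rho i%:R (i.*2.+2)%:R by apply: rho_ge0; lia.
  have lb : kappa_lb (i%:R + 1) ((i.*2.+2)%:R - 1) m%:R <= kappa i.+1 i.*2.+1 m.
    rewrite natr1 -pred_natr //; apply: kappa_ge_lb; lia.
  have c0 : 0 <= defect_ratio i%:R m%:R - 1.
    rewrite /defect_ratio addrC addKr divr_ge0 // subr_ge0 -natrD ler1n; lia.
  (* With u, u' the upper bounds for k, k' and c the defect ratio, rho k' - k = rho u' - u + (u - k)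
     - rho (u' - k'), which [critical_defect] bounds by rho u' - u + (c-1) rho (u' - k'). The small
     factor c - 1 = 4/(m+i-1) makes the lower bound for k' precise enough. *)
  have fin : 0 < - (rho i%:R (i.*2.+2)%:R * kappa_ub (i%:R + 1) ((i.*2.+2)%:R - 1) m%:R
     - kappa_ub i%:R (i.*2.+2)%:R m%:R
     + (defect_ratio i%:R m%:R - 1) * rho i%:R (i.*2.+2)%:R
       * (kappa_ub (i%:R + 1) ((i.*2.+2)%:R - 1) m%:R - kappa_lb (i%:R + 1) ((i.*2.+2)%:R - 1) m%:R)).
    have [x ex] : exists x, i = (x + 7)%N by exists (i - 7)%N; lia.
    by rewrite em ee ex /defect_ratio; nat_sign1 x.
  have := ler_wpM2l (mulr_ge0 c0 rho0) lb.
  move: (rho _ _) (defect_ratio _ _) (kappa_ub _ _ _) (kappa_ub _ _ _) (kappa _ _ _) (kappa _ _ _)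
    (kappa_lb _ _ _) fin => r c u u' k k' lb' h1 h2 h3.
  lra.
rewrite -oppr_gt0 /kappa_diff em.
have [->|[->|[->|[->|->]]]] : i = 2 \/ i = 3 \/ i = 4 \/ i = 5 \/ i = 6 by lia.
all: by rewrite /= /rho /beta; rational_sign ([::] : seq rat).
Qed.

Lemma critical_beta i : (0 < i)%N ->
  0 < rho i%:R (i.*2.+2)%:R * beta (i%:R + 1) ((i.*2.+2)%:R - 1) - beta i%:R (i.*2.+2)%:R.
Proof.
move=> i0; have ee : i.*2.+2 = (i + i + 2)%N by lia.
have [x ex] : exists x, i = (x + 1)%N by exists (i - 1)%N; lia.
by rewrite ee ex; nat_sign1 x.
Qed.

(** By [critical_beta] the difference decreases in l, so l = 0 is the worst case. *)
Lemma critical_diff_neg i m l : (1 < i)%N -> (0 < m <= i + 2)%N -> 0 <= l ->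
  kappa_diff i i.*2.+2 m l < 0.
Proof.
move=> i1 hm l0; rewrite kappa_diff_affine subr_lt0.
apply: (lt_le_trans (critical_diff_neg0 i1 hm)).
by rewrite mulr_ge0 // ltW // critical_beta // ltnW.
Qed.

(** Here the largest l is the worst case. [bound_case] works with the enclosure and [exact_case]
    with kappa itself. At the two excluded pairs the difference changes sign within the range of l
    allowed by the bounds. *)
Lemma critical_diff_pos i m l : (1 < i)%N -> (i + 3 <= m)%N ->
  (i, m) <> (2, 5)%N -> (i, m) <> (3, 6)%N ->
  0 <= l -> l * (m%:R + 1) <= 1 -> l * ((i.*2.+2 + i)%:R + 1) <= 1 ->
  0 < kappa_diff i i.*2.+2 m l.
Proof.
move=> i1 im ne1 ne2 l0 /le_invn lm /le_invn ld; have ee : i.*2.+2 = (i + i + 2)%N by lia.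
have exact_case : 0 < kappa_diff i i.*2.+2 m 0 ->
    0 < kappa_diff i i.*2.+2 m ((i.*2.+2 + i)%:R + 1)^-1 -> 0 < kappa_diff i i.*2.+2 m l.
  exact: kappa_diff_pos_affine.
have bound_case l' : l <= l' -> 0 < step_lb i%:R (i.*2.+2)%:R m%:R l' ->
    0 < kappa_diff i i.*2.+2 m l.
  move=> le h; apply: lt_le_trans (kappa_diff_ge _ _ _ _); try (move: i1 im; clear; lia).
  apply: step_lb_pos le _ h => //.
  have [x ex] : exists x, i = (x + 2)%N by exists (i - 2)%N; lia.
  have [y ey] : exists y, m = (i + 3 + y)%N by exists (m - i - 3)%N; lia.
  by rewrite ey ee ex; nat_sign2 x y.
have [i4|i4] := leqP 4 i.
  have [m4|m4] := leqP (i + 4) m.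
    apply: bound_case lm _.
    have [x ex] : exists x, i = (x + 4)%N by exists (i - 4)%N; lia.
    have [y ey] : exists y, m = (i + 4 + y)%N by exists (m - i - 4)%N; lia.
    by rewrite ey ee ex; nat_sign2 x y.
  have em : m = (i + 3)%N by lia.
  have [i9|i9] := leqP 9 i.
    apply: bound_case ld _.
    have [x ex] : exists x, i = (x + 9)%N by exists (i - 9)%N; lia.
    by rewrite em ee ex; nat_sign1 x.
  have hi : i = 4 \/ i = 5 \/ i = 6 \/ i = 7 \/ i = 8 by lia.
  apply: exact_case; rewrite /kappa_diff em; case: hi => [->|[->|[->|[->|->]]]];
    by rewrite /= /rho /beta; rational_sign ([::] : seq rat).
have [ei|ei] : i = 2 \/ i = 3 by lia.
  subst i; have [m7|m7] := leqP 7 m.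
    apply: bound_case lm _.
    have [y ey] : exists y, m = (7 + y)%N by exists (m - 7)%N; lia.
    by rewrite ey; nat_sign1 y.
  have em : m = 6 by move: ne1 im m7; clear; case: (eqVneq m 5) => [->|] //; lia.
  by apply: exact_case; rewrite em /kappa_diff /= /rho /beta; rational_sign ([::] : seq rat).
subst i; have [m8|m8] := leqP 8 m.
  apply: bound_case lm _.
  have [y ey] : exists y, m = (8 + y)%N by exists (m - 8)%N; lia.
  by rewrite ey; nat_sign1 y.
have em : m = 7 by move: ne2 im m8; clear; case: (eqVneq m 6) => [->|] //; lia.
by apply: bound_case ld _; rewrite em; step_sign ([::] : seq rat).
Qed.

Lemma kappa_diff_pos_full i e m l : (0 < i)%N -> (i.*2 + 3 <= e)%N -> (1 < m)%N ->
  0 <= l -> l * (m%:R + 1) <= 1 -> l * ((e + i)%:R + 1) <= 1 -> 0 < kappa_diff i e m l.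
Proof.
move=> i0 ie m1 l0 lm ld; have [[ei ee em]|ne] := eqVneq (i, e, m) (1, 5, 2)%N.
  apply: kappa_diff_pos_affine (le_invn ld) _ _ => //;
    by rewrite ei ee em /kappa_diff /= /rho /beta; rational_sign ([::] : seq rat).
by apply: kappa_diff_pos => //; apply/eqP.
Qed.

(** * Unimodality *)

Lemma alt_conv_kappa m i e : (0 < i < e)%N ->
  (alt_conv m i e)%:~R
    = 'C(m + e, m)%:R * 'C(e.-1, i)%:R * (kappa i e m + i%:R / (m%:R + i%:R)) :> rat.
Proof.
move=> /andP[i0 ie]; elim: m => [|m IHm].
  rewrite alt_conv0 // bin0 mul1r /= !add0r divff ?mulr1 ?pnatr_eq0 ?rmorph_nat //; lia.
rewrite alt_convS // rmorphD /= IHm rmorph_nat.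
have b1 : (m%:R + 1) * 'C(m.+1 + e, m.+1)%:R = (m%:R + 1 + e%:R) * 'C(m + e, m)%:R :> rat.
  by rewrite natr1 -!natrD -!natrM addSn -mul_bin_diag.
have b2 : ('C(m + e, m + i.+1) * 'C(m + i, m.+1))%:R * ((m%:R + i%:R + 1) * (m%:R + 1))
    = i%:R * e%:R * ('C(m + e, m)%:R * 'C(e.-1, i)%:R) :> rat.
  rewrite -natrD !natr1 -!natrM; congr (_%:R).
  have h1 := @bin_mul_sub (m + e) (m + i.+1) m.
  have {}h1 := h1 ltac:(lia).
  have h2 : (m.+1 * 'C(m + i, m.+1) = i * 'C(m + i, m))%N by rewrite mul_bin_left addKn.
  have h3 : ((m + i).+1 * 'C(m + i, m) = i.+1 * 'C(m + i.+1, m))%N.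
    by rewrite addnS (mul_bin_down (m + i).+1); congr (_ * _)%N; lia.
  have h4 : (e * 'C(e.-1, i) = i.+1 * 'C(e, i.+1))%N.
    by rewrite -[e in (e * _)%N]prednK ?mul_bin_diag ?prednK //; lia.
  rewrite !addKn in h1.
  transitivity (i.+1 * ('C(m + e, m + i.+1) * 'C(m + i.+1, m)) * i)%N.
    rewrite -[RHS]mulnA -[in RHS]mulnA [in RHS]mulnCA.
    have -> : ('C(m + e, m + i.+1) * 'C(m + i, m.+1) * ((m + i).+1 * m.+1)
      = 'C(m + e, m + i.+1) * (m + i).+1 * (m.+1 * 'C(m + i, m.+1)))%N by ring.
    rewrite h2.
    have -> : ('C(m + e, m + i.+1) * (m + i).+1 * (i * 'C(m + i, m))
      = 'C(m + e, m + i.+1) * ((m + i).+1 * 'C(m + i, m)) * i)%N by ring.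
    by rewrite h3; ring.
  by rewrite h1; transitivity (i * 'C(m + e, m) * (i.+1 * 'C(e, i.+1)))%N;
    [ring | rewrite -h4; ring].
have m1 : (m%:R + 1 : rat) != 0 by rewrite natr1 pnatr_eq0.
have me : (m%:R + 1 + e%:R : rat) != 0 by rewrite natr1 -natrD pnatr_eq0.
have mi : (m%:R + i%:R : rat) != 0 by rewrite -natrD pnatr_eq0; lia.
have mi1 : (m%:R + i%:R + 1 : rat) != 0 by rewrite -natrD natr1 pnatr_eq0.
rewrite -[m.+1%:R]natr1.
move/(canRL (mulKf m1)): b1 => ->.
have /(canRL (mulfK (mulf_neq0 mi1 m1))) -> := b2.
move: (kappa i e m) ('C(m + e, m)%:R : rat) ('C(e.-1, i)%:R : rat) => k b c.
by field; rewrite addrAC m1 me mi mi1.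
Qed.

Definition weight (d i : nat) : rat := ('C(d, i) * 'C((d - i).-1, i))%:R.

Lemma weight_gt0 d i : (i.*2 < d)%N -> 0 < weight d i.
Proof. by move=> h; rewrite /weight ltr0n muln_gt0 !bin_gt0; lia. Qed.

Lemma weightS d i : (i.+1.*2 < d)%N -> weight d i.+1 = rho i%:R (d - i)%:R * weight d i.
Proof.
move=> h; rewrite /weight !natrM.
have [e ee] : exists e, (d - i = e.+3)%N by exists (d - i - 3)%N; lia.
have b1 : (i%:R + 1) * 'C(d, i.+1)%:R = e.+3%:R * 'C(d, i)%:R :> rat.
  by rewrite natr1 -!natrM mul_bin_left ee.
have b2 : (i%:R + 1) * e.+2%:R * 'C(e.+1, i.+1)%:R
    = (e.+3%:R - i%:R - 1) * (e.+3%:R - i%:R - 2) * 'C(e.+2, i)%:R :> rat.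
  have -> : (i%:R + 1) * e.+2%:R * 'C(e.+1, i.+1)%:R = e.+2%:R * ((i.+1 * 'C(e.+1, i.+1))%:R) :> rat.
    by rewrite natrM -natr1; ring.
  rewrite mul_bin_left natrM natrB; last by lia.
  transitivity ((e.+1%:R - i%:R) * (e.+2 * 'C(e.+1, i))%:R : rat); first by rewrite natrM; ring.
  rewrite (mul_bin_down e.+2) natrM natrB; last by lia.
  by rewrite -[e.+3%:R]natr1 -[e.+2%:R]natr1 -[e.+1%:R]natr1; ring.
have i1 : (i%:R + 1 : rat) != 0 by rewrite natr1 pnatr_eq0.
have e2 : (e.+2%:R : rat) != 0 by rewrite pnatr_eq0.
have -> : (d - i.+1).-1 = e.+1 by lia.
rewrite ee /=.
move/(canRL (mulKf i1)): b1 => ->; move/(canRL (mulKf (mulf_neq0 i1 e2))): b2 => ->.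
rewrite /rho -[e.+3%:R]natr1.
have e31 : e.+2%:R + 1 - 1 = e.+2%:R :> rat by ring.
move: (e.+2%:R : rat) ('C(d, i)%:R : rat) e2 e31 => E c E0 _.
by field; rewrite i1 (_ : E + 1 - 1 = E) ?E0 //; ring.
Qed.

Lemma coef_uniform_kappa m d i : (0 < i)%N -> (i.*2 < d)%N ->
  ((uniform_KL m d)`_i)%:~R = 'C(m + d, m)%:R * weight d i * kappa i (d - i) m :> rat.
Proof.
move=> i0 h; rewrite coef_uniform_KL // rmorphB rmorphM /= alt_conv_kappa; last by lia.
have b1 : ('C(m + d, i) * 'C(m + (d - i), m) = 'C(m + d, m) * 'C(d, i))%N.
  have -> : (m + (d - i) = m + d - i)%N by lia.
  by rewrite bin_mul_bin ?addKn //; lia.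
have b2 : ('C(m + d, m + i) * 'C((m + i).-1, m) * (m + i) = 'C(m + d, m) * 'C(d, i) * i)%N.
  have b3 : ('C(m + d, m + i) * 'C(m + i, m) = 'C(m + d, m) * 'C(d, i))%N.
    by rewrite bin_mul_sub ?addKn //; lia.
  rewrite -b3 -mulnA; have -> : ('C((m + i).-1, m) * (m + i) = 'C(m + i, m) * i)%N.
    by rewrite mulnC mul_bin_down addKn mulnC.
  by rewrite mulnA.
have mi : (m%:R + i%:R : rat) != 0 by rewrite -natrD pnatr_eq0; lia.
have b2' : ('C(m + d, m + i) * 'C((m + i).-1, m))%:R * (m%:R + i%:R)
   = 'C(m + d, m)%:R * 'C(d, i)%:R * i%:R :> rat by rewrite -natrD -!natrM b2.
rewrite i0 mul1n !rmorph_nat [in X in _ - X]natrM.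
move/(canRL (mulfK mi)): b2' => ->.
rewrite /weight natrM; transitivity (('C(m + d, i) * 'C(m + (d - i), m))%:R * 'C((d - i).-1, i)%:R
   * (kappa i (d - i) m + i%:R / (m%:R + i%:R))
   - 'C(m + d, m)%:R * 'C(d, i)%:R * i%:R / (m%:R + i%:R) * 'C((d - i).-1, i)%:R : rat).
  by rewrite natrM; ring.
by rewrite b1 natrM; ring.
Qed.

Lemma coef_relaxation d i : (0 < i)%N -> (i.*2 < d)%N ->
  ((relaxation_KL d)`_i)%:~R = weight d i * beta i%:R (d - i)%:R :> rat.
Proof.
move=> i0 h; rewrite /relaxation_KL coefB rmorphB /= coef_uniform_kappa //.
have [e ee] : exists e, (d - i = e.+2)%N by exists (d - i - 2)%N; lia.
have ed : d = (e.+2 + i)%N by lia.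
have c2 : ((uniform_KL 1 d.-1)`_i)%:~R = d%:R * weight d.-1 i * kappa i e.+1 1 :> rat.
  have [h1|h1] := ltnP i.*2 d.-1.
    rewrite coef_uniform_kappa // bin1 add1n prednK; last by lia.
    by congr (_ * kappa _ _ _); lia.
  (* Here d = 2i+1: the coefficient lies beyond the degree of U_(1,d-1), and the factor C(d-i-2, i)
     vanishes as well. *)
  rewrite nth_default; last by apply: leq_trans (size_uniform_KL _ _) _; lia.
  by rewrite /weight [X in (_ * X)%N]bin_small ?muln0 ?mulr0 ?mul0r //; lia.
rewrite c2 bin1 /weight ee.
have -> : (d.-1 - i).-1 = e by lia.
have b1 : d%:R * 'C(d.-1, i)%:R = e.+2%:R * 'C(d, i)%:R :> rat.
  by rewrite -!natrM mul_bin_down ee.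
have b2 : e.+1%:R * 'C(e, i)%:R = (e.+1%:R - i%:R) * 'C(e.+1, i)%:R :> rat.
  rewrite -natrB; last by lia.
  by rewrite -!natrM (mul_bin_down e.+1).
rewrite !natrM /= -!natr1 add0r.
have e1 : (e.+1%:R : rat) != 0 by rewrite pnatr_eq0.
have -> : d%:R * ('C(d.-1, i)%:R * 'C(e, i)%:R)
   = (d%:R * 'C(d.-1, i)%:R) * (e.+1%:R * 'C(e, i)%:R) / e.+1%:R :> rat.
  by move: (e.+1%:R : rat) e1 => t t0; field; rewrite t0.
rewrite b1 b2 /beta (_ : d%:R = e%:R + 2 + i%:R :> rat);
  last by rewrite ed -[2]/(2%:R) -!natrD; congr _%:R; lia.
have := ler0n rat e; have : 0 < i%:R :> rat by rewrite ltr0n.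
rewrite -[e.+2%:R]natr1 -[e.+1%:R]natr1.
move: (e%:R : rat) (i%:R : rat) => E I I0 E0.
by field; rewrite ?gt_eqF //; lra.
Qed.

(** * Coefficients of U_(m,d) - lambda B_d *)

Definition sparse_KL (m d lambda : nat) : {poly int} :=
  uniform_KL m d - relaxation_KL d *+ lambda.

Lemma size_sparse_KL m d lambda : (size (sparse_KL m d lambda) <= uphalf d)%N.
Proof.
apply: (leq_trans (size_polyD _ _)); rewrite size_polyN geq_max size_uniform_KL.
by rewrite -mulr_natl (leq_trans (size_natpolyM _ _)) ?size_relaxation_KL.
Qed.

Lemma sparse_KL_coef0 m d lambda : (1 < d)%N -> (sparse_KL m d lambda)`_0 = 1.
Proof.
move=> d1; rewrite coefB coefMn uniform_KL_coef0 ?(ltnW d1) // /relaxation_KL coefB.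
by rewrite !uniform_KL_coef0 ?subrr ?mul0rn ?subr0 //; lia.
Qed.

Lemma sparse_KL_coef m d lambda i : (0 < i)%N -> (i.*2 < d)%N ->
  ((sparse_KL m d lambda)`_i)%:~R = 'C(m + d, m)%:R * weight d i
    * (kappa i (d - i) m - lambda%:R / 'C(m + d, m)%:R * beta i%:R (d - i)%:R) :> rat.
Proof.
move=> i0 h; rewrite coefB coefMn rmorphB rmorphMn /= coef_uniform_kappa // coef_relaxation //.
have : 'C(m + d, m)%:R != 0 :> rat by rewrite pnatr_eq0 -lt0n bin_gt0 leq_addr.
rewrite -[_ *+ lambda]mulr_natr.
move: ('C(m + d, m)%:R : rat) (lambda%:R : rat) (weight d i) (kappa _ _ _) (beta _ _) => c l w k b c0.
by field.
Qed.

Lemma sparse_KL_diff m d lambda i : (0 < i)%N -> (i.+1.*2 < d)%N ->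
  ((sparse_KL m d lambda)`_i.+1 - (sparse_KL m d lambda)`_i)%:~R
    = 'C(m + d, m)%:R * weight d i
      * kappa_diff i (d - i) m (lambda%:R / 'C(m + d, m)%:R) :> rat.
Proof.
move=> i0 h; rewrite rmorphB /= !sparse_KL_coef //; try lia.
rewrite weightS // /kappa_diff.
have -> : (d - i.+1)%N = (d - i).-1 by lia.
rewrite -natr1 (pred_natr (n := d - i)); last by lia.
by move: (kappa _ _ _) (kappa _ _ _) (beta _ _) (beta _ _) (_ / _) (rho _ _) => *; ring.
Qed.

Lemma sparse_KL_diff_scale_gt0 m d i : (i.*2 < d)%N -> 0 < 'C(m + d, m)%:R * weight d i.
Proof. by move=> h; rewrite mulr_gt0 ?weight_gt0 // ltr0n bin_gt0 leq_addr. Qed.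

Lemma sparse_KL_increase m d lambda i : (0 < i)%N -> (i.+1.*2 < d)%N ->
  0 < kappa_diff i (d - i) m (lambda%:R / 'C(m + d, m)%:R) ->
  (sparse_KL m d lambda)`_i < (sparse_KL m d lambda)`_i.+1.
Proof.
move=> i0 h k; rewrite -subr_gt0 -(ltr0z rat) sparse_KL_diff // mulr_gt0 //.
by apply: sparse_KL_diff_scale_gt0; lia.
Qed.

Lemma sparse_KL_decrease m d lambda i : (0 < i)%N -> (i.+1.*2 < d)%N ->
  kappa_diff i (d - i) m (lambda%:R / 'C(m + d, m)%:R) < 0 ->
  (sparse_KL m d lambda)`_i.+1 < (sparse_KL m d lambda)`_i.
Proof.
move=> i0 h k; rewrite -subr_lt0 -(ltrz0 rat) sparse_KL_diff // pmulr_rlt0 //.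
by apply: sparse_KL_diff_scale_gt0; lia.
Qed.

(** For i = 1 the recursion has a closed solution; [kappa_ub] misses only its last term. *)
Lemma kappa1E e m : (1 < e)%N ->
  kappa 1 e m = (e%:R - 1)^-1 * ((m%:R + 1)^-1 - ('C(m + e, m)%:R)^-1).
Proof.
move=> e1; elim: m => [|m IHm]; first by rewrite /= bin0 add0r invr1 subrr mulr0.
rewrite [kappa _ _ _]/= IHm.
have b1 : (m%:R + 1) * 'C(m.+1 + e, m.+1)%:R = (m%:R + 1 + e%:R) * 'C(m + e, m)%:R :> rat.
  by rewrite natr1 -!natrD -!natrM addSn -mul_bin_diag.
have m1 : (m%:R + 1 : rat) != 0 by rewrite natr1 pnatr_eq0.
have E1 : 1 < e%:R :> rat by rewrite ltr1n.
have M0 := ler0n rat m.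
have c0 : 'C(m + e, m)%:R != 0 :> rat by rewrite pnatr_eq0 -lt0n bin_gt0 leq_addr.
move/(canRL (mulKf m1)): b1 => ->; rewrite -[m.+1%:R]natr1.
move: ('C(m + e, m)%:R : rat) c0 (e%:R : rat) (m%:R : rat) E1 M0 {m1 IHm} => c c0 E M E1 M0.
by field; rewrite c0 ?gt_eqF //; lra.
Qed.

(** This is the number of hyperplanes minus the number of atoms: each circuit-hyperplane replaces d
    hyperplanes of size d-1 by a single one. *)
Lemma sparse_KL_coef1 m d lambda : (2 < d)%N ->
  (sparse_KL m d lambda)`_1 = 'C(m + d, m.+1)%:R - (m + d)%:R - lambda%:R * (d.-1)%:R.
Proof.
move=> d2; apply: (@intr_inj rat).
rewrite sparse_KL_coef // kappa1E; last by lia.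
rewrite !rmorphB rmorphM /= !rmorph_nat /weight bin1 subn1 bin1.
have b1 : m.+1%:R * 'C(m + d, m.+1)%:R = d%:R * 'C(m + d, m)%:R :> rat.
  by rewrite -!natrM mul_bin_left addKn.
have b2 : (m + d)%:R * 'C(m + d.-1, m)%:R = d%:R * 'C(m + d, m)%:R :> rat.
  have -> : (m + d.-1 = (m + d).-1)%N by lia.
  by rewrite -!natrM mul_bin_down addKn.
have d3 : 2 < d%:R :> rat by rewrite ltr_nat.
have p1 : d.-1%:R = d%:R - 1 :> rat by rewrite pred_natr //; lia.
have p2 : d.-1.-1%:R = d%:R - 2 :> rat by rewrite pred_natr ?p1; [ring | lia].
have m1 : (m.+1%:R : rat) != 0 by rewrite pnatr_eq0.
have c0 : 'C(m + d, m)%:R != 0 :> rat by rewrite pnatr_eq0 -lt0n bin_gt0 leq_addr.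
have c1 : 'C(m + d.-1, m)%:R != 0 :> rat by rewrite pnatr_eq0 -lt0n bin_gt0 leq_addr.
rewrite natrM /beta p1 p2 natr1; move/(canRL (mulKf m1)): b1 => ->.
move/(canRL (mulfK c1)): b2 => ->.
move: ('C(m + d, m)%:R : rat) c0 ('C(m + d.-1, m)%:R : rat) c1 (d%:R : rat) d3 (m.+1%:R : rat) m1
  (lambda%:R : rat) => c c0 c' c1 D D2 M M0 l.
by field; rewrite c0 c1 M0 ?gt_eqF //; lra.
Qed.

Lemma leq_bin_self n k : (0 < k < n)%N -> (n <= 'C(n, k))%N.
Proof.
elim: n k => [|n IHn] [|k] //= /[!ltnS] lt; rewrite binS.
have [->|k0] := posnP k; first by rewrite bin1 bin0 addn1.
have := bin_gt0 n k; rewrite (ltnW lt) => k1.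
move: lt; rewrite leq_eqVlt => /orP[/eqP e|lt]; last by have := IHn k.+1; rewrite /= lt => /(_ isT); lia.
have := IHn k; rewrite k0 -e ltnSn => /(_ isT).
by rewrite binn; lia.
Qed.

(** Since lambda d <= C(m+d,m+1), subtracting lambda (d-1) leaves at least a d-th part of that
    binomial, which has to exceed m+d+1. For m = 1 and m = 2 this already fails at d = 5, and
    [sparse_KL_first_step] treats them apart. *)
Lemma bin_lower_bound m d : (2 < m)%N -> (4 < d)%N -> (d * (m + d + 1) < 'C(m + d, m.+1))%N.
Proof.
move=> + d4; elim: m => [|m IHm] //; rewrite ltnS leq_eqVlt => /orP[/eqP <-|m2].
  rewrite -(ltn_pmul2r (m := 4`!)) // bin_ffact.
  have -> : (3 + d) ^_ 4 = ((d + 3) * ((d + 2) * ((d + 1) * d)))%N.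
    by rewrite !ffactnS ffactn0 /= muln1 !addSn !add0n !addnS addn0.
  rewrite (_ : 4`! = 24%N) //; nia.
have {}IHm := IHm m2.
have := @leq_bin_self (m + d) m.+2; rewrite addSn binS; lia.
Qed.

Lemma sparse_KL_first_step m d lambda : (0 < m)%N -> (4 < d)%N ->
  (lambda * m.+1 <= 'C(m + d, m))%N -> (lambda * d.+1 <= 'C(m + d, m))%N ->
  (sparse_KL m d lambda)`_0 < (sparse_KL m d lambda)`_1.
Proof.
move=> m0 d4 h1 h2; rewrite sparse_KL_coef0 ?sparse_KL_coef1; try lia.
have b1 : (m.+1 * 'C(m + d, m.+1) = d * 'C(m + d, m))%N by rewrite mul_bin_left addKn.
suff : (lambda * d.-1 + (m + d) + 1 < 'C(m + d, m.+1))%N by lia.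
have [m3|m3] := leqP 3 m.
  have := bin_lower_bound m3 d4; have : (lambda * d <= 'C(m + d, m.+1))%N.
    by rewrite -(leq_pmul2l (m := m.+1)) // b1; nia.
  by move: d4; case: (d) => // d' _ /=; nia.
have [em|em] : m = 1%N \/ m = 2%N by lia.
  subst m; have : (2 * 'C(1 + d, 2) = d * (1 + d))%N by rewrite mul_bin_left bin1; lia.
  have : (lambda <= 1)%N by move: h2; rewrite bin1 add1n; nia.
  by case: lambda {h1 h2 b1} => [|[|]] // _; nia.
subst m; have e2 : (2 * 'C(2 + d, 2) = (d + 1) * (2 + d))%N by rewrite mul_bin_left bin1; lia.
have l2 : (2 * lambda <= 2 + d)%N.
  rewrite -(leq_pmul2r (m := d.+1)) // -mulnA.
  by apply: (@leq_trans (2 * 'C(2 + d, 2))); rewrite ?leq_mul2l ?h2 // e2 addn1 mulnC.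
have e3 : (6 * 'C(2 + d, 3) = d * (d + 1) * (2 + d))%N.
  by rewrite -[6%N]/(2 * 3)%N -mulnA b1 mulnCA e2 mulnA.
have : (2 * (lambda * d.-1) <= (2 + d) * d.-1)%N by rewrite mulnA leq_mul2r l2 orbT.
have : (d * (d + 1) * (2 + d) > 3 * ((2 + d) * d.-1) + 6 * (d + 3))%N.
  have [x ->] : exists x, d = (x + 5)%N by exists (d - 5)%N; lia.
  have -> : (x + 5).-1 = (x + 4)%N by lia.
  by have : (0 <= x * x * x)%N; have : (0 <= x * x)%N; nia.
by move: (lambda * d.-1)%N ((2 + d) * d.-1)%N e3; lia.
Qed.

(** At d = 3i+2 it is enough that the two coefficients differ: the mode is i or i+1 according to the
    direction of the step. *)
Lemma strictly_unimodal_modes (p : {poly int}) d : (3 < d)%N -> (size p <= uphalf d)%N ->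
  0 < p`_0 ->
  (forall i, (i.+1.*2 < d)%N -> (3 * i + 3 <= d)%N -> p`_i < p`_i.+1) ->
  (forall i, (i.+1.*2 < d)%N -> (d <= 3 * i + 1)%N -> p`_i.+1 < p`_i) ->
  (forall i, (i.+1.*2 < d)%N -> d = (3 * i + 2)%N -> p`_i != p`_i.+1) ->
  strictly_unimodal p.
Proof.
move=> d3 sp p0 up down crit.
have [r [rK hup hdown]] : exists r, [/\ (r.*2 < d)%N,
    forall i, (i < r)%N -> p`_i < p`_i.+1 &
    forall i, (r <= i)%N -> (i.+1.*2 < d)%N -> p`_i.+1 < p`_i].
  pose k := (d %/ 3)%N; have ek : k = (d %/ 3)%N by [].
  have [e|ne] := eqVneq d (3 * k + 2)%N; last first.
    exists k; split=> [|i lt|i le h]; first by lia.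
      by apply: up; lia.
    by apply: down; lia.
  have kd : (k.+1.*2 < d)%N by lia.
  have := crit k kd e; rewrite neq_lt => /orP[lt|lt].
    exists k.+1; split=> [|i ltk|i le h]; first by lia.
      have [->|ne] := eqVneq i k; first by [].
      by apply: up; lia.
    by apply: down; lia.
  exists k; split=> [|i ltk|i le h]; first by lia.
    by apply: up; lia.
  have [->|ne] := eqVneq i k; first by [].
  by apply: down; lia.
exists r; last first.
  by split=> // i le h; apply: hdown => //; have := leq_trans h sp; lia.
(* The coefficients rise up to r from a positive constant term, so r does not exceed the actual
   degree. *)
have pr : 0 < p`_r.
  elim: (r) hup => [|j IHj] // h; apply: lt_trans (IHj _) (h _ _) => // i lt.
  by apply: h; apply: ltnW.
by rewrite ltnNge; apply/negP => le; rewrite nth_default // ltxx in pr.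
Qed.

Lemma strictly_unimodalW c : strictly_unimodal c -> unimodal c.
Proof.
case=> r lt [up down]; exists r => //.
by split=> [i /up/ltW | i le h] //; apply/ltW/down.
Qed.

Lemma uniform_KL1_strictly_unimodal d : (3 < d)%N -> strictly_unimodal (uniform_KL 1 d).
Proof.
move=> d3; have eU : uniform_KL 1 d = sparse_KL 1 d 0 by rewrite /sparse_KL mulr0n subr0.
have c0 : (uniform_KL 1 d)`_0 = 1 by rewrite eU sparse_KL_coef0 //; lia.
apply: (@strictly_unimodal_modes _ d) => //; rewrite ?size_uniform_KL ?c0 //.
- move=> [|i] h le.
    rewrite c0 eU sparse_KL_coef1; last by lia.
    have : (2 * 'C(1 + d, 2) = d * (1 + d))%N by rewrite mul_bin_left bin1; lia.
    by nia.
  rewrite eU; apply: sparse_KL_increase => //; rewrite mul0r.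
  have [x ex] : exists x, (d - i.+1)%N = (x + i + i + 5)%N by exists (d - 3 * i - 6)%N; lia.
  rewrite ex /kappa_diff [kappa i.+1 _ _]/= [kappa i.+2 _ _]/= !mul0r !subr0.
  have -> : (x + i + i + 5).-1 = (x + i + i + 4)%N by lia.
  have -> : i.+2 = (i + 2)%N by lia.
  have -> : i.+1 = (i + 1)%N by lia.
  by nat_sign2 x i.
- move=> [|i] h le; first by lia.
  rewrite eU; apply: sparse_KL_decrease => //; rewrite mul0r.
  have [x ex] : exists x, (d - i.+1)%N = (x + i + 4)%N by exists (d - i - i - 5)%N; lia.
  have [y ey] : exists y, i = (x + y)%N by exists (i - x)%N; lia.
  rewrite -oppr_gt0 ex /kappa_diff [kappa i.+1 _ _]/= [kappa i.+2 _ _]/= !mul0r !subr0.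
  have -> : (x + i + 4).-1 = (x + i + 3)%N by lia.
  have -> : i.+2 = (x + y + 2)%N by lia.
  have -> : i.+1 = (x + y + 1)%N by lia.
  by rewrite ey; nat_sign2 x y.
- move=> [|i] h le; first by lia.
  rewrite eU eq_sym neq_lt; apply/orP; left; apply: sparse_KL_decrease => //; rewrite mul0r.
  have ex : (d - i.+1)%N = (i + i + 4)%N by lia.
  rewrite -oppr_gt0 ex /kappa_diff [kappa i.+1 _ _]/= [kappa i.+2 _ _]/= !mul0r !subr0.
  have -> : (i + i + 4).-1 = (i + i + 3)%N by lia.
  have -> : i.+2 = (i + 2)%N by lia.
  have -> : i.+1 = (i + 1)%N by lia.
  by nat_sign1 i.
Qed.

(** * Rank 5 and the two isolated cases of d = 3i+2 *)

Lemma bin5 m : (120 * 'C(m + 5, m) = (m + 5) * (m + 4) * (m + 3) * (m + 2) * (m + 1))%N.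
Proof.
have -> : 'C(m + 5, m) = 'C(m + 5, 5) by rewrite -[LHS]bin_sub ?leq_addr // addKn.
rewrite -[120%N]/(5`!) mulnC bin_ffact !ffactnS ffactn0 /= muln1.
by rewrite !addnS addn0 /=; ring.
Qed.

(** Here e = i+1, where the two bounds meet. *)
Lemma kappa_2_3 m : (0 < m)%N -> kappa 2 3 m = m%:R / ((m%:R + 2) * (m%:R + 3)).
Proof.
move=> m0; have := @kappa_le_ub 2 3 m isT isT m0; have := @kappa_ge_lb 2 3 m isT m0.
have M0 : 0 < m%:R :> rat by rewrite ltr0n.
have -> : kappa_lb 2 3 m%:R = m%:R / ((m%:R + 2) * (m%:R + 3)).
  by rewrite /kappa_lb; move: (m%:R : rat) M0 => M M0; field; rewrite ?gt_eqF //; lra.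
have -> : kappa_ub 2 3 m%:R = m%:R / ((m%:R + 2) * (m%:R + 3)).
  by rewrite /kappa_ub; move: (m%:R : rat) M0 => M M0; field; rewrite ?gt_eqF //; lra.
by move=> h1 h2; apply/eqP; rewrite eq_le h1 h2.
Qed.

Lemma sparse_KL5_coef1 m lambda : 24 * (sparse_KL m 5 lambda)`_1
  = (m + 5)%:R * ((m + 4)%:R * (m + 3)%:R * (m + 2)%:R - 24) - 96 * lambda%:R.
Proof.
rewrite sparse_KL_coef1 // -[5.-1]/4%N.
have : (24 * 'C(m + 5, m.+1) = (m + 5) * ((m + 4) * (m + 3) * (m + 2)))%N.
  apply/eqP; rewrite -(eqn_pmul2l (m := m.+1)) //; apply/eqP.
  have b1 : (m.+1 * 'C(m + 5, m.+1) = 5 * 'C(m + 5, m))%N by rewrite mul_bin_left addKn.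
  rewrite mulnCA b1; have := bin5 m; move: 'C(m + 5, m) => c h.
  by transitivity (120 * c)%N; [ring | rewrite h -addn1; ring].
move=> h; transitivity ((24 * 'C(m + 5, m.+1))%:R - 24 * (m + 5)%:R - 96 * lambda%:R : int).
  by rewrite natrM; ring.
by rewrite h !natrM; ring.
Qed.

Lemma sparse_KL5_coef2 m lambda : (0 < m)%N -> 12 * (sparse_KL m 5 lambda)`_2
  = (m + 5)%:R * (m + 4)%:R * (m + 1)%:R * m%:R - 60 * lambda%:R.
Proof.
move=> m0; apply: (@intr_inj rat).
rewrite rmorphM rmorphB !rmorphM /= !rmorph_nat sparse_KL_coef // kappa_2_3 //.
have : 120 * 'C(m + 5, m)%:R
    = (m%:R + 5) * (m%:R + 4) * (m%:R + 3) * (m%:R + 2) * (m%:R + 1) :> rat.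
  by have := congr1 (fun n => n%:R : rat) (bin5 m); rewrite !natrM !natrD.
have -> : weight 5 2 = 10 by rewrite /weight (_ : 'C(5, 2) * 'C((5 - 2).-1, 2) = 10)%N.
have c0 : 'C(m + 5, m)%:R != 0 :> rat by rewrite pnatr_eq0 -lt0n bin_gt0 leq_addr.
have M0 : 0 < m%:R :> rat by rewrite ltr0n.
have M2 : m%:R + 2 != 0 :> rat by rewrite gt_eqF // ltr_wpDl // ltW.
have M3 : m%:R + 3 != 0 :> rat by rewrite gt_eqF // ltr_wpDl // ltW.
have n120 : 120 != 0 :> rat by [].
move/(canRL (mulKf n120)) => {n120} e; rewrite !natrD /beta.
have -> : 'C(m + 5, m)%:R * 10 * (m%:R / ((m%:R + 2) * (m%:R + 3))
      - lambda%:R / 'C(m + 5, m)%:R * (2 * 2 * (5 - 2)%:R / ((2 + 1) * ((5 - 2)%:R + 1) * ((5 - 2)%:R - 1))))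
    = 'C(m + 5, m)%:R * 10 * (m%:R / ((m%:R + 2) * (m%:R + 3))) - 5 * lambda%:R :> rat.
  rewrite -[(5 - 2)%N]/3%N.
  move: ('C(m + 5, m)%:R : rat) c0 (lambda%:R : rat) (m%:R / _) {e} => c c0 l q.
  by field.
rewrite e; move: (m%:R : rat) M2 M3 (lambda%:R : rat) {e c0 M0} => M M2 M3 l.
by field; rewrite M2 M3.
Qed.

(** Equality means m (m+5) (m^2+m-18) = 24 lambda. The left side is negative for 1 <= m <= 3, gives
    the three exceptional lambda for m = 4, 5, 6, and contradicts the bound on lambda from m = 7
    on. *)
Lemma sparse_KL5_neq m lambda : (0 < m)%N -> (lambda * m.+1 <= 'C(m + 5, m))%N ->
  (m, lambda) \notin [:: (4, 3); (5, 25); (6, 66)]%N ->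
  (sparse_KL m 5 lambda)`_1 != (sparse_KL m 5 lambda)`_2.
Proof.
move=> m0 h ne; apply/eqP => e.
have e1 := sparse_KL5_coef1 m lambda; have e2 := sparse_KL5_coef2 lambda m0.
rewrite -e in e2.
have {e1 e2} e3 : ((m + 5) * m * (m * m + m) = (m + 5) * m * 18 + 24 * lambda)%N.
  apply/eqP; rewrite -(eqr_nat int) !natrD !natrM !natrD !natrM.
  move: e1 e2; rewrite !natrD.
  move: (m%:R : int) (lambda%:R : int) (_`_1 : int) => M l a h1 h2.
  apply/eqP; move: h1; rewrite (_ : 24 * a = 2 * (12 * a)); last by ring.
  rewrite h2 => h1; have : 2 * ((M + 5) * (M + 4) * (M + 1) * M - 60 * l)
    - ((M + 5) * ((M + 4) * (M + 3) * (M + 2) - 24) - 96 * l) = 0.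
    by rewrite h1 subrr.
  by move=> h0; apply/eqP; rewrite -subr_eq0 -h0; apply/eqP; ring.
have h120 : (120 * lambda <= (m + 5) * (m + 4) * (m + 3) * (m + 2))%N.
  rewrite -(leq_pmul2r (m := m.+1)) // -mulnA -[X in (_ <= _ * X)%N]addn1 -bin5.
  by rewrite leq_mul2l h.
have [m7|m7] := leqP 7 m.
  have [x ex] : exists x, m = (x + 7)%N by exists (m - 7)%N; lia.
  move: e3 h120; rewrite ex.
  have : (0 <= x * x * x * x)%N; have : (0 <= x * x * x)%N; have : (0 <= x * x)%N; nia.
move: ne e3; rewrite !inE !xpair_eqE.
by case: m m0 m7 {h h120 e} => [|[|[|[|[|[|[|m]]]]]]] //= _ _; lia.
Qed.

Lemma sparse_KL_plateau m d lambda i : (0 < i)%N -> (i.+1.*2 < d)%N ->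
  (sparse_KL m d lambda)`_i = (sparse_KL m d lambda)`_i.+1 ->
  'C(m + d, m)%:R * kappa_diff i (d - i) m 0
    = lambda%:R * (rho i%:R (d - i)%:R * beta (i%:R + 1) ((d - i)%:R - 1) - beta i%:R (d - i)%:R).
Proof.
move=> i0 h e; have := sparse_KL_diff m lambda i0 h; rewrite -e subrr kappa_diff_affine.
have w0 : 'C(m + d, m)%:R * weight d i != 0 by rewrite gt_eqF // sparse_KL_diff_scale_gt0 //; lia.
have c0 : 'C(m + d, m)%:R != 0 :> rat by rewrite pnatr_eq0 -lt0n bin_gt0 leq_addr.
move/esym/eqP; rewrite mulf_eq0 (negPf w0) /= subr_eq0 => /eqP ->.
by rewrite mulrA mulrCA mulfV // mulr1.
Qed.

Lemma lambda_quotient (c l k b p q : rat) : 0 < b -> c * k = l * b -> q * c * k = p * b ->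
  q * l = p.
Proof.
move=> b0 e1 e2; have bn : b != 0 by rewrite gt_eqF.
apply: (mulIf bn).
by rewrite -e2 -!mulrA e1.
Qed.

Lemma eq_of_sub_ge0 (a b : rat) : 0 <= a - b -> 0 <= b - a -> a = b.
Proof. by rewrite !subr_ge0 => h1 h2; apply/eqP; rewrite eq_le h1 h2. Qed.

(** The difference vanishes at lambda = 247/3, below the bound C(13,5)/9 = 143, so both signs are
    compatible with the bounds and only integrality excludes equality. *)
Lemma sparse_KL8_neq lambda : (sparse_KL 5 8 lambda)`_2 != (sparse_KL 5 8 lambda)`_3.
Proof.
apply/eqP => /(@sparse_KL_plateau 5 8 lambda 2 isT isT).
rewrite -[(8 - 2)%N]/6%N => h.
have b0 : 0 < rho 2%:R 6%:R * beta (2%:R + 1) (6%:R - 1) - beta 2%:R 6%:R.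
  by rewrite /rho /beta; rational_sign ([::] : seq rat).
have e1 : 3%:R * 'C(5 + 8, 5)%:R * kappa_diff 2 6 5 0
   = 247%:R * (rho 2%:R 6%:R * beta (2%:R + 1) (6%:R - 1) - beta 2%:R 6%:R).
  rewrite /kappa_diff; cbn [kappa Nat.pred]; rewrite /rho /beta.
  by apply: eq_of_sub_ge0; rational_sign ([::] : seq rat).
have := lambda_quotient b0 h e1; clear=> /eqP; rewrite -natrM eqr_nat; lia.
Qed.

(** Again the zero, 10336/11 with 10336 = 32 * 323, lies below the bound C(17,6)/12 and is not an
    integer. *)
Lemma sparse_KL11_neq lambda : (sparse_KL 6 11 lambda)`_3 != (sparse_KL 6 11 lambda)`_4.
Proof.
apply/eqP => /(@sparse_KL_plateau 6 11 lambda 3 isT isT).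
rewrite -[(11 - 3)%N]/8%N => h.
have b0 : 0 < rho 3%:R 8%:R * beta (3%:R + 1) (8%:R - 1) - beta 3%:R 8%:R.
  by rewrite /rho /beta; rational_sign ([::] : seq rat).
have e1 : 11%:R * 'C(6 + 11, 6)%:R * kappa_diff 3 8 6 0
   = (32 * 323)%:R * (rho 3%:R 8%:R * beta (3%:R + 1) (8%:R - 1) - beta 3%:R 8%:R).
  rewrite /kappa_diff; cbn [kappa Nat.pred]; rewrite /rho /beta.
  by apply: eq_of_sub_ge0; rational_sign ([::] : seq rat).
have := lambda_quotient b0 h e1; clear=> /eqP; rewrite -natrM eqr_nat; lia.
Qed.

Lemma ratio_bound (l c n : nat) : (0 < c)%N -> (l * n.+1 <= c)%N ->
  l%:R / c%:R * (n%:R + 1) <= 1 :> rat.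
Proof.
move=> c0 h; rewrite mulrAC ler_pdivrMr ?ltr0n // mul1r natr1 -natrM ler_nat; exact: h.
Qed.

Lemma sparse_KL_strictly_unimodal m d lambda : (0 < m)%N -> (4 < d)%N ->
  (lambda * m.+1 <= 'C(m + d, m))%N -> (lambda * d.+1 <= 'C(m + d, m))%N ->
  (m, d, lambda) \notin [:: (4, 5, 3); (5, 5, 25); (6, 5, 66)]%N ->
  strictly_unimodal (sparse_KL m d lambda).
Proof.
move=> m0 d4 hm hd ne.
have c0 : (0 < 'C(m + d, m))%N by rewrite bin_gt0 leq_addr.
have l0 : 0 <= lambda%:R / 'C(m + d, m)%:R :> rat by rewrite divr_ge0 ?ler0n.
have lm := ratio_bound c0 hm; have ld := ratio_bound c0 hd.
have [m1|m1] := leqP m 1.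
  have em : m = 1%N by lia.
  have l1 : (lambda <= 1)%N.
    by move: hd; rewrite em bin1 add1n -{2}[d.+1]mul1n leq_pmul2r.
  have [->|->] : lambda = 0%N \/ lambda = 1%N by lia.
    by rewrite em /sparse_KL mulr0n subr0; apply: uniform_KL1_strictly_unimodal; lia.
  rewrite em /sparse_KL /relaxation_KL mulr1n opprB addrC subrK.
  by apply: uniform_KL1_strictly_unimodal; lia.
apply: (@strictly_unimodal_modes _ d); first by lia.
- exact: size_sparse_KL.
- by rewrite sparse_KL_coef0 //; lia.
- move=> [|i] h le; first exact: sparse_KL_first_step.
  apply: sparse_KL_increase => //; apply: kappa_diff_pos_full => //; first by lia.
  by have -> : (d - i.+1 + i.+1 = d)%N by lia.
- move=> i h le; have i0 : (0 < i)%N by lia.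
  apply: sparse_KL_decrease => //; apply: kappa_diff_neg => //; try lia.
  by have -> : (d - i + i = d)%N by lia.
- move=> i h ed; have i0 : (0 < i)%N by lia.
  have [i1|i1] := leqP i 1.
    have ei : i = 1%N by lia.
    have e5 : d = 5%N by lia.
    move: ne hm; rewrite ei e5 => ne hm; apply: sparse_KL5_neq => //.
    by move: ne; rewrite !inE !xpair_eqE eqxx !andbT.
  have ee : (d - i = i.*2.+2)%N by lia.
  have ei : (i.*2.+2 + i = d)%N by lia.
  have [mi|mi] := leqP m (i + 2).
    rewrite eq_sym neq_lt; apply/orP; left; apply: sparse_KL_decrease => //.
    by rewrite ee; apply: critical_diff_neg; rewrite ?m0.
  have [[e2 em]|ne1] := eqVneq (i, m) (2, 5)%N.
    by have -> : d = 8%N by [lia]; rewrite e2 em sparse_KL8_neq.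
  have [[e2 em]|ne2] := eqVneq (i, m) (3, 6)%N.
    by have -> : d = 11%N by [lia]; rewrite e2 em sparse_KL11_neq.
  rewrite neq_lt; apply/orP; left; apply: sparse_KL_increase => //.
  rewrite ee; apply: critical_diff_pos => //; try exact/eqP; first by lia.
  by rewrite ei.
Qed.

Lemma unimodal_size2 c : (0 < size c <= 2)%N -> unimodal c.
Proof.
case: c => [|a [|b [|]]] //= _.
  by exists 0%N => //; split.
have [ab|ba] := lerP a b.
  by exists 1%N => //; split=> [[|]|[|]].
by exists 0%N => //; split=> // [[|]] // _ _; apply: ltW.
Qed.

Lemma sparse_KL_m0 d : (1 < d)%N -> (size (sparse_KL 0 d 0) <= 1)%N.
Proof.
move=> d1; apply/leq_sizeP => -[|i] // _.
have [h|h] := ltnP i.+1.*2 d; last first.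
  by rewrite nth_default //; apply: leq_trans (size_sparse_KL _ _ _) _; lia.
by apply: (@intr_inj rat); rewrite sparse_KL_coef //= !mul0r subrr mulr0.
Qed.

Theorem theorem1p1 (T : finType) (M : matroid T) (m d lambda : nat)
    (M_loopless : loopless M) (M_sparse_paving : sparse_paving M)
    (M_rank : rank M = d) (M_card : #|ground M| = (m + d)%N)
    (M_lambda : #|circuit_hyperplanes M| = lambda) :
  [/\ unimodal (KLpoly M),
      (5 <= d)%N -> (1 <= m)%N ->
        (m, d, lambda) \notin [:: (4, 5, 3); (5, 5, 25); (6, 5, 66)]%N ->
        strictly_unimodal (KLpoly M)
    & (m, d, lambda) \in [:: (4, 5, 3); (5, 5, 25); (6, 5, 66)]%N ->
        size (KLpoly M) = 3%N /\ (KLpoly M)`_1 = (KLpoly M)`_2].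
Proof.
have nuM := sparse_pavingP M_sparse_paving.
(* Rank 0 is separate because [uniform_KL m 0] is 0, whereas the polynomial is 1. *)
have [d0|d0] := posnP d.
  rewrite KLpoly_rank0 ?M_rank // d0; split=> //; last by rewrite !inE !xpair_eqE !andbF.
  by apply: unimodal_size2; rewrite size_poly1.
have eP : KLpoly M = sparse_KL m d lambda.
  by rewrite (KLpoly_sparse_paving (m := m)) ?M_rank // M_lambda.
have hm : (lambda * m.+1 <= 'C(m + d, m))%N.
  have := ch_lower_bound nuM; rewrite M_rank M_lambda M_card => /(_ d0).
  have -> : 'C(m + d, d.-1) = 'C(m + d, m.+1) by rewrite -[RHS]bin_sub; [congr 'C(_, _)|]; lia.
  have := mul_bin_left (m + d) m; rewrite addKn => e h.
  by rewrite -(leq_pmul2l d0) -e mulnA [(d * lambda)%N]mulnC mulnC leq_pmul2l.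
have hd : (0 < m)%N -> (lambda * d.+1 <= 'C(m + d, m))%N.
  move=> m0; have := ch_upper_bound nuM; rewrite M_rank M_lambda M_card addnK => h.
  have := mul_bin_left (m + d) d; rewrite addnK => e.
  have -> : 'C(m + d, m) = 'C(m + d, d) by rewrite -[LHS]bin_sub ?leq_addr // addKn.
  by rewrite -(leq_pmul2l m0) -e mulnA [(m * lambda)%N]mulnC mulnC leq_pmul2l.
have strict : (4 < d)%N -> (0 < m)%N ->
    (m, d, lambda) \notin [:: (4, 5, 3); (5, 5, 25); (6, 5, 66)]%N ->
    strictly_unimodal (KLpoly M).
  by move=> d4 m0 ne; rewrite eP; apply: sparse_KL_strictly_unimodal; rewrite ?hd.
have except : (m, d, lambda) \in [:: (4, 5, 3); (5, 5, 25); (6, 5, 66)]%N ->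
    [/\ d = 5, (0 < m)%N, (KLpoly M)`_1 = (KLpoly M)`_2 & 0 < (KLpoly M)`_2].
  have c1 := sparse_KL5_coef1; have c2 := sparse_KL5_coef2.
  rewrite !inE !xpair_eqE => /or3P[] /andP[/andP[/eqP em /eqP e5] /eqP el];
    rewrite eP em e5 el; split=> //;
    have := c1 m lambda; have := c2 m lambda; rewrite em el => /(_ isT);
    move: (_`_1) (_`_2) => a b; rewrite ?natrD; lia.
split=> //; last first.
  move=> /except[e5 m0 e12 p2]; split=> //; apply/eqP; rewrite eqn_leq; apply/andP; split.
    by rewrite eP (leq_trans (size_sparse_KL _ _ _)) // e5.
  by rewrite ltnNge; apply/negP => le; rewrite nth_default // ltxx in p2.
have [d4|d4] := leqP d 4.
  apply: unimodal_size2; rewrite eP; apply/andP; split; last first.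
    by apply: leq_trans (size_sparse_KL _ _ _) _; lia.
  have [d1|d1] := leqP d 1.
    have := KLpoly_rank1 M_loopless; rewrite eP M_rank => -> //; last by lia.
    by rewrite size_poly1.
  rewrite ltnNge; apply/negP => le; have := sparse_KL_coef0 m lambda d1.
  by rewrite nth_default.
have [m0|m0] := posnP m.
  have l0 : lambda = 0%N.
    apply/eqP; rewrite -M_lambda cards_eq0; apply/eqP/setP => C; rewrite in_set0.
    apply/negP => hC; have := ground_notin_ch M; suff -> : ground M = C by rewrite hC.
    apply/esym/eqP; rewrite eqEcard ch_ground // (ch_card nuM hC) M_rank M_card m0 add0n leqnn //.
  rewrite eP m0 l0; apply: unimodal_size2; apply/andP; split; last first.
    by apply: leq_trans (sparse_KL_m0 _) _ => //; lia.
  rewrite ltnNge; apply/negP => le; have := @sparse_KL_coef0 0 d 0.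
  by rewrite nth_default // => /(_ ltac:(lia)).
have [ex|ne] := boolP ((m, d, lambda) \in [:: (4, 5, 3); (5, 5, 25); (6, 5, 66)]%N); last first.
  exact/strictly_unimodalW/strict.
have [e5 _ e12 p2] := except ex.
have s3 : (size (KLpoly M) <= 3)%N by rewrite eP (leq_trans (size_sparse_KL _ _ _)) // e5.
have lt01 : (KLpoly M)`_0 < (KLpoly M)`_1.
  by rewrite eP; apply: sparse_KL_first_step => //; apply: hd.
exists 1%N.
  rewrite ltnNge; apply/negP => le; move: p2; rewrite -e12 nth_default ?ltxx //.
split=> [[|]|[|[|i]]] // => [_|_ _|_ lt]; [exact: ltW | by rewrite e12 |].
by have := leq_trans lt s3.
Qed.
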